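(* There exists a Schur function $\phi$ such that $C_\phi$ is compact on $\mathcal{D}_\ast$, but $C_\phi$ belongs to no Schatten class $S_p(\mathcal{D}_\ast)$, $0<p<\infty$.
   Context: $\mathbb{D}$ is the open unit disk and $A$ the normalized area measure $dx\,dy/\pi$ on $\mathbb{D}$. A Schur function is an analytic map $\phi\colon\mathbb{D}\to\mathbb{D}$; $C_\phi(f)=f\circ\phi$. The Dirichlet space $\mathcal{D}_\ast$ is the Hilbert space of analytic functions $f$ on $\mathbb{D}$ with $f(0)=0$ and $\|f\|^2=\int_{\mathbb{D}}|f'|^2\,dA<\infty$. $S_p(\mathcal{D}_\ast)$ is the Schatten class of operators on $\mathcal{D}_\ast$ whose singular numbers are in $\ell^p$. ''Compact on $\mathcal{D}_\ast$'' includes that $C_\phi$ maps $\mathcal{D}_\ast$ into itself. *)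

(* Defs.v *)
From HB Require Import structures.
From mathcomp Require Import all_boot all_order all_algebra.
From mathcomp Require Import complex.
From mathcomp Require Import all_classical all_reals all_analysis.

Set Implicit Arguments.
Unset Strict Implicit.
Unset Printing Implicit Defensive.

Import Order.TTheory GRing.Theory Num.Theory.
Import numFieldNormedType.Exports.

Local Open Scope classical_set_scope.
Local Open Scope ring_scope.
Local Open Scope complex_scope.

(* Operators on a Hilbert space [H] given as a linear subspace of a
   [C]-module [V], with inner product [ip] (linear in the first variable).
   An operator on [H] is represented by a map [T : V -> V] whose values
   outside [H] are irrelevant. *)
Section operators.
Context {R : realType} {V : lmodType R[i]}.
Variables (H : set V) (ip : V -> V -> R[i]).

Definition hnorm (f : V) : R := Num.sqrt (complex.Re (ip f f)).

Definition is_operator (T : V -> V) : Prop :=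
  (forall f, H f -> H (T f)) /\
  (forall (a : R[i]) f g, H f -> H g -> T (a *: f + g) = a *: T f + T g).

Definition hcvg (u : nat -> V) (g : V) : Prop :=
  (fun n => hnorm (u n - g)) @ \oo --> (0 : R).

Definition is_compact_operator (T : V -> V) : Prop :=
  is_operator T /\
  forall u : nat -> V,
    (forall n, H (u n)) -> (exists M : R, forall n, hnorm (u n) <= M) ->
    exists k : nat -> nat, {homo k : m n / (m < n)%N} /\
      exists g, H g /\ hcvg (fun n => T (u (k n))) g.

Definition is_adjoint (T S : V -> V) : Prop :=
  is_operator S /\ forall f g, H f -> H g -> ip (T f) g = ip f (S g).

Definition orthonormal_seq (e : nat -> V) : Prop :=
  (forall n, H (e n)) /\ forall m n, ip (e m) (e n) = (m == n)%:R.

(* [s] enumerates in nonincreasing order, with multiplicity, the square roots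
   of the eigenvalues of [T^* T]: the last clause says that [T^* T], whose
   kernel is that of [T], has no further nonzero eigenvalue. For a compact [T]
   on an infinite-dimensional [H], the spectral theorem shows that exactly one
   such [s] exists, with trailing zeros when [T] has finite rank. *)
Definition singular_numbers (T : V -> V) (s : nat -> R) : Prop :=
  [/\ nonincreasing_seq s, forall n, 0 <= s n &
    exists S e, [/\ is_adjoint T S, orthonormal_seq e,
      forall n, S (T (e n)) = (s n ^+ 2)%:C *: e n &
      forall f, H f -> (forall n, ip f (e n) = 0) -> T f = 0]].

Definition schatten_class (p : R) (T : V -> V) : Prop :=
  is_compact_operator T /\
  exists s, singular_numbers T s /\
    (\sum_(0 <= n <oo) (s n `^ p)%:E < +oo)%E.

End operators.

Section dirichlet.
Context {R : realType}.
Local Notation C := R[i].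

Definition disk : set C := [set z | `|z| < 1].

Definition holomorphic_on_disk (f : C -> C) : Prop :=
  forall z, disk z -> derivable (f : C^o -> C^o) z 1.

Definition complex_derivative (f : C -> C) (z : C) : C :=
  derive1 (f : C^o -> C^o) z.

Definition schur_function (phi : C -> C) : Prop :=
  holomorphic_on_disk phi /\ forall z, disk z -> disk (phi z).

Definition plane_disk : set (R * R) := [set p | disk (p.1 +i* p.2)].

Local Notation lebesgue2 := (@lebesgue_measure R \x @lebesgue_measure R)%E.

Definition dirichlet_energy (f : C -> C) : \bar R :=
  ((pi^-1)%:E * \int[lebesgue2]_(p in plane_disk)
     (complex.Re `|complex_derivative f (p.1 +i* p.2)| ^+ 2)%:E)%E.

Definition area_integral (h : C -> C) : C :=
  (pi^-1 * Rintegral lebesgue2 plane_disk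
             (fun p => complex.Re (h (p.1 +i* p.2)))) +i*
  (pi^-1 * Rintegral lebesgue2 plane_disk
             (fun p => complex.Im (h (p.1 +i* p.2)))).

(* A function on the disk is represented by its extension by [0] to [C], so
   that equality in the Dirichlet space is equality of functions [C -> C]. *)
Definition dirichlet_space : set (C -> C) :=
  [set f | [/\ holomorphic_on_disk f, forall z, ~ disk z -> f z = 0,
             f 0 = 0 & (dirichlet_energy f < +oo)%E]].

Definition dirichlet_ip (f g : C -> C) : C :=
  area_integral (fun z => complex_derivative f z * (complex_derivative g z)^*).

Definition composition_operator (phi : C -> C) (f : C -> C) : C -> C :=
  fun z => if `|z| < 1 then f (phi z) else 0.

End dirichlet.

(* Main.v *)
(** Put [delta k = 4^-k] and let [C k] decrease to [0] with [C 0 = 1] and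
[C k.+1 = C k * (1 - theta k)], where [theta k ~ 1 / log k] tends to [0] but has
[sum_k theta k ^ p = oo] for every [p].  The symbol is the convex combination
[phi z = sum_k c k * (delta k * z / (1 + delta k - z))] with weights
[c k = C k - C k.+1]: each term is a Moebius self-map of the disk fixing [0] and
close to [1] only within distance [delta k] of the point [1].

On the shell [|1 - z| ~ delta m] one has [1 - |phi z| ~ |1 - phi z| ~ C m] and
[|phi' z| <= const * c m / delta m].  The mean value property of [f'] on a square
of side [~ C m] around [phi z] bounds the energy of [f o phi] on that shell by
[theta m ^ 2] times the energy of [f] on a region seen by few other shells; hence
the part of [C_phi] carried by [|1 - z| <= delta M] has norm at most
[const * theta M ^ (1/2)], and normal families give compactness.

Conversely, functions [f_m] with [f_m' ~ C m ^ 3 / (1 + C m - z) ^ 4] have bounded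
norms, are almost orthogonal ([|<f_m, f_k>| <= const * C k / C m]) and satisfy
[|C_phi f_m| >= const * theta m].  Splitting the sum of [|C_phi f_m|^2] over [m < N]
along the first [L] singular vectors, with the Boas-Bellman inequality on those, gives
[N * theta N ^ 2 <= const * (L / theta N + N * s L ^ 2)].  A Schatten condition makes
[s L] so small for [L] a fixed power of [1 / theta N] that this fails for large [N]. *)

Require Import Defs.
From HB Require Import structures.
From mathcomp Require Import all_boot all_order all_algebra.
From mathcomp Require Import complex.
From mathcomp Require Import all_classical all_reals all_analysis.
From mathcomp Require Import measurable_realfun.
From mathcomp Require Import ring lra zify.

Set Implicit Arguments.
Unset Strict Implicit.
Unset Printing Implicit Defensive.

Import Order.TTheory GRing.Theory Num.Theory.
Import numFieldNormedType.Exports.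
Import Normc.

Local Open Scope classical_set_scope.
Local Open Scope ring_scope.
Local Open Scope complex_scope.

(** The construction rests on two unequal rates. The radii [delta k] shrink by the factor 4 while
    the weights at most halve, so at scale [delta m] the derivative of the symbol is governed by the
    single term [m]. The remainders shrink only by [1 - theta k]: about [1 / theta m] consecutive
    shells land at comparable distances from the circle, and this multiplicity turns the factor
    [theta ^ 2] of one shell into the [theta] of the upper bound. The lower bound keeps only
    [theta ^ 2]; since [1 / theta] is logarithmic, this loss and that from imperfect orthogonality
    are powers of [log N] set against [N]. Holomorphy is bare differentiability at each point, so
    Goursat's theorem, Cauchy's estimates and the differentiability of [f'] come before the energies
    are shown measurable. Squares replace circles: their sides are parallel to the axes, and
    Tonelli's theorem turns boundary means into area means without polar coordinates. Most constants
    are generous, real and imaginary parts being estimated separately; only the bound that keeps the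
    symbol inside the disk must be sharp. *)

Section complex_modulus.
Context {R : realType}.
Local Notation C := R[i].
Implicit Types (z w : C) (x y : R).

Lemma norm_normc z : `|z| = (normc z)%:C.
Proof. by []. Qed.

Lemma normc_ge0 z : 0 <= normc z.
Proof. by case: z => a b; rewrite sqrtr_ge0. Qed.

Lemma normcD z w : normc (z + w) <= normc z + normc w.
Proof. exact: le_normcD. Qed.

Lemma normcB z w : normc (z - w) <= normc z + normc w.
Proof. by rewrite -(normcN w); exact: le_normcD. Qed.

Lemma normc_dist z w : normc (z - w) = normc (w - z).
Proof. by rewrite -(normcN (z - w)) opprB. Qed.

Lemma normcBD v z w : normc (z - w) <= normc (z - v) + normc (v - w).
Proof. by rewrite (_ : z - w = z - v + (v - w)); [exact: normcD|ring]. Qed.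

Lemma normc_real x : normc x%:C = `|x|.
Proof. by rewrite /= expr0n /= addr0 sqrtr_sqr. Qed.

Lemma normc_sqr z : normc z ^+ 2 = complex.Re z ^+ 2 + complex.Im z ^+ 2.
Proof. by case: z => a b /=; rewrite sqr_sqrtr ?addr_ge0 ?sqr_ge0. Qed.

Lemma normcX z n : normc (z ^+ n) = normc z ^+ n.
Proof.
elim: n => [|n IH]; first by rewrite !expr0 -[1]/(1%:C) normc_real normr1.
by rewrite !exprS normcM IH.
Qed.

Lemma Re_le_normc z : `|complex.Re z| <= normc z.
Proof.
rewrite -(ler_pXn2r (n := 2)) ?nnegrE ?normc_ge0 //.
by rewrite normc_sqr real_normK ?num_real // lerDl sqr_ge0.
Qed.

Lemma Im_le_normc z : `|complex.Im z| <= normc z.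
Proof.
rewrite -(ler_pXn2r (n := 2)) ?nnegrE ?normc_ge0 //.
by rewrite normc_sqr real_normK ?num_real // lerDr sqr_ge0.
Qed.

Lemma normc_le z : normc z <= `|complex.Re z| + `|complex.Im z|.
Proof.
rewrite [X in normc X]complexE.
apply: (le_trans (normcD _ _)); rewrite normcM !normc_real.
rewrite (_ : normc 'i = 1); last by rewrite /= expr0n add0r expr1n sqrtr1.
by rewrite mul1r.
Qed.

Lemma normc_eq0 z : (normc z == 0) = (z == 0).
Proof.
by apply/eqP/eqP => [/eq0_normc //|->]; rewrite -[0]/(0%:C) normc_real normr0.
Qed.

Lemma normc_gt0 z : (0 < normc z) = (z != 0).
Proof. by rewrite lt_neqAle normc_ge0 andbT eq_sym normc_eq0. Qed.

Lemma Re_conj_mul z : complex.Re (z * z^*) = normc z ^+ 2.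
Proof. by rewrite normc_sqr; case: z => a b /=; ring. Qed.

Lemma normc_conj z : normc z^* = normc z.
Proof. by case: z => a b /=; rewrite sqrrN. Qed.

Lemma Re_real x : complex.Re x%:C = x. Proof. by []. Qed.
Lemma Re_addc z w : complex.Re (z + w) = complex.Re z + complex.Re w.
Proof. by case: z; case: w. Qed.
Lemma Im_addc z w : complex.Im (z + w) = complex.Im z + complex.Im w.
Proof. by case: z; case: w. Qed.
Lemma Re_oppc z : complex.Re (- z) = - complex.Re z.
Proof. by case: z. Qed.
Lemma Im_oppc z : complex.Im (- z) = - complex.Im z.
Proof. by case: z. Qed.
Lemma Re_mulc z w : complex.Re (z * w) =
  complex.Re z * complex.Re w - complex.Im z * complex.Im w.
Proof. by case: z; case: w. Qed.
Lemma Im_mulc z w : complex.Im (z * w) =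
  complex.Re z * complex.Im w + complex.Im z * complex.Re w.
Proof. by case: z; case: w. Qed.

Lemma diskE z : disk z <-> normc z < 1.
Proof. by rewrite /disk /= norm_normc -[1]/(1%:C) ltcR. Qed.

End complex_modulus.

(** * Complex derivatives *)

Section complex_differentiability.
Context {R : realType}.
Local Notation C := R[i].
Implicit Types (f g : C -> C) (z l : C).

(** Complex differentiability in epsilon-delta form with a real-valued modulus. The non-strict
    inequality covers [h = 0], so punctured neighbourhoods never appear. *)
Definition cdiff f z l := forall e : R, 0 < e -> exists2 d : R, 0 < d &
  forall h, normc h < d -> normc (f (z + h) - f z - l * h) <= e * normc h.

Lemma near0_normc (P : C -> Prop) :
  (\forall h \near nbhs (0 : C^o), P h) <->
  exists2 d : R, 0 < d & forall h, normc h < d -> P h.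
Proof.
split.
  move/nbhs_ballP => [[d0 d1] /=]; rewrite ltcE /= => /andP[/eqP d10 d0p] H.
  exists d0 => // h hd; apply: H; rewrite /ball /= sub0r normrN.
  by rewrite norm_normc d10 ltcR.
move=> [d d0 H]; apply/nbhs_ballP; exists d%:C => /=; first by rewrite ltcR.
by move=> h; rewrite /ball /= sub0r normrN norm_normc ltcR => /H.
Qed.

Lemma cdiff_is_cvg f z l : cdiff f z l <->
  (fun h : C^o => h^-1 *: ((f : C^o -> C^o) (h + z) - f z)) @ (0 : C^o)^' --> (l : C^o).
Proof.
split=> [H|].
  apply/cvgrPdist_le => -[e0 e1]; rewrite ltcE /= => /andP[/eqP e10 e0p].
  rewrite e10 {e10 e1}.
  have [d d0 Hd] := H _ e0p.
  rewrite /dnbhs near_withinE; apply/near0_normc; exists d => // h hd hn0.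
  have := Hd h hd; rewrite (addrC z) norm_normc lecR => Hh.
  have h0 : 0 < normc h by rewrite normc_gt0.
  rewrite normc_dist -(ler_pM2r h0) -normcM; apply: le_trans Hh.
  rewrite (_ : _ * h = f (h + z) - f z - l * h) // mulrBl.
  by rewrite [_ *: _]/(_ * _) mulrAC mulVf // mul1r.
move/cvgrPdist_le => H e e0.
have e0' : 0 < e%:C by rewrite ltcR.
have := H _ e0'; rewrite /dnbhs near_withinE => /near0_normc [d d0 Hd].
exists d => // h hd; have [->|hn0] := eqVneq h 0.
  by rewrite addr0 mulr0 subrr subr0 -[0]/(0%:C) !normc_real normr0 mulr0.
have := Hd h hd hn0; rewrite norm_normc lecR => Hh.
have h0 : 0 < normc h by rewrite normc_gt0.
rewrite normc_dist -(ler_pM2r h0) -normcM in Hh; apply: le_trans Hh.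
rewrite (addrC z) (_ : _ * h = f (h + z) - f z - l * h) // mulrBl.
by rewrite [_ *: _]/(_ * _) mulrAC mulVf // mul1r.
Qed.

Lemma derivable_cdiff f z : derivable (f : C^o -> C^o) z 1 ->
  cdiff f z (complex_derivative f z).
Proof.
move=> H; apply/cdiff_is_cvg; rewrite /complex_derivative /derive1.
move: H; rewrite /derivable.
set g1 := (fun h => _); set g2 := (fun h => _).
have -> : g1 = g2 by apply/funext => h; rewrite /g1 /g2 /= [h%:A](mulr1).
by [].
Qed.

Lemma cdiff_derivable f z l : cdiff f z l -> derivable (f : C^o -> C^o) z 1.
Proof.
move/cdiff_is_cvg => H; rewrite /derivable; apply/cvg_ex; exists l.
move: H; set g1 := (fun h => _); set g2 := (fun h => _).
suff -> : g1 = g2 by [].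
by apply/funext => h; rewrite /g1 /g2 /= [h%:A](mulr1).
Qed.

Lemma cdiff_derivative f z l : cdiff f z l -> complex_derivative f z = l.
Proof.
move/cdiff_is_cvg => H; rewrite /complex_derivative /derive1.
exact: (cvg_lim (@norm_hausdorff _ (C^o : normedModType C)) H).
Qed.

Lemma holomorphicP f : holomorphic_on_disk f <->
  forall z, normc z < 1 -> cdiff f z (complex_derivative f z).
Proof.
split=> H z /diskE Hz; first exact/derivable_cdiff/H.
exact: (cdiff_derivable (H z Hz)).
Qed.

Lemma cdiff_cst c z : cdiff (fun=> c) z 0.
Proof.
move=> e e0; exists 1 => // h _.
rewrite mul0r subr0 subrr -[X in normc X]/(0%:C) normc_real normr0.
by rewrite mulr_ge0 ?normc_ge0 // ltW.
Qed.

Lemma cdiff_id z : cdiff id z 1.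
Proof.
move=> e e0; exists 1 => // h _.
rewrite mul1r (addrC z) addrK subrr -[X in normc X]/(0%:C) normc_real normr0.
by rewrite mulr_ge0 ?normc_ge0 // ltW.
Qed.

Lemma cdiff_lip f z l : cdiff f z l -> exists2 d : R, 0 < d &
  forall h, normc h < d -> normc (f (z + h) - f z) <= (normc l + 1) * normc h.
Proof.
move=> H; have [d d0 Hd] := H 1 ltr01; exists d => // h hd.
have := Hd h hd; rewrite mul1r => Hh.
rewrite -[_ - f z](subrK (l * h)) mulrDl addrC mul1r -normcM.
have := normcD (l * h) (f (z + h) - f z - l * h); lra.
Qed.

Lemma cdiffD f g z l m : cdiff f z l -> cdiff g z m ->
  cdiff (fun w => f w + g w) z (l + m).
Proof.
move=> Hf Hg e e0; have e2 : 0 < e / 2 by rewrite divr_gt0.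
have [d d0 Hd] := Hf _ e2; have [d' d'0 Hd'] := Hg _ e2.
exists (Num.min d d'); first by rewrite lt_min d0.
move=> h; rewrite lt_min => /andP[/Hd h1 /Hd' h2].
rewrite (_ : _ - _ = (f (z + h) - f z - l * h) + (g (z + h) - g z - m * h)).
  by apply: (le_trans (normcD _ _)); lra.
by ring.
Qed.

Lemma cdiffM f g z l m : cdiff f z l -> cdiff g z m ->
  cdiff (fun w => f w * g w) z (l * g z + f z * m).
Proof.
move=> Hf Hg e e0.
pose A : R := 1 + normc (f z) + normc (g z) + (normc l + 1).
have A1 : 1 <= A by rewrite /A; have := normc_ge0 (f z); have := normc_ge0 (g z); have := normc_ge0 l; lra.
have eA : 0 < e / (4 * A) by rewrite divr_gt0 //; lra.
have [d d0 Hd] := Hf _ eA; have [d' d'0 Hd'] := Hg _ eA.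
have [d1 d10 Hd1] := cdiff_lip Hf.
have [d2 d20 Hd2] := cdiff_lip Hg.
pose d3 := e / (4 * A * (normc m + 1)).
have m0 := normc_ge0 m.
have d30 : 0 < d3 by rewrite divr_gt0 // mulr_gt0 //; lra.
exists (Num.min (Num.min d d') (Num.min (Num.min d1 d2) d3)).
  by rewrite !lt_min d0 d'0 d10 d20 d30.
move=> h; rewrite !lt_min => /andP[/andP[/Hd h1 /Hd' h2] /andP[/andP[/Hd1 h3 /Hd2 h4] h5]].
set F := f (z + h); set G := g (z + h).
rewrite (_ : _ - _ = (F - f z - l * h) * g z + f z * (G - g z - m * h) + (F - f z) * (G - g z)); last by ring.
have H0 := normc_ge0 h.
have HA : e / (4 * A) * A = e / 4 by field; lra.
have k1 : normc ((F - f z - l * h) * g z) <= e / 4 * normc h.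
  rewrite normcM; apply: (le_trans (ler_wpM2r (normc_ge0 _) h1)).
  rewrite mulrAC ler_wpM2r // -HA ler_wpM2l ?ltW //.
  by rewrite /A; have := normc_ge0 (f z); have := normc_ge0 l; lra.
have k2 : normc (f z * (G - g z - m * h)) <= e / 4 * normc h.
  rewrite normcM; apply: (le_trans (ler_wpM2l (normc_ge0 _) h2)).
  rewrite mulrA ler_wpM2r // -HA mulrC ler_wpM2l ?ltW //.
  by rewrite /A; have := normc_ge0 (g z); have := normc_ge0 l; lra.
have k3 : normc ((F - f z) * (G - g z)) <= e / 4 * normc h.
  rewrite normcM; apply: (le_trans (ler_pM (normc_ge0 _) (normc_ge0 _) h3 h4)).
  rewrite mulrA ler_wpM2r //.
  rewrite (_ : e / 4 = A * d3 * (normc m + 1)); last by rewrite /d3; field; lra.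
  rewrite ler_wpM2r //; first lra.
  apply: ler_pM => //; last exact: ltW.
    by rewrite addr_ge0 ?normc_ge0.
  by rewrite /A; have := normc_ge0 (f z); have := normc_ge0 (g z); lra.
apply: (le_trans (normcD _ _)); apply: (le_trans (lerD (normcD _ _) (lexx _))).
apply: (le_trans (lerD (lerD k1 k2) k3)); rewrite -!mulrDl ler_wpM2r //; lra.
Qed.

Lemma cdiffMl c f z l : cdiff f z l -> cdiff (fun w => c * f w) z (c * l).
Proof.
by move=> H; have := cdiffM (cdiff_cst c z) H; rewrite mul0r add0r.
Qed.

Lemma cdiffN f z l : cdiff f z l -> cdiff (fun w => - f w) z (- l).
Proof.
move=> H e e0; have [d d0 Hd] := H _ e0; exists d => // h /Hd.
rewrite -normcN; congr (normc _ <= _); ring.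
Qed.

Lemma cdiffB f g z l m : cdiff f z l -> cdiff g z m ->
  cdiff (fun w => f w - g w) z (l - m).
Proof. by move=> Hf /cdiffN; apply: cdiffD. Qed.

Lemma cdiff_comp f g z l m : cdiff g z m -> cdiff f (g z) l ->
  cdiff (fun w => f (g w)) z (l * m).
Proof.
move=> Hg Hf e e0.
have l0 := normc_ge0 l; have m0 := normc_ge0 m.
have e1 : 0 < e / (2 * (normc m + 1)) by rewrite divr_gt0 //; lra.
have e2 : 0 < e / (2 * (normc l + 1)) by rewrite divr_gt0 //; lra.
have [d d0 Hd] := Hf _ e1; have [d' d'0 Hd'] := Hg _ e2.
have [d1 d10 Hd1] := cdiff_lip Hg.
pose d2 := d / (normc m + 1).
have d20 : 0 < d2 by rewrite divr_gt0 //; lra.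
exists (Num.min d' (Num.min d1 d2)); first by rewrite !lt_min d'0 d10.
move=> h; rewrite !lt_min => /andP[/Hd' h1 /andP[/Hd1 h2 h3]].
set k := g (z + h) - g z in h1 h2.
have kd : normc k < d.
  apply: (le_lt_trans h2); rewrite (_ : d = (normc m + 1) * d2); last first.
    by rewrite /d2; field; lra.
  by rewrite ltr_pM2l //; lra.
have := Hd k kd; rewrite (_ : g z + k = g (z + h)); last by rewrite /k; ring.
move=> h4.
rewrite (_ : _ - _ = (f (g (z + h)) - f (g z) - l * k) + l * (k - m * h)); last by ring.
have H0 := normc_ge0 h.
have k1 : e / (2 * (normc m + 1)) * normc k <= e / 2 * normc h.
  apply: (le_trans (ler_wpM2l (ltW e1) h2)).
  by rewrite mulrA ler_wpM2r // le_eqVlt; apply/orP; left; apply/eqP; field; lra.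
have k2 : normc (l * (k - m * h)) <= e / 2 * normc h.
  rewrite normcM; apply: (le_trans (ler_wpM2l l0 h1)).
  rewrite mulrA ler_wpM2r //.
  rewrite (_ : e / 2 = (normc l + 1) * (e / (2 * (normc l + 1)))); last by field; lra.
  by rewrite ler_wpM2r ?ltW //; lra.
apply: (le_trans (normcD _ _)); lra.
Qed.

Lemma cdiff_inv z : z != 0 -> cdiff (fun w => w^-1) z (- z^-2).
Proof.
move=> z0 e e0; have nz0 : 0 < normc z by rewrite normc_gt0.
pose d := Num.min (normc z / 2) (e * normc z ^+ 3 / 2).
exists d; first by rewrite /d lt_min !divr_gt0 // mulr_gt0 // exprn_gt0.
move=> h; rewrite /d lt_min => /andP[h1 h2].
have zh : normc z / 2 <= normc (z + h).
  have := normcB (z + h) h; rewrite addrK; lra.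
have zh0 : z + h != 0 by rewrite -normc_gt0; lra.
rewrite (_ : _ - _ = h * (h * (z + h)^-1 * z^-2)); last by field; rewrite z0.
rewrite normcM mulrC ler_wpM2r ?normc_ge0 // !normcM !normcV normcX.
rewrite -mulrA -invfM ler_pdivrMr; last first.
  by rewrite mulr_gt0 ?exprn_gt0 //; lra.
apply: ltW; apply: (lt_le_trans h2).
rewrite (_ : e * normc z ^+ 3 / 2 = e * (normc z / 2 * normc z ^+ 2)); last by field.
apply: ler_wpM2l; first exact: ltW.
by apply: ler_wpM2r => //; rewrite exprn_ge0 // ltW.
Qed.

Lemma cdiff_ext f g z l : (exists2 d : R, 0 < d & forall h, normc h < d ->
  f (z + h) = g (z + h)) -> cdiff f z l -> cdiff g z l.
Proof.
move=> [d d0 E] H e e0; have [d' d'0 Hd] := H e e0.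
exists (Num.min d d'); first by rewrite lt_min d0.
move=> h; rewrite lt_min => /andP[/E E1 /Hd].
rewrite E1; have := E 0; rewrite addr0 => -> //.
by rewrite -[0]/(0%:C) normc_real normr0.
Qed.

End complex_differentiability.

(** * Cauchy's formula on squares *)

Section segment_integrals.
Context {R : realType}.
Local Notation C := R[i].
Local Notation mu := (@lebesgue_measure R).
Implicit Types (f g : R -> R) (a b c : R).

(** The nearby point [u] is not confined to the segment. Differentiability on a larger domain
    supplies this two-sided form directly, and it passes to sub-segments without any care for
    endpoints. *)
Definition continuous_on_segment f a b := forall t, a <= t <= b ->
  forall e : R, 0 < e -> exists2 d : R, 0 < d &
    forall u, `|u - t| < d -> `|f u - f t| <= e.

Definition segment_integral f a b : R := \int[mu]_(x in `[a, b]) f x.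
Local Notation Ri := segment_integral.

Lemma continuous_on_segment_within f a b : continuous_on_segment f a b ->
  {within `[a, b], continuous f}.
Proof.
move=> H; apply: continuous_in_subspaceT => t; rewrite inE /= in_itv /= => tab.
apply/cvgrPdist_le => e e0; have [d d0 Hd] := H t tab e e0.
by near=> u; rewrite distrC; apply: Hd; rewrite distrC; near: u; apply: cvgr_dist_lt.
Unshelve. all: by end_near. Qed.

Lemma segment_integrable f a b : continuous_on_segment f a b ->
  mu.-integrable `[a, b] (EFin \o f).
Proof.
move=> H; apply: continuous_compact_integrable; first exact: segment_compact.
exact: continuous_on_segment_within.
Qed.

Lemma continuous_on_segmentD f g a b : continuous_on_segment f a b ->
  continuous_on_segment g a b -> continuous_on_segment (fun x => f x + g x) a b.
Proof.
move=> Hf Hg t tab e e0; have e2 : 0 < e / 2 by rewrite divr_gt0.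
have [d d0 Hd] := Hf t tab _ e2; have [d' d'0 Hd'] := Hg t tab _ e2.
exists (Num.min d d'); first by rewrite lt_min d0.
move=> u; rewrite lt_min => /andP[/Hd h1 /Hd' h2].
rewrite (_ : _ - _ = (f u - f t) + (g u - g t)); last by ring.
by apply: (le_trans (ler_normD _ _)); lra.
Qed.

Lemma continuous_on_segmentN f a b : continuous_on_segment f a b ->
  continuous_on_segment (fun x => - f x) a b.
Proof.
move=> Hf t tab e e0; have [d d0 Hd] := Hf t tab _ e0; exists d => // u /Hd.
by rewrite -opprD normrN.
Qed.

Lemma continuous_on_segmentB f g a b : continuous_on_segment f a b ->
  continuous_on_segment g a b -> continuous_on_segment (fun x => f x - g x) a b.
Proof. by move=> Hf /continuous_on_segmentN; apply: continuous_on_segmentD. Qed.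

Lemma continuous_on_segment_cst k a b : continuous_on_segment (fun=> k) a b.
Proof.
by move=> t _ e e0; exists 1 => // u _; rewrite subrr normr0 ltW.
Qed.

Lemma segment_integralD f g a b : continuous_on_segment f a b ->
  continuous_on_segment g a b ->
  Ri (fun x => f x + g x) a b = Ri f a b + Ri g a b.
Proof.
by move=> Hf Hg; rewrite /Ri RintegralD //; exact: segment_integrable.
Qed.

Lemma segment_integralB f g a b : continuous_on_segment f a b ->
  continuous_on_segment g a b ->
  Ri (fun x => f x - g x) a b = Ri f a b - Ri g a b.
Proof.
by move=> Hf Hg; rewrite /Ri RintegralB //; exact: segment_integrable.
Qed.

Lemma segment_integralZ k f a b : continuous_on_segment f a b ->
  Ri (fun x => k * f x) a b = k * Ri f a b.
Proof. by move=> Hf; rewrite /Ri RintegralZl //; exact: segment_integrable. Qed.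

Lemma segment_integral_cst k a b : a <= b -> Ri (fun=> k) a b = k * (b - a).
Proof.
move=> ab; rewrite /Ri Rintegral_cst //= lebesgue_measure_itv /=.
rewrite lte_fin; case: ltP => // ba.
by rewrite (le_anti (introT andP (conj ab ba))) subrr.
Qed.

Lemma segment_integral_split f a b c : a <= c -> c <= b ->
  continuous_on_segment f a b -> Ri f a b = Ri f a c + Ri f c b.
Proof.
move=> ac cb Hf; have If := segment_integrable Hf.
have := @Rintegral_itvB R f (BLeft a) (BRight b) c If.
rewrite !bnd_simp => /(_ ac cb) E.
rewrite /Ri -(@Rintegral_itv_obnd_cbnd R (c : R) (BRight b) f).
  by rewrite -E; ring.
apply: integrableS If => //; apply: subset_itvr; by rewrite bnd_simp.
Qed.

Lemma le_segment_integral f g a b : continuous_on_segment f a b ->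
  continuous_on_segment g a b -> (forall x, a <= x <= b -> f x <= g x) ->
  Ri f a b <= Ri g a b.
Proof.
move=> Hf Hg H; apply: le_Rintegral => [//|||x]; last (by rewrite /= in_itv /= => /H); try exact: segment_integrable.
Qed.

Lemma segment_integral_bound f a b M : a <= b -> continuous_on_segment f a b ->
  (forall x, a <= x <= b -> `|f x| <= M) -> `|Ri f a b| <= M * (b - a).
Proof.
move=> ab Hf H; rewrite ler_norml -mulNr -!(segment_integral_cst _ ab).
apply/andP; split; apply: le_segment_integral => //;
  try exact: continuous_on_segment_cst; move=> x /H; rewrite ler_norml => /andP[]//.
Qed.

Lemma eq_segment_integral f g a b : (forall x, a <= x <= b -> f x = g x) ->
  Ri f a b = Ri g a b.
Proof.
by move=> H; apply: eq_Rintegral => x; rewrite inE /= in_itv /= => /H.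
Qed.

End segment_integrals.

(** * Goursat's theorem for closed forms on rectangles *)

Section Goursat.
Context {R : realType}.
Local Notation Ri := segment_integral.

Definition diff2 (P : R -> R -> R) (s t p q : R) := forall e : R, 0 < e ->
  exists2 d : R, 0 < d & forall x y, `|x - s| < d -> `|y - t| < d ->
    `|P x y - P s t - p * (x - s) - q * (y - t)| <= e * (`|x - s| + `|y - t|).

Lemma diff2_continuous P s t p q : diff2 P s t p q -> forall e : R, 0 < e ->
  exists2 d : R, 0 < d & forall x y, `|x - s| < d -> `|y - t| < d ->
    `|P x y - P s t| <= e.
Proof.
move=> H e e0; have [d d0 Hd] := H 1 ltr01.
pose K := 1 + `|p| + `|q|.
have p0 := normr_ge0 p; have q0 := normr_ge0 q.
have K0 : 0 < K by rewrite /K; lra.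
exists (Num.min d (e / (2 * K))); first by rewrite lt_min d0 divr_gt0 // mulr_gt0.
move=> x y; rewrite !lt_min => /andP[xd xe] /andP[yd ye].
have := Hd x y xd yd; rewrite mul1r => h.
have h2 : `|p * (x - s)| <= `|p| * (e / (2 * K)) by rewrite normrM ler_wpM2l // ltW.
have h3 : `|q * (y - t)| <= `|q| * (e / (2 * K)) by rewrite normrM ler_wpM2l // ltW.
rewrite (_ : P x y - P s t = (P x y - P s t - p * (x - s) - q * (y - t)) + p * (x - s) + q * (y - t)); last by ring.
apply: (le_trans (ler_normD _ _)); apply: (le_trans (lerD (ler_normD _ _) (lexx _))).
have E : e = 2 * (e / (2 * K)) + 2 * (`|p| * (e / (2 * K))) + 2 * (`|q| * (e / (2 * K))).
  by rewrite -!mulrDr -[X in X + _ + _]mul1r -!mulrDl -/K; field; lra.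
have : 0 <= `|p| * (e / (2 * K)) by rewrite mulr_ge0 // divr_ge0 ?ltW // mulr_gt0.
have : 0 <= `|q| * (e / (2 * K)) by rewrite mulr_ge0 // divr_ge0 ?ltW // mulr_gt0.
lra.
Qed.

Variables (P Q : R -> R -> R).

(** The integral of [P ds + Q dt] counterclockwise around the rectangle [[a, b] x [c, d]]. *)
Definition circulation a b c d :=
  Ri (fun t => Q b t - Q a t) c d - Ri (fun s => P s d - P s c) a b.
Local Notation D := circulation.

Variables (a0 b0 c0 d0 : R).
Hypotheses (ab0 : a0 <= b0) (cd0 : c0 <= d0).
Hypothesis closed_form : forall s t, a0 <= s <= b0 -> c0 <= t <= d0 ->
  exists p q r, diff2 P s t p q /\ diff2 Q s t q r.

Lemma closed_form_contQ s c d : a0 <= s <= b0 -> c0 <= c -> d <= d0 ->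
  continuous_on_segment (Q s) c d.
Proof.
move=> sab cc dd t /andP[ct td] e e0.
have tcd : c0 <= t <= d0 by rewrite (le_trans cc ct) (le_trans td dd).
have [p [q [r [_ H]]]] := closed_form sab tcd.
have [k k0 Hk] := diff2_continuous H e0.
by exists k => // u uk; apply: Hk; rewrite // subrr normr0.
Qed.

Lemma closed_form_contP t a b : c0 <= t <= d0 -> a0 <= a -> b <= b0 ->
  continuous_on_segment (P^~ t) a b.
Proof.
move=> tcd cc dd s /andP[ct td] e e0.
have sab : a0 <= s <= b0 by rewrite (le_trans cc ct) (le_trans td dd).
have [p [q [r [H _]]]] := closed_form sab tcd.
have [k k0 Hk] := diff2_continuous H e0.
by exists k => // u uk; apply: Hk; rewrite // subrr normr0.
Qed.

Definition subrect (x : R * R * R * R) :=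
  let: (a, b, c, d) := x in [/\ a0 <= a, a <= b, b <= b0, c0 <= c & c <= d /\ d <= d0].

Lemma circulation_split_s a m b c d : subrect (a, b, c, d) -> a <= m -> m <= b ->
  D a b c d = D a m c d + D m b c d.
Proof.
move=> [aa ab bb cc [cd dd]] am mb; rewrite /D.
have ca : a0 <= a <= b0 by rewrite aa (le_trans ab bb).
have cb : a0 <= b <= b0 by rewrite bb (le_trans aa ab).
have cm : a0 <= m <= b0 by rewrite (le_trans aa am) (le_trans mb bb).
have hc : c0 <= c <= d0 by rewrite cc (le_trans cd dd).
have hd : c0 <= d <= d0 by rewrite dd (le_trans cc cd).
rewrite !segment_integralB; try (by apply: closed_form_contQ); try (by apply: closed_form_contP; rewrite // ?(le_trans aa am) ?(le_trans mb bb)).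
rewrite (segment_integral_split am mb (closed_form_contP hc aa bb)).
rewrite (segment_integral_split am mb (closed_form_contP hd aa bb)).
ring.
Qed.

Lemma circulation_split_t a b c m d : subrect (a, b, c, d) -> c <= m -> m <= d ->
  D a b c d = D a b c m + D a b m d.
Proof.
move=> [aa ab bb cc [cd dd]] am mb; rewrite /D.
have ca : a0 <= a <= b0 by rewrite aa (le_trans ab bb).
have cb : a0 <= b <= b0 by rewrite bb (le_trans aa ab).
have hc : c0 <= c <= d0 by rewrite cc (le_trans cd dd).
have hd : c0 <= d <= d0 by rewrite dd (le_trans cc cd).
have hm : c0 <= m <= d0 by rewrite (le_trans cc am) (le_trans mb dd).
rewrite !segment_integralB; try (by apply: closed_form_contP); try (by apply: closed_form_contQ; rewrite // ?(le_trans cc am) ?(le_trans mb dd)).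
rewrite (segment_integral_split am mb (closed_form_contQ ca cc dd)).
rewrite (segment_integral_split am mb (closed_form_contQ cb cc dd)).
ring.
Qed.

(* Halving a rectangle keeps at least half of the circulation in one of the halves. *)
Definition bisect_s (x : R * R * R * R) := let: (a, b, c, d) := x in
  let m := (a + b) / 2 in
  if `|D a b c d| / 2 <= `|D a m c d| then (a, m, c, d) else (m, b, c, d).
Definition bisect_t (x : R * R * R * R) := let: (a, b, c, d) := x in
  let m := (c + d) / 2 in
  if `|D a b c d| / 2 <= `|D a b c m| then (a, b, c, m) else (a, b, m, d).

Definition lo_s (x : R * R * R * R) := x.1.1.1.
Definition hi_s (x : R * R * R * R) := x.1.1.2.
Definition lo_t (x : R * R * R * R) := x.1.2.
Definition hi_t (x : R * R * R * R) := x.2.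
Definition Dx (x : R * R * R * R) := `|D (lo_s x) (hi_s x) (lo_t x) (hi_t x)|.

Lemma bisect_sP x : subrect x -> [/\ subrect (bisect_s x),
  lo_s x <= lo_s (bisect_s x) /\ hi_s (bisect_s x) <= hi_s x,
  lo_t (bisect_s x) = lo_t x /\ hi_t (bisect_s x) = hi_t x,
  hi_s (bisect_s x) - lo_s (bisect_s x) = (hi_s x - lo_s x) / 2 &
  Dx x / 2 <= Dx (bisect_s x)].
Proof.
case: x => [[[a b] c] d] H; have [aa ab bb cc [cd dd]] := H.
rewrite /bisect_s /Dx /lo_s /hi_s /lo_t /hi_t /=.
set m := (a + b) / 2.
have am : a <= m by rewrite /m; lra.
have mb : m <= b by rewrite /m; lra.
have E := circulation_split_s H am mb.
case: ifP => /= h; split => //; try by split => //; lra.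
- by rewrite /m; lra.
- by rewrite /m; lra.
- move/negbT: h; rewrite -ltNge; have := ler_normD (D a m c d) (D m b c d).
  by rewrite -E; lra.
Qed.

Lemma bisect_tP x : subrect x -> [/\ subrect (bisect_t x),
  lo_t x <= lo_t (bisect_t x) /\ hi_t (bisect_t x) <= hi_t x,
  lo_s (bisect_t x) = lo_s x /\ hi_s (bisect_t x) = hi_s x,
  hi_t (bisect_t x) - lo_t (bisect_t x) = (hi_t x - lo_t x) / 2 &
  Dx x / 2 <= Dx (bisect_t x)].
Proof.
case: x => [[[a b] c] d] H; have [aa ab bb cc [cd dd]] := H.
rewrite /bisect_t /Dx /lo_s /hi_s /lo_t /hi_t /=.
set m := (c + d) / 2.
have am : c <= m by rewrite /m; lra.
have mb : m <= d by rewrite /m; lra.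
have E := circulation_split_t H am mb.
case: ifP => /= h; split => //; try by split => //; lra.
- by rewrite /m; lra.
- by rewrite /m; lra.
- move/negbT: h; rewrite -ltNge; have := ler_normD (D a b c m) (D a b m d).
  by rewrite -E; lra.
Qed.

Let X n := iter n (fun x => bisect_t (bisect_s x)) (a0, b0, c0, d0).

Lemma bisect_subrect n : subrect (X n) /\ subrect (bisect_s (X n)).
Proof.
elim: n => [|n [_ IH]].
  have h : subrect (X 0%N) by split.
  by split => //; have [] := bisect_sP h.
by have [H _ _ _ _] := bisect_tP IH; split => //; have [] := bisect_sP H.
Qed.

Lemma bisect_step n : [/\ lo_s (X n) <= lo_s (X n.+1) /\ hi_s (X n.+1) <= hi_s (X n),
  lo_t (X n) <= lo_t (X n.+1) /\ hi_t (X n.+1) <= hi_t (X n),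
  hi_s (X n.+1) - lo_s (X n.+1) = (hi_s (X n) - lo_s (X n)) / 2,
  hi_t (X n.+1) - lo_t (X n.+1) = (hi_t (X n) - lo_t (X n)) / 2 &
  Dx (X n) / 4 <= Dx (X n.+1)].
Proof.
have [H1 H2] := bisect_subrect n.
have [_ [h1 h2] [h3 h4] h5 h6] := bisect_sP H1.
have [_ [k1 k2] [k3 k4] k5 k6] := bisect_tP H2.
rewrite (_ : X n.+1 = bisect_t (bisect_s (X n))) //.
by split; rewrite ?k3 ?k4 ?k5 -?h3 -?h4 //; lra.
Qed.

Lemma nested_point (lo hi : nat -> R) :
  (forall n, lo n <= lo n.+1) -> (forall n, hi n.+1 <= hi n) ->
  (forall n, lo n <= hi n) -> exists s, forall n, lo n <= s <= hi n.
Proof.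
move=> H1 H2 H3.
have L : {homo lo : m n / (m <= n)%N >-> m <= n} by apply: (homo_leq (@lexx _ _) (@le_trans _ _)).
have U m n : lo m <= hi n.
  have V : {homo hi : m n / (m <= n)%N >-> n <= m}.
    by apply: (homo_leq (@lexx _ _)) => // x y z h k; exact: le_trans k h.
  have [mn|/ltnW nm] := leqP m n; first exact: le_trans (L _ _ mn) (H3 n).
  exact: le_trans (H3 m) (V _ _ nm).
exists (sup (range lo)) => n; apply/andP; split.
  by apply: ub_le_sup; [exists (hi 0%N) => _ [m _ <-]|exists n].
by apply: ge_sup; [exists (lo 0%N), 0%N|move=> _ [m _ <-]].
Qed.

(** Each round of two bisections keeps at least a quarter of the circulation, so [4 ^ n] times that
    of the [n]-th rectangle dominates the original. Near the common point of the rectangles both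
    coefficients are affine up to a small error. The affine part has zero circulation because
    [closed_form] uses the same [q] for [P] in [t] and for [Q] in [s]; the error is at most [e]
    times the square of the size, which cancels the factor [4 ^ n]. *)
Lemma Goursat_real :
  Ri (fun t => Q b0 t - Q a0 t) c0 d0 = Ri (fun s => P s d0 - P s c0) a0 b0.
Proof.
apply/eqP; rewrite -subr_eq0 -normr_eq0 eq_le normr_ge0 andbT.
pose l : R := (b0 - a0) + (d0 - c0).
have l0 : 0 <= l by rewrite /l addr_ge0 ?subr_ge0.
suff H (e : R) : 0 < e -> `|D a0 b0 c0 d0| <= 4 * e * l ^+ 2.
  apply/ler_addgt0Pl => e e0; rewrite addr0.
  pose e' := e / (4 * (l ^+ 2 + 1)).
  have l2 : 0 <= l ^+ 2 by rewrite exprn_ge0.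
  have e'0 : 0 < e' by rewrite divr_gt0 //; lra.
  apply: (le_trans (H _ e'0)).
  rewrite (_ : e = 4 * e' * (l ^+ 2 + 1)); last by rewrite /e'; field; lra.
  rewrite ler_pM2l; lra.
move=> e0.
have le_s n : lo_s (X n) <= hi_s (X n).
  by have [] := bisect_subrect n; case: (X n) => [[[? ?] ?] ?] [].
have le_t n : lo_t (X n) <= hi_t (X n).
  by have [] := bisect_subrect n; case: (X n) => [[[? ?] ?] ?] [_ _ _ _ []].
have [s Hs] := @nested_point (lo_s \o X) (hi_s \o X)
  (fun n => let: And5 (conj h _) _ _ _ _ := bisect_step n in h)
  (fun n => let: And5 (conj _ h) _ _ _ _ := bisect_step n in h)
  le_s.
have [t Ht] := @nested_point (lo_t \o X) (hi_t \o X)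
  (fun n => let: And5 _ (conj h _) _ _ _ := bisect_step n in h)
  (fun n => let: And5 _ (conj _ h) _ _ _ := bisect_step n in h)
  le_t.
have [p [q [r [dP dQ]]]] : exists p q r, diff2 P s t p q /\ diff2 Q s t q r.
  by apply: closed_form; [have := Hs 0%N|have := Ht 0%N].
have [k k0 Hk] := dP _ e0; have [k' k'0 Hk'] := dQ _ e0.
have size n : hi_s (X n) - lo_s (X n) = (b0 - a0) / 2 ^+ n /\
              hi_t (X n) - lo_t (X n) = (d0 - c0) / 2 ^+ n.
  elim: n => [|n [IH1 IH2]]; first by rewrite expr0 !divr1.
  have [_ _ -> -> _] := bisect_step n; rewrite IH1 IH2 exprS invfM.
  by rewrite !mulrA; split; rewrite mulrAC.
have DX n : `|D a0 b0 c0 d0| <= Dx (X n) * 4 ^+ n.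
  elim: n => [|n IH]; first by rewrite expr0 mulr1.
  have [_ _ _ _ h] := bisect_step n; apply: (le_trans IH).
  rewrite exprS mulrA ler_wpM2r ?exprn_ge0 //; lra.
have [n Hn] : exists n, l / 2 ^+ n < Num.min k k'.
  have h : 0 < Num.min k k' by rewrite lt_min k0.
  exists (Num.bound (l / Num.min k k')).
  rewrite ltr_pdivrMr ?exprn_gt0 // mulrC -ltr_pdivrMr //.
  apply: (lt_trans (archi_boundP _)); first by rewrite divr_ge0 // ltW.
  by rewrite -natrX ltr_nat ltn_expl.
have [Sx _] := bisect_subrect n; have [S1 S2] := size n; have := DX n.
have := Hs n; have := Ht n; move: Sx S1 S2; rewrite /Dx /=.
case: (X n) => [[[a b] c] d]; rewrite /lo_s /hi_s /lo_t /hi_t /=.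
move=> [aa ab bb cc [cd dd]] S1 S2 /andP[ct td] /andP[as_ sb] h.
set e2 := 2 ^+ n in S1 S2 Hn; have e20 : 0 < e2 by rewrite exprn_gt0.
have E4 : 4 ^+ n = e2 ^+ 2 :> R 
  by rewrite /e2 -exprM mulnC exprM (_ : 2 ^+ 2 = 4 :> R) //; ring.
have ll : (b - a) + (d - c) = l / e2 by rewrite S1 S2 -mulrDl.
move: Hn; rewrite lt_min -ll => /andP[lk lk'].
have ca : a0 <= a <= b0 by rewrite aa (le_trans ab bb).
have cb : a0 <= b <= b0 by rewrite bb (le_trans aa ab).
have hc : c0 <= c <= d0 by rewrite cc (le_trans cd dd).
have hd : c0 <= d <= d0 by rewrite dd (le_trans cc cd).
have xs x : a <= x <= b -> `|x - s| <= b - a.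
  by rewrite ler_norml => /andP[h1 h2]; apply/andP; lra.
have yt x : c <= x <= d -> `|x - t| <= d - c.
  by rewrite ler_norml => /andP[h1 h2]; apply/andP; lra.
have aab : a <= a <= b by rewrite lexx.
have bab : a <= b <= b by rewrite lexx ab.
have ccd : c <= c <= d by rewrite lexx.
have dcd : c <= d <= d by rewrite lexx cd.
set m := (b - a) + (d - c) in ll lk lk'.
have m0 : 0 <= m by rewrite /m; lra.
have rQ x y : a <= x <= b -> c <= y <= d ->
    `|Q x y - Q s t - q * (x - s) - r * (y - t)| <= e * m.
  move=> /xs h1 /yt h2; apply: (le_trans (Hk' _ _ _ _)).
  - by apply: le_lt_trans h1 _; move: lk'; rewrite /m; lra.
  - by apply: le_lt_trans h2 _; move: lk'; rewrite /m; lra.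
  - by rewrite ler_wpM2l ?(ltW e0) // lerD.
have rP x y : a <= x <= b -> c <= y <= d ->
    `|P x y - P s t - p * (x - s) - q * (y - t)| <= e * m.
  move=> /xs h1 /yt h2; apply: (le_trans (Hk _ _ _ _)).
  - by apply: le_lt_trans h1 _; move: lk; rewrite /m; lra.
  - by apply: le_lt_trans h2 _; move: lk; rewrite /m; lra.
  - by rewrite ler_wpM2l ?(ltW e0) // lerD.
(* After subtraction of the affine parts, both integrals carry the same constant
   [q * (b - a) * (d - c)], which disappears from their difference. *)
have IQ : `|Ri (fun y => Q b y - Q a y - q * (b - a)) c d| <= 2 * (e * m) * (d - c).
  apply: segment_integral_bound => //.
    apply: continuous_on_segmentB; last exact: continuous_on_segment_cst.
    by apply: continuous_on_segmentB; apply: closed_form_contQ.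
  move=> y hy; have h1 := rQ _ _ aab hy; have h2 := rQ _ _ bab hy.
  rewrite (_ : _ - _ = (Q b y - Q s t - q * (b - s) - r * (y - t)) - (Q a y - Q s t - q * (a - s) - r * (y - t))); last by ring.
  by apply: (le_trans (ler_normB _ _)); lra.
have IP : `|Ri (fun x => P x d - P x c - q * (d - c)) a b| <= 2 * (e * m) * (b - a).
  apply: segment_integral_bound => //.
    apply: continuous_on_segmentB; last exact: continuous_on_segment_cst.
    by apply: continuous_on_segmentB; apply: closed_form_contP.
  move=> y hy; have h1 := rP _ _ hy ccd; have h2 := rP _ _ hy dcd.
  rewrite (_ : _ - _ = (P y d - P s t - p * (y - s) - q * (d - t)) - (P y c - P s t - p * (y - s) - q * (c - t))); last by ring.
  by apply: (le_trans (ler_normB _ _)); lra.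
have key : `|D a b c d| <= 2 * e * m ^+ 2.
  rewrite (_ : D a b c d = Ri (fun y => Q b y - Q a y - q * (b - a)) c d -
     Ri (fun x => P x d - P x c - q * (d - c)) a b).
    apply: (le_trans (ler_normB _ _)); apply: (le_trans (lerD IQ IP)).
    by rewrite -mulrDr addrC -/m expr2 !mulrA.
  rewrite (segment_integralB (f := fun y => Q b y - Q a y)); last 2 first.
  - by apply: continuous_on_segmentB; apply: closed_form_contQ.
  - exact: continuous_on_segment_cst.
  rewrite (segment_integralB (f := fun y => P y d - P y c)); last 2 first.
  - by apply: continuous_on_segmentB; apply: closed_form_contP.
  - exact: continuous_on_segment_cst.
  by rewrite !segment_integral_cst // /D; ring.
apply: (le_trans h); rewrite E4; apply: (le_trans (ler_wpM2r (sqr_ge0 _) key)).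
have aux (u v w : R) : w != 0 -> v * (u / w) ^+ 2 * w ^+ 2 = v * u ^+ 2.
  by move=> w0; field.
rewrite ll aux; last by rewrite gt_eqF.
by apply: ler_wpM2r; [exact: sqr_ge0|lra].
Qed.

End Goursat.

(** * Integrals of complex-valued functions on a segment *)

Section complex_segment_integrals.
Context {R : realType}.
Local Notation C := R[i].
Local Notation Re := (@complex.Re R).
Local Notation Im := (@complex.Im R).
Local Notation Ri := segment_integral.
Implicit Types (f g : R -> C) (a b : R).

Definition ccontinuous_on_segment f a b := forall t, a <= t <= b ->
  forall e : R, 0 < e -> exists2 d : R, 0 < d &
    forall u, `|u - t| < d -> normc (f u - f t) <= e.

Lemma ccontinuous_Re f a b : ccontinuous_on_segment f a b ->
  continuous_on_segment (fun t => Re (f t)) a b.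
Proof.
move=> H t tab e e0; have [d d0 Hd] := H t tab e e0; exists d => // u /Hd.
by apply: le_trans; rewrite -Re_oppc -Re_addc Re_le_normc.
Qed.

Lemma ccontinuous_Im f a b : ccontinuous_on_segment f a b ->
  continuous_on_segment (fun t => Im (f t)) a b.
Proof.
move=> H t tab e e0; have [d d0 Hd] := H t tab e e0; exists d => // u /Hd.
by apply: le_trans; rewrite -Im_oppc -Im_addc Im_le_normc.
Qed.

Lemma ccontinuous_normc f a b : ccontinuous_on_segment f a b ->
  continuous_on_segment (fun t => normc (f t)) a b.
Proof.
move=> H t tab e e0; have [d d0 Hd] := H t tab e e0; exists d => // u /Hd.
apply: le_trans; rewrite ler_norml.
have h1 := normcD (f u - f t) (f t); have h2 := normcD (f t - f u) (f u).
rewrite !subrK in h1 h2; rewrite normc_dist in h2.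
by apply/andP; lra.
Qed.

Lemma ccontinuous_cst k a b : ccontinuous_on_segment (fun=> k) a b.
Proof.
by move=> t _ e e0; exists 1 => // u _; rewrite subrr -[0]/(0%:C) normc_real normr0 ltW.
Qed.

Lemma ccontinuousD f g a b : ccontinuous_on_segment f a b ->
  ccontinuous_on_segment g a b -> ccontinuous_on_segment (fun x => f x + g x) a b.
Proof.
move=> Hf Hg t tab e e0; have e2 : 0 < e / 2 by rewrite divr_gt0.
have [d d0 Hd] := Hf t tab _ e2; have [d' d'0 Hd'] := Hg t tab _ e2.
exists (Num.min d d'); first by rewrite lt_min d0.
move=> u; rewrite lt_min => /andP[/Hd h1 /Hd' h2].
rewrite (_ : _ - _ = (f u - f t) + (g u - g t)); last by ring.
by apply: (le_trans (normcD _ _)); lra.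
Qed.

Lemma ccontinuousM f g a b : ccontinuous_on_segment f a b ->
  ccontinuous_on_segment g a b -> ccontinuous_on_segment (fun x => f x * g x) a b.
Proof.
move=> Hf Hg t tab e e0.
have f0 := normc_ge0 (f t); have g0 := normc_ge0 (g t).
have e1 : 0 < Num.min 1 (e / (4 * (normc (g t) + 1))).
  by rewrite lt_min ltr01 divr_gt0 //; lra.
have e2 : 0 < e / (4 * (normc (f t) + 1)) by rewrite divr_gt0 //; lra.
have [d d0 Hd] := Hf t tab _ e1; have [d' d'0 Hd'] := Hg t tab _ e2.
exists (Num.min d d'); first by rewrite lt_min d0.
move=> u; rewrite lt_min => /andP[/Hd + /Hd' h2]; rewrite le_min => /andP[h3 h1].
rewrite (_ : _ - _ = (f u - f t) * g t + f t * (g u - g t) + (f u - f t) * (g u - g t)); last by ring.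
have k1 : normc ((f u - f t) * g t) <= e / 4.
  rewrite normcM; apply: (le_trans (ler_wpM2r g0 h1)).
  rewrite (_ : e / 4 = e / (4 * (normc (g t) + 1)) * (normc (g t) + 1)); last by field; lra.
  by apply: ler_wpM2l; [rewrite divr_ge0 //; lra|lra].
have k2 : normc (f t * (g u - g t)) <= e / 4.
  rewrite normcM; apply: (le_trans (ler_wpM2l f0 h2)).
  rewrite (_ : e / 4 = (normc (f t) + 1) * (e / (4 * (normc (f t) + 1)))); last by field; lra.
  by apply: ler_wpM2r; [rewrite divr_ge0 //; lra|lra].
have k3 : normc ((f u - f t) * (g u - g t)) <= e / 4.
  rewrite normcM; apply: (le_trans (ler_pM (normc_ge0 _) (normc_ge0 _) h3 h2)).
  rewrite mul1r ler_pdivrMr; last by lra.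
  by rewrite (_ : e / 4 * _ = e * (normc (f t) + 1)) ?ler_peMr ?(ltW e0) ?lerDr //; field.
apply: (le_trans (normcD _ _)); apply: (le_trans (lerD (normcD _ _) (lexx _))).
lra.
Qed.

Lemma ccontinuousB f g a b : ccontinuous_on_segment f a b ->
  ccontinuous_on_segment g a b -> ccontinuous_on_segment (fun x => f x - g x) a b.
Proof.
move=> Hf Hg; under [X in ccontinuous_on_segment X]eq_fun do rewrite -mulN1r.
exact: ccontinuousD Hf (ccontinuousM (@ccontinuous_cst (-1) a b) Hg).
Qed.

Definition csegment_integral f a b : C :=
  (Ri (fun t => Re (f t)) a b) +i* (Ri (fun t => Im (f t)) a b).
Local Notation Ci := csegment_integral.

Lemma csegment_integralD f g a b : ccontinuous_on_segment f a b ->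
  ccontinuous_on_segment g a b ->
  Ci (fun x => f x + g x) a b = Ci f a b + Ci g a b.
Proof.
move=> Hf Hg; rewrite /Ci /=; congr (_ +i* _).
  rewrite -segment_integralD; try exact: ccontinuous_Re.
  by apply: eq_segment_integral => x _; rewrite Re_addc.
rewrite -segment_integralD; try exact: ccontinuous_Im.
by apply: eq_segment_integral => x _; rewrite Im_addc.
Qed.

Lemma csegment_integralZ k f a b : ccontinuous_on_segment f a b ->
  Ci (fun x => k * f x) a b = k * Ci f a b.
Proof.
case: k => kr ki Hf; have HR := ccontinuous_Re Hf; have HI := ccontinuous_Im Hf.
have Z r h : continuous_on_segment h a b -> continuous_on_segment (fun x => r * h x) a b.
  move=> Hh t tab e e0.
  have r0 := normr_ge0 r.
  have e1 : 0 < e / (`|r| + 1) by rewrite divr_gt0 //; lra.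
  have [d d0 Hd] := Hh t tab _ e1; exists d => // u /Hd h1.
  rewrite -mulrBr normrM; apply: (le_trans (ler_wpM2l r0 h1)).
  rewrite mulrA ler_pdivrMr ?mulrDr; [nra|lra].
rewrite /Ci; simpc; congr (_ +i* _).
  rewrite -!segment_integralZ // -segment_integralB; try exact: Z.
  by apply: eq_segment_integral => x _; case: (f x).
rewrite -!segment_integralZ // -segment_integralD; try exact: Z.
by apply: eq_segment_integral => x _; case: (f x) => ? ? /=; rewrite addrC.
Qed.

Lemma eq_csegment_integral f g a b : (forall x, a <= x <= b -> f x = g x) ->
  Ci f a b = Ci g a b.
Proof.
by move=> H; congr (_ +i* _); apply: eq_segment_integral => x /H ->.
Qed.

(** Real and imaginary parts are bounded separately, hence the factor 2. The later constants absorb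
    it. *)
Lemma csegment_integral_le f (g : R -> R) a b : ccontinuous_on_segment f a b ->
  continuous_on_segment g a b -> (forall x, a <= x <= b -> normc (f x) <= g x) ->
  normc (Ci f a b) <= 2 * Ri g a b.
Proof.
move=> Hf Hg H; apply: (le_trans (normc_le _)) => /=.
have Hg' := continuous_on_segmentN Hg.
have E : Ri (fun x => - g x) a b = - Ri g a b.
  rewrite (_ : (fun x => - g x) = (fun x => -1 * g x)) ?segment_integralZ ?mulN1r //.
  by apply/funext => x; rewrite mulN1r.
rewrite mulr2n mulrDl !mul1r; apply: lerD; rewrite ler_norml -E;
  apply/andP; split; apply: le_segment_integral => //;
  do ?[exact: ccontinuous_Re|exact: ccontinuous_Im];
  move=> x /H => h.
- by have := le_trans (Re_le_normc _) h; rewrite ler_norml => /andP[].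
- by have := le_trans (Re_le_normc _) h; rewrite ler_norml => /andP[].
- by have := le_trans (Im_le_normc _) h; rewrite ler_norml => /andP[].
- by have := le_trans (Im_le_normc _) h; rewrite ler_norml => /andP[].
Qed.

Lemma csegment_integral_bound f a b (M : R) : a <= b -> ccontinuous_on_segment f a b ->
  (forall x, a <= x <= b -> normc (f x) <= M) ->
  normc (Ci f a b) <= 2 * M * (b - a).
Proof.
move=> ab Hf H; rewrite -mulrA -(segment_integral_cst M ab).
exact: csegment_integral_le Hf (@continuous_on_segment_cst _ M a b) H.
Qed.

End complex_segment_integrals.

Lemma le_small_factor (R : realType) (e u : R) : 0 <= u -> 0 <= e ->
  u * (e / (4 * (u + 1))) <= e / 4.
Proof.
move=> u0 e0; rewrite mulrA ler_pdivrMr; last by lra.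
by rewrite (_ : e / 4 * _ = e * (u + 1)); [nra|field].
Qed.

(** * Goursat's theorem for complex-valued forms *)

Section Goursat_complex.
Context {R : realType}.
Local Notation C := R[i].
Local Notation Re := (@complex.Re R).
Local Notation Im := (@complex.Im R).
Local Notation Ci := csegment_integral.

Definition cdiff2 (P : R -> R -> C) (s t : R) (p q : C) := forall e : R, 0 < e ->
  exists2 d : R, 0 < d & forall x y, `|x - s| < d -> `|y - t| < d ->
    normc (P x y - P s t - p * (x - s)%:C - q * (y - t)%:C)
      <= e * (`|x - s| + `|y - t|).

Lemma Re_affine (a b p q : C) (x y : R) :
  Re (a - b - p * x%:C - q * y%:C) = Re a - Re b - Re p * x - Re q * y.
Proof. by case: a b p q => ? ? [? ?] [? ?] [? ?] /=; ring. Qed.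

Lemma Im_affine (a b p q : C) (x y : R) :
  Im (a - b - p * x%:C - q * y%:C) = Im a - Im b - Im p * x - Im q * y.
Proof. by case: a b p q => ? ? [? ?] [? ?] [? ?] /=; ring. Qed.

Lemma cdiff2_Re P s t p q : cdiff2 P s t p q ->
  diff2 (fun x y => Re (P x y)) s t (Re p) (Re q).
Proof.
move=> H e e0; have [d d0 Hd] := H e e0; exists d => // x y hx hy.
apply: le_trans (Hd x y hx hy); apply: le_trans (Re_le_normc _).
by rewrite Re_affine.
Qed.

Lemma cdiff2_Im P s t p q : cdiff2 P s t p q ->
  diff2 (fun x y => Im (P x y)) s t (Im p) (Im q).
Proof.
move=> H e e0; have [d d0 Hd] := H e e0; exists d => // x y hx hy.
apply: le_trans (Hd x y hx hy); apply: le_trans (Im_le_normc _).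
by rewrite Im_affine.
Qed.

Lemma Goursat (P Q : R -> R -> C) (a b c d : R) : a <= b -> c <= d ->
  (forall s t, a <= s <= b -> c <= t <= d ->
    exists p q r, cdiff2 P s t p q /\ cdiff2 Q s t q r) ->
  Ci (fun t => Q b t - Q a t) c d = Ci (fun s => P s d - P s c) a b.
Proof.
move=> ab cd H.
have HR := @Goursat_real R (fun s t => Re (P s t)) (fun s t => Re (Q s t)) a b c d ab cd.
have HI := @Goursat_real R (fun s t => Im (P s t)) (fun s t => Im (Q s t)) a b c d ab cd.
rewrite /Ci; congr (_ +i* _).
  under eq_segment_integral do rewrite Re_addc Re_oppc.
  under [RHS]eq_segment_integral do rewrite Re_addc Re_oppc.
  apply: HR => s t hs ht; have [p [q [r [h1 h2]]]] := H s t hs ht.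
  by exists (Re p), (Re q), (Re r); split; apply: cdiff2_Re.
under eq_segment_integral do rewrite Im_addc Im_oppc.
under [RHS]eq_segment_integral do rewrite Im_addc Im_oppc.
apply: HI => s t hs ht; have [p [q [r [h1 h2]]]] := H s t hs ht.
by exists (Im p), (Im q), (Im r); split; apply: cdiff2_Im.
Qed.

Lemma cdiff2_lip P s t p q : cdiff2 P s t p q -> exists2 d : R, 0 < d &
  forall x y, `|x - s| < d -> `|y - t| < d ->
    normc (P x y - P s t) <= (normc p + normc q + 1) * (`|x - s| + `|y - t|).
Proof.
move=> H; have [d d0 Hd] := H 1 ltr01; exists d => // x y hx hy.
have := Hd x y hx hy; set r := _ - q * _; rewrite mul1r => h.
rewrite (_ : P x y - P s t = r + (p * (x - s)%:C + q * (y - t)%:C)); last by rewrite /r; ring.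
apply: (le_trans (normcD _ _)); apply: (le_trans (lerD h (normcD _ _))).
rewrite !normcM !normc_real.
have := normc_ge0 p; have := normc_ge0 q; have := normr_ge0 (x - s); have := normr_ge0 (y - t).
nra.
Qed.

Lemma cdiff2_cst k s t : cdiff2 (fun _ _ => k) s t 0 0.
Proof.
move=> e e0; exists 1 => // x y _ _; rewrite !mul0r !subr0 subrr.
by rewrite -[X in normc X]/(0%:C) normc_real normr0 mulr_ge0 ?addr_ge0 // ltW.
Qed.

Lemma cdiff2_fst s t : cdiff2 (fun x _ => x%:C) s t 1 0.
Proof.
move=> e e0; exists 1 => // x y _ _; rewrite !mul0r mul1r subr0 rmorphB subrr.
by rewrite -[X in normc X]/(0%:C) normc_real normr0 mulr_ge0 ?addr_ge0 // ltW.
Qed.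

Lemma cdiff2_snd s t : cdiff2 (fun _ y => y%:C) s t 0 1.
Proof.
move=> e e0; exists 1 => // x y _ _; rewrite !mul0r mul1r subr0 rmorphB subrr.
by rewrite -[X in normc X]/(0%:C) normc_real normr0 mulr_ge0 ?addr_ge0 // ltW.
Qed.

Lemma cdiff2D P Q s t p q p' q' : cdiff2 P s t p q -> cdiff2 Q s t p' q' ->
  cdiff2 (fun x y => P x y + Q x y) s t (p + p') (q + q').
Proof.
move=> HP HQ e e0; have e2 : 0 < e / 2 by rewrite divr_gt0.
have [d d0 Hd] := HP _ e2; have [d' d'0 Hd'] := HQ _ e2.
exists (Num.min d d'); first by rewrite lt_min d0.
move=> x y; rewrite !lt_min => /andP[x1 x2] /andP[y1 y2].
have h1 := Hd x y x1 y1; have h2 := Hd' x y x2 y2.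
rewrite (_ : _ - _ = (P x y - P s t - p * (x - s)%:C - q * (y - t)%:C) +
  (Q x y - Q s t - p' * (x - s)%:C - q' * (y - t)%:C)); last by ring.
by apply: (le_trans (normcD _ _)); lra.
Qed.

Lemma cdiff2M P Q s t p q p' q' : cdiff2 P s t p q -> cdiff2 Q s t p' q' ->
  cdiff2 (fun x y => P x y * Q x y) s t (p * Q s t + P s t * p') (q * Q s t + P s t * q').
Proof.
move=> HP HQ e e0.
have P0 := normc_ge0 (P s t); have Q0 := normc_ge0 (Q s t).
pose L := normc p + normc q + 1; pose L' := normc p' + normc q' + 1.
have L0 : 1 <= L by rewrite /L; have := normc_ge0 p; have := normc_ge0 q; lra.
have L'0 : 1 <= L' by rewrite /L'; have := normc_ge0 p'; have := normc_ge0 q'; lra.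
have e1 : 0 < e / (4 * (normc (Q s t) + 1)) by rewrite divr_gt0 //; lra.
have e2 : 0 < e / (4 * (normc (P s t) + 1)) by rewrite divr_gt0 //; lra.
have [d1 d10 Hd1] := HP _ e1; have [d2 d20 Hd2] := HQ _ e2.
have [d3 d30 Hd3] := cdiff2_lip HP; have [d4 d40 Hd4] := cdiff2_lip HQ.
pose d5 := e / (8 * L * L').
have D5 : L * (2 * d5) * L' = e / 4.
  by rewrite /d5; clear -L0 L'0; field; apply/andP; lra.
have d50 : 0 < d5 by rewrite divr_gt0 // !mulr_gt0 //; lra.
exists (Num.min (Num.min d1 d2) (Num.min (Num.min d3 d4) d5)).
  by rewrite !lt_min d10 d20 d30 d40 d50.
move=> x y; rewrite !lt_min => /andP[/andP[x1 x2] /andP[/andP[x3 x4] x5]].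
move=> /andP[/andP[y1 y2] /andP[/andP[y3 y4] y5]].
have h1 := Hd1 x y x1 y1; have h2 := Hd2 x y x2 y2.
have h3 := Hd3 x y x3 y3; have h4 := Hd4 x y x4 y4.
set r := P x y - P s t - _ - _ in h1; set r' := Q x y - Q s t - _ - _ in h2.
rewrite -/L in h3; rewrite -/L' in h4.
set n := `|x - s| + `|y - t| in h1 h2 h3 h4 *.
have n0 : 0 <= n by rewrite /n addr_ge0.
have E : P x y * Q x y - P s t * Q s t
    - (p * Q s t + P s t * p') * (x - s)%:C - (q * Q s t + P s t * q') * (y - t)%:C
  = r * Q s t + P s t * r' + (P x y - P s t) * (Q x y - Q s t).
  by rewrite /r /r'; move: (P x y) (Q x y) (P s t) (Q s t) ((x - s)%:C) ((y - t)%:C) => *; ring.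
rewrite E {E}.
have k1 : normc (r * Q s t) <= e / 4 * n.
  rewrite normcM; apply: (le_trans (ler_wpM2r Q0 h1)); rewrite mulrAC ler_wpM2r //.
  by rewrite mulrC; apply: le_small_factor => //; exact: ltW.
have k2 : normc (P s t * r') <= e / 4 * n.
  rewrite normcM; apply: (le_trans (ler_wpM2l P0 h2)); rewrite mulrA ler_wpM2r //.
  by apply: le_small_factor => //; exact: ltW.
have k3 : normc ((P x y - P s t) * (Q x y - Q s t)) <= e / 4 * n.
  rewrite normcM; apply: (le_trans (ler_pM (normc_ge0 _) (normc_ge0 _) h3 h4)).
  rewrite mulrA ler_wpM2r // -D5 ler_wpM2r //; first by clear -L'0; lra.
  rewrite ler_wpM2l //; first by clear -L0; lra.
  by rewrite /n mulr2n mulrDl !mul1r; apply: lerD; exact: ltW.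
apply: (le_trans (normcD _ _)); apply: (le_trans (lerD (normcD _ _) (lexx _))).
apply: (le_trans (lerD (lerD k1 k2) k3)); rewrite -!mulrDl ler_wpM2r //.
by clear -e0; lra.
Qed.

Lemma cdiff2_comp (f : C -> C) P s t p q l : cdiff2 P s t p q -> cdiff f (P s t) l ->
  cdiff2 (fun x y => f (P x y)) s t (l * p) (l * q).
Proof.
move=> HP Hf e e0.
pose L := normc p + normc q + 1.
have L0 : 1 <= L by rewrite /L; have := normc_ge0 p; have := normc_ge0 q; lra.
have l0 := normc_ge0 l.
have e1 : 0 < e / (2 * L) by rewrite divr_gt0 //; lra.
have e2 : 0 < e / (2 * (normc l + 1)) by rewrite divr_gt0 //; lra.
have [d d0 Hd] := Hf _ e1; have [d1 d10 Hd1] := HP _ e2.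
have [d2 d20 Hd2] := cdiff2_lip HP.
pose d3 := d / (2 * L).
have d30 : 0 < d3 by rewrite divr_gt0 //; lra.
exists (Num.min d1 (Num.min d2 d3)); first by rewrite !lt_min d10 d20 d30.
move=> x y; rewrite !lt_min => /andP[x1 /andP[x2 x3]] /andP[y1 /andP[y2 y3]].
have h1 := Hd1 x y x1 y1; have h2 := Hd2 x y x2 y2; rewrite -/L in h2.
set r := P x y - P s t - _ - _ in h1.
set n := `|x - s| + `|y - t| in h1 h2 *.
have n0 : 0 <= n by rewrite /n addr_ge0.
set k := P x y - P s t in h2.
have kd : normc k < d.
  apply: (le_lt_trans h2); rewrite (_ : d = L * (2 * d3)); last by rewrite /d3; field; lra.
  by rewrite ltr_pM2l; [rewrite /n; lra|lra].
have := Hd k kd; rewrite (_ : P s t + k = P x y); last by rewrite /k; ring.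
move=> h3.
rewrite (_ : _ - _ = (f (P x y) - f (P s t) - l * k) + l * r); last by rewrite /r /k; ring.
have k1 : e / (2 * L) * normc k <= e / 2 * n.
  apply: (le_trans (ler_wpM2l (ltW e1) h2)); rewrite mulrA ler_wpM2r //.
  by rewrite le_eqVlt; apply/orP; left; apply/eqP; field; lra.
have k2 : normc (l * r) <= e / 2 * n.
  rewrite normcM; apply: (le_trans (ler_wpM2l l0 h1)); rewrite mulrA ler_wpM2r //.
  rewrite (_ : e / 2 = (normc l + 1) * (e / (2 * (normc l + 1)))); last by field; lra.
  by apply: ler_wpM2r; [exact: ltW|lra].
apply: (le_trans (normcD _ _)); lra.
Qed.

Lemma cdiff2_ccont_snd P s t p q : cdiff2 P s t p q -> forall e : R, 0 < e ->
  exists2 d : R, 0 < d & forall x, `|x - t| < d -> normc (P s x - P s t) <= e.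
Proof.
move=> /cdiff2_lip [d d0 Hd] e e0.
pose L := normc p + normc q + 1.
have L0 : 1 <= L by rewrite /L; have := normc_ge0 p; have := normc_ge0 q; lra.
exists (Num.min d (e / L)); first by rewrite lt_min d0 divr_gt0 //; lra.
move=> x; rewrite lt_min => /andP[x1 x2].
have := Hd s x; rewrite subrr normr0 add0r -/L => /(_ d0 x1) h.
apply: (le_trans h); rewrite mulrC -ler_pdivlMr; [exact: ltW|lra].
Qed.

End Goursat_complex.

(** * Cauchy's formula for the derivative on the boundary of a square *)

Section Cauchy.
Context {R : realType}.
Local Notation C := R[i].
Local Notation Re := (@complex.Re R).
Local Notation Im := (@complex.Im R).
Local Notation Ri := segment_integral.
Local Notation Ci := csegment_integral.
Local Notation iC := ('i : C).
Implicit Types (f g : C -> C) (a z w l : C) (s t S : R).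

Definition fourth_root_of_unity w := [\/ w = 1, w = iC, w = -1 | w = - iC].

Lemma iC_sqr : iC * iC = -1.
Proof. by have := @sqr_i R; rewrite expr2. Qed.

Lemma normc_iC : normc iC = 1.
Proof. by rewrite /= expr0n add0r expr1n sqrtr1. Qed.

Lemma normc_fourth_root w : fourth_root_of_unity w -> normc w = 1.
Proof. by case=> ->; rewrite ?normcN ?normc_iC ?normc1. Qed.

Lemma fourth_root_neq0 w : fourth_root_of_unity w -> w != 0.
Proof. by move=> /normc_fourth_root h; rewrite -normc_eq0 h oner_eq0. Qed.

Definition side t : C := 1 + iC * t%:C.

(* The boundary of the square of centre [a] and half-side [s] is run through, side by
   side, by [square_point a w s t] for [-1 <= t <= 1] and [w] a fourth root of unity. *)
Definition square_point a w s t : C := a + (w * s%:C) * side t.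

Definition in_square a S z := `|Re (z - a)| <= S /\ `|Im (z - a)| <= S.

Lemma Re_side t : Re (side t) = 1.
Proof. by rewrite /side /= !mul0r mulr0 subrr addr0. Qed.

Lemma side_ge1 t : 1 <= normc (side t).
Proof. by have := Re_le_normc (side t); rewrite Re_side normr1. Qed.

Lemma side_neq0 t : side t != 0.
Proof. by rewrite -normc_gt0; have := side_ge1 t; lra. Qed.

Lemma side_le2 t : -1 <= t <= 1 -> normc (side t) <= 2.
Proof.
move=> /andP[h1 h2]; have := normcD 1 (iC * t%:C).
rewrite normcM normc1 normc_iC mul1r normc_real => h.
have : `|t| <= 1 by rewrite ler_norml h1.
rewrite /side; lra.
Qed.

Lemma in_square_point a w s t S : fourth_root_of_unity w -> 0 <= s <= S ->
  -1 <= t <= 1 -> in_square a S (square_point a w s t).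
Proof.
move=> hw /andP[s0 sS] /andP[t1 t2]; rewrite /in_square /square_point addrAC subrr add0r.
have st : `|s * t| <= S.
  rewrite normrM (ger0_norm s0); apply: le_trans sS; rewrite -[leRHS]mulr1 ler_wpM2l //.
  by rewrite ler_norml t1.
have sS' : `|s| <= S by rewrite ger0_norm.
have E : s%:C * side t = s +i* (s * t).
  by apply/eqP; rewrite eq_complex /side /=; apply/andP; split; apply/eqP; ring.
have sN u : `|u| <= S -> `|- u| <= S by rewrite normrN.
rewrite -mulrA E; case: hw => ->.
- by rewrite mul1r.
- rewrite (_ : iC * _ = (- (s * t)) +i* s); first by split; rewrite //=; exact: sN.
  by apply/eqP; rewrite eq_complex /=; apply/andP; split; apply/eqP; ring.
- by rewrite mulN1r; split; exact: sN.
- rewrite (_ : - iC * _ = (s * t) +i* (- s)); first by split; rewrite //=; exact: sN.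
  by apply/eqP; rewrite eq_complex /=; apply/andP; split; apply/eqP; ring.
Qed.

Lemma normc_square_point a w s t : fourth_root_of_unity w ->
  normc (square_point a w s t - a) = `|s| * normc (side t).
Proof.
move=> hw; rewrite /square_point addrAC subrr add0r !normcM normc_real.
by rewrite (normc_fourth_root hw) mul1r.
Qed.

Lemma cdiff2_eq (P : R -> R -> C) s t p q p' q' : p = p' -> q = q' -> cdiff2 P s t p q -> cdiff2 P s t p' q'.
Proof. by move=> <- <-. Qed.

Lemma cdiff2_side s t : cdiff2 (fun _ y => side y) s t 0 iC.
Proof.
apply: (cdiff2_eq _ _ (cdiff2D (cdiff2_cst 1 s t) (cdiff2M (cdiff2_cst iC s t) (cdiff2_snd s t)))); ring.
Qed.

Lemma cdiff2_square_point a w s t :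
  cdiff2 (square_point a w) s t (w * side t) (w * s%:C * iC).
Proof.
apply: (cdiff2_eq _ _ (cdiff2D (cdiff2_cst a s t) (cdiff2M (cdiff2M (cdiff2_cst w s t) (cdiff2_fst s t)) (cdiff2_side s t)))); ring.
Qed.

(* The form [g(z) dz] in the coordinates [(s, t)] of one quarter of a square. *)
Definition ring_form_t g a w s t := g (square_point a w s t) * (w * s%:C * iC).
Definition ring_form_s g a w s t := g (square_point a w s t) * (w * side t).

(** Both coefficients come from the pullback of [g(z) dz] under [square_point], whose mixed second
    derivative is symmetric. This is what makes the two middle coefficients coincide. *)
Lemma ring_form_closed g a w s t l : cdiff g (square_point a w s t) l ->
  exists p q r, cdiff2 (ring_form_s g a w) s t p q /\ cdiff2 (ring_form_t g a w) s t q r.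
Proof.
move=> Hg; have H := cdiff2_comp (cdiff2_square_point a w s t) Hg.
do 3 eexists; split.
  exact: (cdiff2M H (cdiff2M (cdiff2_cst w s t) (cdiff2_side s t))).
refine (cdiff2_eq _ _ (cdiff2M H (cdiff2M (cdiff2M (cdiff2_cst w s t) (cdiff2_fst s t)) (cdiff2_cst iC s t)))).
  by ring.
by reflexivity.
Qed.

Lemma closed_formD (P Q P' Q' : R -> R -> C) s t :
  (exists p q r, cdiff2 P s t p q /\ cdiff2 Q s t q r) ->
  (exists p q r, cdiff2 P' s t p q /\ cdiff2 Q' s t q r) ->
  exists p q r, cdiff2 (fun x y => P x y + P' x y) s t p q /\
    cdiff2 (fun x y => Q x y + Q' x y) s t q r.
Proof.
move=> [p [q [r [h1 h2]]]] [p' [q' [r' [h1' h2']]]].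
by exists (p + p'), (q + q'), (r + r'); split; apply: cdiff2D.
Qed.

(** For each [w] the rectangle [[s0, s1] x [-1, 1]] parametrises one trapezoid, and the four
    trapezoids fill the ring between two concentric squares. Goursat's theorem is applied to the sum
    of the four forms, so that the contributions of the diagonal edges cancel and only the two
    boundaries remain. *)
Lemma ring_invariance g a s0 s1 : s0 <= s1 ->
  (forall w s t, fourth_root_of_unity w -> s0 <= s <= s1 -> -1 <= t <= 1 ->
     exists l, cdiff g (square_point a w s t) l) ->
  let Q s t := ring_form_t g a 1 s t + ring_form_t g a iC s t
             + ring_form_t g a (-1) s t + ring_form_t g a (- iC) s t in
  Ci (Q s0) (-1) 1 = Ci (Q s1) (-1) 1.
Proof.
move=> s01 Hg Q.
pose P s t := ring_form_s g a 1 s t + ring_form_s g a iC s t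
             + ring_form_s g a (-1) s t + ring_form_s g a (- iC) s t.
have H s t : s0 <= s <= s1 -> -1 <= t <= 1 ->
    exists p q r, cdiff2 P s t p q /\ cdiff2 Q s t q r.
  move=> hs ht.
  have X w : fourth_root_of_unity w -> exists p q r,
      cdiff2 (ring_form_s g a w) s t p q /\ cdiff2 (ring_form_t g a w) s t q r.
    by move=> hw; have [l hl] := Hg w s t hw hs ht; exact: ring_form_closed hl.
  by do 3 (try apply: closed_formD); apply: X;
    [exact: Or41|exact: Or42|exact: Or43|exact: Or44].
have N11 : -1 <= 1 :> R by lra.
have G := Goursat s01 N11 H.
have cQ s : s0 <= s <= s1 -> ccontinuous_on_segment (Q s) (-1) 1.
  move=> hs t ht e e0; have [p [q [r [_ h]]]] := H s t hs ht.
  exact: cdiff2_ccont_snd h e e0.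
have Z : Ci (fun t => Q s1 t - Q s0 t) (-1) 1 = 0.
  rewrite G (_ : (fun s => _) = fun=> 0 * (0 : C)).
    by rewrite csegment_integralZ ?mul0r //; exact: ccontinuous_cst.
  apply/funext => s; rewrite mul0r; apply/eqP; rewrite subr_eq0; apply/eqP.
  (* The end of the side of direction w is the start of the one of direction iw *)
  have corner w w' : w' = iC * w ->
      ring_form_s g a w s 1 = ring_form_s g a w' s (-1).
    move=> ->; rewrite /ring_form_s /square_point.
    have E : w * side 1 = iC * w * side (-1).
      rewrite /side rmorphN rmorph1 mulrN !mulr1 !mulrDr mulrN mulr1.
      rewrite [iC * w * iC]mulrAC iC_sqr; ring.
    rewrite E (_ : w * s%:C * side 1 = s%:C * (w * side 1)); last by ring.
    by rewrite E; congr (g (a + _) * _); ring.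
  rewrite /P (corner 1 iC) ?mulr1 // (corner iC (-1)) ?iC_sqr //.
  rewrite (corner (-1) (- iC)) ?mulrN1 // (corner (- iC) 1) ?mulrN ?iC_sqr ?opprK //.
  ring.
have h0 : s0 <= s0 <= s1 by rewrite lexx.
have h1 : s0 <= s1 <= s1 by rewrite lexx s01.
have E : Ci (Q s1) (-1) 1 = Ci (Q s0) (-1) 1 + Ci (fun t => Q s1 t - Q s0 t) (-1) 1.
  rewrite -csegment_integralD; [|exact: cQ|apply: ccontinuousB; exact: cQ].
  by apply: eq_csegment_integral => t _; ring.
by rewrite E Z addr0.
Qed.

(* Its value is [2 * pi]; only [4 <= |winding_constant|] is needed. *)
Definition winding_constant : C := Ci (fun t => 4 * (side t)^-1) (-1) 1.

(* The integrand of the contour integral of [f z / (i * (z - a) ^ 2)]. *)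
Definition square_mean f a s t : C :=
  (f (square_point a 1 s t) - iC * f (square_point a iC s t)
   - f (square_point a (-1) s t) + iC * f (square_point a (- iC) s t))
  * (s%:C * side t ^+ 2)^-1.

Lemma ccontinuous_side_inv (a b : R) : ccontinuous_on_segment (fun t => (side t)^-1) a b.
Proof.
move=> t _ e e0.
have h := cdiff2_comp (cdiff2_side 0 t) (cdiff_inv (side_neq0 t)).
exact: cdiff2_ccont_snd h e e0.
Qed.

Lemma ccontinuous_square_point f a w s : (forall t, -1 <= t <= 1 ->
    exists l, cdiff f (square_point a w s t) l) ->
  ccontinuous_on_segment (fun t => f (square_point a w s t)) (-1) 1.
Proof.
move=> H t ht e e0; have [l hl] := H t ht.
exact: cdiff2_ccont_snd (cdiff2_comp (cdiff2_square_point a w s t) hl) e e0.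
Qed.

Lemma ccontinuous_square_mean_of f a s :
  (forall w, fourth_root_of_unity w ->
    ccontinuous_on_segment (fun t => f (square_point a w s t)) (-1) 1) ->
  ccontinuous_on_segment (square_mean f a s) (-1) 1.
Proof.
move=> H.
rewrite (_ : square_mean f a s = fun t =>
  (((f (square_point a 1 s t) - iC * f (square_point a iC s t))
   - f (square_point a (-1) s t)) + iC * f (square_point a (- iC) s t))
  * (s%:C^-1 * ((side t)^-1 * (side t)^-1))); last first.
  by apply/funext => t; rewrite /square_mean invfM expr2 invfM.
apply: ccontinuousM; last first.
  apply: ccontinuousM; first exact: ccontinuous_cst.
  apply: ccontinuousM; exact: ccontinuous_side_inv.
apply: ccontinuousD; last first.
  by apply: ccontinuousM; [exact: ccontinuous_cst|apply: H; exact: Or44].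
apply: ccontinuousB; last by apply: H; exact: Or43.
apply: ccontinuousB; first by apply: H; exact: Or41.
by apply: ccontinuousM; [exact: ccontinuous_cst|apply: H; exact: Or42].
Qed.

Lemma ccontinuous_square_mean f a S s : 0 < s <= S ->
  (forall z, in_square a S z -> exists l, cdiff f z l) ->
  ccontinuous_on_segment (square_mean f a s) (-1) 1.
Proof.
move=> /andP[s0 sS] Hf; apply: ccontinuous_square_mean_of => w hw.
apply: ccontinuous_square_point => t ht.
by apply/Hf/in_square_point => //; rewrite (ltW s0).
Qed.

(** The ring argument is applied to [f(z) / (z - a) ^ 2]. This function is differentiable off the
    centre, which the ring avoids. *)
Lemma square_mean_const f a S s0 s1 : 0 < s0 -> s0 <= s1 -> s1 <= S ->
  (forall z, in_square a S z -> exists l, cdiff f z l) ->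
  Ci (square_mean f a s0) (-1) 1 = Ci (square_mean f a s1) (-1) 1.
Proof.
move=> s0p s01 s1S Hf.
pose g z := f z * ((z - a)^-1 * (z - a)^-1).
have /= := @ring_invariance g a s0 s1 s01 _.
have sp w s t : square_point a w s t - a = w * s%:C * side t by rewrite /square_point; ring.
have rf w s t : fourth_root_of_unity w -> 0 < s ->
    ring_form_t g a w s t = iC * (w^-1 * f (square_point a w s t) * (s%:C * side t ^+ 2)^-1).
  move=> hw hs; rewrite /ring_form_t /g sp; field.
  have sn : s%:C != 0 by rewrite -normc_eq0 normc_real gtr0_norm // gt_eqF.
  by apply/and3P; split; [exact: side_neq0|exact: sn|exact: fourth_root_neq0].
have E s : 0 < s <= S -> Ci (fun t => ring_form_t g a 1 s t + ring_form_t g a iC s t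
       + ring_form_t g a (-1) s t + ring_form_t g a (- iC) s t) (-1) 1
     = iC * Ci (square_mean f a s) (-1) 1.
  move=> hs; have /andP[hs0 _] := hs.
  rewrite -csegment_integralZ; last exact: ccontinuous_square_mean hs Hf.
  apply: eq_csegment_integral => t _.
  rewrite !rf //; [|exact: Or44|exact: Or43|exact: Or42|exact: Or41].
  have iV : iC^-1 = - iC.
    by apply: (mulrI (x := iC)); rewrite ?unitfE ?mulfV ?mulrN ?iC_sqr ?opprK // -normc_eq0 normc_iC oner_eq0.
  rewrite /square_mean !invrN iV invr1; ring.
rewrite !E ?s0p ?(lt_le_trans s0p s01) ?(le_trans s01 s1S) //.
move=> H; apply: (mulrI (x := iC)); first by rewrite unitfE -normc_eq0 normc_iC oner_eq0.
apply: H => w s t hw /andP[hs1 hs2] ht.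
have hs0 : 0 < s by exact: lt_le_trans hs1.
have [l hl] : exists l, cdiff f (square_point a w s t) l.
  by apply/Hf/in_square_point => //; rewrite (ltW hs0) (le_trans hs2).
have nz : square_point a w s t - a != 0.
  have sn : s%:C != 0 by rewrite -normc_eq0 normc_real gtr0_norm // gt_eqF.
  rewrite sp; apply: mulf_neq0; last exact: side_neq0.
  by apply: mulf_neq0 => //; exact: fourth_root_neq0.
have h1 : cdiff (fun z => z - a) (square_point a w s t) (1 - 0).
  by apply: cdiffB; [exact: cdiff_id|exact: cdiff_cst].
have h2 := cdiff_comp h1 (cdiff_inv nz).
by eexists; exact: (cdiffM hl (cdiffM h2 h2)).
Qed.

(** The mean does not depend on the size of the square, so it may be computed on a square so small
    that [f] is nearly affine. *)
Theorem Cauchy_square f a S s l : 0 < s <= S ->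
  (forall z, in_square a S z -> exists l, cdiff f z l) -> cdiff f a l ->
  Ci (square_mean f a s) (-1) 1 = winding_constant * l.
Proof.
move=> /andP[s0 sS] Hf Hl.
apply/eqP; rewrite -subr_eq0 -normc_eq0 eq_le normc_ge0 andbT.
apply/ler_addgt0Pl => e e0; rewrite addr0.
have e16 : 0 < e / 16 by rewrite divr_gt0.
have [d d0 Hd] := Hl _ e16.
(* A boundary point lies within [2 * r] of the centre, hence closer than [d]. *)
pose r := Num.min s (d / 3).
have r0 : 0 < r by rewrite lt_min s0 divr_gt0.
have rs : r <= s by rewrite ge_min lexx.
have rd : r <= d / 3 by rewrite ge_min lexx orbT.
rewrite -(square_mean_const r0 rs sS Hf) /winding_constant mulrC.
have cS : ccontinuous_on_segment (fun t => 4 * (side t)^-1) (-1) 1.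
  by apply: ccontinuousM; [exact: ccontinuous_cst|exact: ccontinuous_side_inv].
have cM : ccontinuous_on_segment (square_mean f a r) (-1) 1.
  by apply: ccontinuous_square_mean Hf; rewrite r0 (le_trans rs).
have cN : ccontinuous_on_segment (fun t => -1 * (l * (4 * (side t)^-1))) (-1) 1.
  by do 2 (apply: ccontinuousM; first exact: ccontinuous_cst).
have -> : Ci (square_mean f a r) (-1) 1 - l * Ci (fun t => 4 * (side t)^-1) (-1) 1
    = Ci (fun t => square_mean f a r t + -1 * (l * (4 * (side t)^-1))) (-1) 1.
  have cL : ccontinuous_on_segment (fun t => l * (4 * (side t)^-1)) (-1) 1.
    by apply: ccontinuousM; first exact: ccontinuous_cst.
  by rewrite csegment_integralD // (csegment_integralZ (-1) cL) (csegment_integralZ l cS) mulN1r.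
have N11 : -1 <= 1 :> R by lra.
rewrite (_ : e = 2 * (e / 4) * (1 - -1)); last by field.
apply: csegment_integral_bound => //.
  exact: ccontinuousD.
move=> t ht.
(* The constant [f a] drops out because the coefficients [1], [-i], [-1], [i] add up to zero. The
   linear part produces exactly the integrand of [winding_constant]. *)
pose E w := f (square_point a w r t) - f a - l * (square_point a w r t - a).
have EB w : fourth_root_of_unity w -> normc (E w) <= e / 16 * (r * normc (side t)).
  move=> hw; have := normc_square_point a r t hw; rewrite (gtr0_norm r0) => n.
  rewrite -n; have := Hd (square_point a w r t - a).
  rewrite (addrC a) subrK; apply; rewrite n.
  have := side_le2 ht; have := side_ge1 t; nra.
have nr : r%:C != 0 by rewrite -normc_eq0 normc_real gtr0_norm // gt_eqF.
rewrite (_ : _ + _ = (E 1 - iC * E iC - E (-1) + iC * E (- iC)) * (r%:C * side t ^+ 2)^-1); last first.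
  rewrite /square_mean.
  rewrite (_ : 4 * (side t)^-1 = (4 * r%:C * side t) * (r%:C * side t ^+ 2)^-1); last first.
    by field; rewrite side_neq0; exact: nr.
  rewrite -[in RHS]mulrC [RHS]mulrC.
  have aux (x y k : C) : x * k + -1 * (l * (y * k)) = (x - l * y) * k by ring.
  rewrite aux; congr (_ * _); rewrite /E /square_point.
  have aux2 (X1 X2 X3 X4 F A u v : C) :
      X1 - iC * X2 - X3 + iC * X4 - l * (4 * u * v) =
      (X1 - F - l * (A + 1 * u * v - A)) - iC * (X2 - F - l * (A + iC * u * v - A))
      - (X3 - F - l * (A + -1 * u * v - A))
      + iC * (X4 - F - l * (A + - iC * u * v - A)).
    by ring: iC_sqr.
  exact: aux2.
rewrite normcM normcV normcM normcX normc_real (gtr0_norm r0).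
have n1 := side_ge1 t.
rewrite ler_pdivrMr; last by rewrite mulr_gt0 // exprn_gt0 //; lra.
have b1 := EB _ (Or41 _ _ _ (erefl 1)).
have b2 := EB _ (Or42 _ _ _ (erefl iC)).
have b3 := EB _ (Or43 _ _ _ (erefl (-1))).
have b4 := EB _ (Or44 _ _ _ (erefl (- iC))).
apply: (le_trans (normcD _ _)); apply: (le_trans (lerD (normcB _ _) (lexx _))).
apply: (le_trans (lerD (lerD (normcB _ _) (lexx _)) (lexx _))).
rewrite !(normcM iC) normc_iC !mul1r.
apply: (le_trans (lerD (lerD (lerD b1 b2) b3) b4)).
rewrite (_ : _ + _ = e / 4 * (r * normc (side t))); last by field.
rewrite expr2 mulrA; apply: ler_wpM2l; first by rewrite divr_ge0 // ltW.
by rewrite ler_peMr // mulr_ge0 ?normc_ge0 // ltW.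
Qed.

End Cauchy.

(** * Cauchy estimates, mean values and differentiability of the derivative *)

Section Cauchy_consequences.
Context {R : realType}.
Local Notation C := R[i].
Local Notation Re := (@complex.Re R).
Local Notation Im := (@complex.Im R).
Local Notation Ri := segment_integral.
Local Notation Ci := csegment_integral.
Local Notation iC := ('i : C).
Local Notation K := (@winding_constant R).
Implicit Types (f g : C -> C) (a z w l : C) (s t S : R).

(** The real part of the integrand is [4 / (1 + t ^ 2)], at least 2 on a segment of length 2. *)
Lemma normc_winding_constant : 4 <= normc K.
Proof.
apply: le_trans (le_trans (ler_norm _) (Re_le_normc _)).
rewrite [leRHS](_ : _ = Ri (fun t => Re (4 * (side t)^-1)) (-1) 1) //.
have N11 : -1 <= 1 :> R by lra.
rewrite (_ : 4 = 2 * (1 - -1)); last by ring.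
rewrite -(segment_integral_cst _ N11); apply: le_segment_integral.
- exact: continuous_on_segment_cst.
- apply: ccontinuous_Re; apply: ccontinuousM; first exact: ccontinuous_cst.
  exact: ccontinuous_side_inv.
move=> t /andP[t1 t2].
have E : side t = 1 +i* t.
  by apply/eqP; rewrite eq_complex /side /=; apply/andP; split; apply/eqP; ring.
have t0 : 0 < 1 ^+ 2 + t ^+ 2 by rewrite expr1n ltr_wpDr ?sqr_ge0.
have -> : Re (4 * (side t)^-1) = 4 / (1 ^+ 2 + t ^+ 2).
  rewrite E -(rmorph_nat (real_complex R) 4) /=; field.
  by move: t0; rewrite expr1n expr2 => t0; rewrite gt_eqF.
by rewrite ler_pdivlMr // expr1n; nra.
Qed.

(** Four sides give [4 * M / s]; the length of the parameter segment and the separate treatment of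
    real and imaginary parts each double it. *)
Lemma square_mean_bound f a s M : 0 < s ->
  (forall w t, fourth_root_of_unity w -> -1 <= t <= 1 -> normc (f (square_point a w s t)) <= M) ->
  ccontinuous_on_segment (square_mean f a s) (-1) 1 ->
  normc (Ci (square_mean f a s) (-1) 1) <= 16 * M / s.
Proof.
move=> s0 H Hc; have N11 : -1 <= 1 :> R by lra.
rewrite (_ : 16 * M / s = 2 * (4 * M / s) * (1 - -1)); last by field; rewrite gt_eqF.
apply: csegment_integral_bound => // t ht.
have n1 := side_ge1 t.
rewrite /square_mean normcM normcV normcM normcX normc_real gtr0_norm //.
have h1 := H _ _ (Or41 _ _ _ (erefl 1)) ht.
have h2 := H _ _ (Or42 _ _ _ (erefl iC)) ht.
have h3 := H _ _ (Or43 _ _ _ (erefl (-1))) ht.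
have h4 := H _ _ (Or44 _ _ _ (erefl (- iC))) ht.
have M0 : 0 <= M := le_trans (normc_ge0 _) h1.
apply: (le_trans (y := 4 * M / (s * normc (side t) ^+ 2))).
  apply: ler_wpM2r; first by rewrite invr_ge0 mulr_ge0 ?exprn_ge0 ?normc_ge0 // ltW.
  apply: (le_trans (normcD _ _)); apply: (le_trans (lerD (normcB _ _) (lexx _))).
  apply: (le_trans (lerD (lerD (normcB _ _) (lexx _)) (lexx _))).
  rewrite !(normcM iC) normc_iC !mul1r; lra.
apply: ler_wpM2l; first by rewrite mulr_ge0.
rewrite lef_pV2 ?posrE // ?mulr_gt0 ?exprn_gt0 //; try lra.
by apply: ler_peMr; [exact: ltW|rewrite expr2; nra].
Qed.

Lemma Cauchy_estimate f a S M l : 0 < S ->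
  (forall z, in_square a S z -> exists l, cdiff f z l) -> cdiff f a l ->
  (forall z, in_square a S z -> normc (f z) <= M) -> normc l <= 4 * M / S.
Proof.
move=> S0 Hf Hl HM; have SS : 0 < S <= S by rewrite S0 lexx.
have E := Cauchy_square SS Hf Hl.
have B : normc (Ci (square_mean f a S) (-1) 1) <= 16 * M / S.
  apply: square_mean_bound => //; last exact: ccontinuous_square_mean SS Hf.
  by move=> w t hw ht; apply/HM/in_square_point; rewrite // (ltW S0) lexx.
rewrite E normcM in B; have := normc_winding_constant; have := normc_ge0 l.
move: B; rewrite (_ : 16 * M / S = 4 * (4 * M / S)); last by field; rewrite gt_eqF.
set X := 4 * M / S; nra.
Qed.

(** This is the formula for the derivative applied to [(z - a) * f z], whose derivative at [a] is
    [f a]. No separate Cauchy formula for values is required. *)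
Lemma mean_value_square f a S s : 0 < s <= S ->
  (forall z, in_square a S z -> exists l, cdiff f z l) ->
  Ci (fun t => (f (square_point a 1 s t) + f (square_point a iC s t)
   + f (square_point a (-1) s t) + f (square_point a (- iC) s t)) * (side t)^-1) (-1) 1
  = K * f a.
Proof.
move=> sS Hf; have /andP[s0 sS'] := sS.
have D z l : cdiff f z l -> cdiff (fun z => (z - a) * f z) z ((1 - 0) * f z + (z - a) * l).
  move=> h; apply: cdiffM h; apply: cdiffB; [exact: cdiff_id|exact: cdiff_cst].
have aS : in_square a S a.
  by rewrite /in_square subrr /= normr0; split; exact: (le_trans (ltW s0)).
have [l hl] := Hf a aS.
have := D a l hl; rewrite subrr mul0r addr0 subr0 mul1r => hD.
rewrite -(Cauchy_square sS _ hD); last first.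
  by move=> z /Hf [m hm]; eexists; exact: D hm.
apply: eq_csegment_integral => t _; rewrite /square_mean /square_point.
have sn : s%:C != 0 by rewrite -normc_eq0 normc_real gtr0_norm // gt_eqF.
have nz := side_neq0 t.
rewrite expr2 !invfM.
have aux (X1 X2 X3 X4 u v : C) : u != 0 -> v != 0 ->
   (X1 + X2 + X3 + X4) / v =
   ((a + 1 * u * v - a) * X1 - iC * ((a + iC * u * v - a) * X2)
    - (a + -1 * u * v - a) * X3 + iC * ((a + - iC * u * v - a) * X4)) * (u^-1 * (v^-1 * v^-1)).
  move=> u0 v0.
  rewrite (_ : _ - _ - _ + _ = (X1 + X2 + X3 + X4) * (u * v)); last by ring: (@iC_sqr R).
  by field; rewrite u0 v0.
exact: aux.
Qed.

Definition side_energy f a s w : R :=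
  Ri (fun t => normc (f (square_point a w s t)) ^+ 2) (-1) 1.

(* Young's inequality |x| <= A/8 + 2 x^2/A turns the L^1 bound into an L^2 bound *)
Lemma mean_value_square_L2 f a S s : 0 < s <= S ->
  (forall z, in_square a S z -> exists l, cdiff f z l) ->
  normc (f a) ^+ 2 <= 2 * (side_energy f a s 1 + side_energy f a s iC
    + side_energy f a s (-1) + side_energy f a s (- iC)).
Proof.
pose I := side_energy f a s.
move=> sS Hf; rewrite -![side_energy f a s _]/(I _); have /andP[s0 sS'] := sS.
set A := normc (f a).
have cw w : fourth_root_of_unity w -> ccontinuous_on_segment (fun t => f (square_point a w s t)) (-1) 1.
  move=> hw; apply: ccontinuous_square_point => t ht.
  by apply/Hf/in_square_point => //; rewrite (ltW s0).
have I0 w : 0 <= I w by apply: Rintegral_ge0 => x _; exact: sqr_ge0.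
have [A0|A0] := ltP 0 A; last first.
  have -> : A = 0 by apply/le_anti; rewrite A0 normc_ge0.
  by rewrite expr0n /= mulr_ge0 // !addr_ge0.
have csq w : fourth_root_of_unity w ->
    continuous_on_segment (fun t => normc (f (square_point a w s t)) ^+ 2) (-1) 1.
  move=> hw t ht.
  have h := ccontinuousM (cw w hw) (cw w hw).
  have h2 := ccontinuous_normc h.
  move=> e e0; have [d d0 Hd] := h2 t ht e e0; exists d => // u /Hd.
  by rewrite !normcM !expr2.
pose g t := A / 2 + 2 / A * (normc (f (square_point a 1 s t)) ^+ 2
  + normc (f (square_point a iC s t)) ^+ 2 + normc (f (square_point a (-1) s t)) ^+ 2
  + normc (f (square_point a (- iC) s t)) ^+ 2).
have c4 : continuous_on_segment (fun t => normc (f (square_point a 1 s t)) ^+ 2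
  + normc (f (square_point a iC s t)) ^+ 2 + normc (f (square_point a (-1) s t)) ^+ 2
  + normc (f (square_point a (- iC) s t)) ^+ 2) (-1) 1.
  do ?(apply: continuous_on_segmentD); apply: csq; [exact: Or41|exact: Or42|exact: Or43|exact: Or44].
have c4' : continuous_on_segment (fun t => 2 / A * (normc (f (square_point a 1 s t)) ^+ 2
  + normc (f (square_point a iC s t)) ^+ 2 + normc (f (square_point a (-1) s t)) ^+ 2
  + normc (f (square_point a (- iC) s t)) ^+ 2)) (-1) 1.
  move=> t ht e e0.
  have eA : 0 < e * A / 2 by rewrite divr_gt0 // mulr_gt0.
  have [d d0 Hd] := c4 t ht _ eA; exists d => // u /Hd h.
  rewrite -mulrBr normrM gtr0_norm ?divr_gt0 //.
  by rewrite mulrAC ler_pdivrMr // mulrC -ler_pdivlMr.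
have N11 : -1 <= 1 :> R by lra.
have B : normc (K * f a) <= 2 * Ri g (-1) 1.
  rewrite -(mean_value_square sS Hf); apply: csegment_integral_le.
  - apply: ccontinuousM; last exact: ccontinuous_side_inv.
    do ?(apply: ccontinuousD); apply: cw; [exact: Or41|exact: Or42|exact: Or43|exact: Or44].
  - by apply: continuous_on_segmentD => //; exact: continuous_on_segment_cst.
  move=> t _; rewrite normcM normcV.
  have n1 := side_ge1 t.
  rewrite ler_pdivrMr; last by lra.
  have Y x : 0 <= x -> x <= A / 8 + 2 / A * x ^+ 2.
    move=> x0; rewrite -subr_ge0.
    rewrite (_ : _ - x = 2 / A * (x - A / 4) ^+ 2); last by field; rewrite gt_eqF.
    by rewrite mulr_ge0 ?sqr_ge0 // divr_ge0 // ltW.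
  have h1 := Y _ (normc_ge0 (f (square_point a 1 s t))).
  have h2 := Y _ (normc_ge0 (f (square_point a iC s t))).
  have h3 := Y _ (normc_ge0 (f (square_point a (-1) s t))).
  have h4 := Y _ (normc_ge0 (f (square_point a (- iC) s t))).
  have g0 : 0 <= g t.
    by rewrite /g addr_ge0 ?divr_ge0 ?mulr_ge0 ?addr_ge0 ?sqr_ge0 ?invr_ge0 // ltW.
  apply: (le_trans (y := g t)); last by rewrite ler_peMr.
  apply: (le_trans (normcD _ _)); apply: (le_trans (lerD (normcD _ _) (lexx _))).
  apply: (le_trans (lerD (lerD (normcD _ _) (lexx _)) (lexx _))).
  apply: (le_trans (lerD (lerD (lerD h1 h2) h3) h4)).
  by rewrite le_eqVlt /g; apply/orP; left; apply/eqP; field; rewrite gt_eqF.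
have E : Ri g (-1) 1 = A + 2 / A * (I 1 + I iC + I (-1) + I (- iC)).
  rewrite /g segment_integralD //; last exact: continuous_on_segment_cst.
  rewrite segment_integral_cst // segment_integralZ //.
  have D4 (q1 q2 q3 q4 : R -> R) : continuous_on_segment q1 (-1) 1 ->
      continuous_on_segment q2 (-1) 1 -> continuous_on_segment q3 (-1) 1 ->
      continuous_on_segment q4 (-1) 1 ->
      Ri (fun t => q1 t + q2 t + q3 t + q4 t) (-1) 1
      = Ri q1 (-1) 1 + Ri q2 (-1) 1 + Ri q3 (-1) 1 + Ri q4 (-1) 1.
    move=> h1 h2 h3 h4; have h12 := continuous_on_segmentD h1 h2.
    have h123 := continuous_on_segmentD h12 h3.
    by rewrite (segment_integralD h123 h4) (segment_integralD h12 h3) segment_integralD.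
  rewrite D4; try (apply: csq); [|exact: Or41|exact: Or42|exact: Or43|exact: Or44].
  by congr (_ + _); field.
rewrite E normcM -/A in B.
have h := normc_winding_constant.
have : 4 * A <= 2 * (A + 2 / A * (I 1 + I iC + I (-1) + I (- iC))).
  by apply: le_trans B; rewrite ler_pM2r.
set T := I 1 + I iC + I (-1) + I (- iC) => hT.
have : 2 * A <= 4 / A * T by lra.
rewrite mulrAC ler_pdivlMr //; rewrite expr2; lra.
Qed.

Lemma is_derive_eps (phi : R -> R) (t m : R) :
  (forall e : R, 0 < e -> exists2 d : R, 0 < d &
    forall u, `|u| < d -> `|phi (t + u) - phi t - m * u| <= e * `|u|) ->
  is_derive t 1 phi m.
Proof.
move=> H.
have h : (fun h => h^-1 *: ((phi \o shift t) (h *: 1) - phi t)) @ 0^' --> m.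
  apply/cvgrPdist_le => e e0; have [d d0 Hd] := H e e0.
  rewrite /dnbhs near_withinE; near=> u => u0.
  have ud : `|u| < d by near: u; apply/nbhs_ballP; exists d => // x; rewrite /ball /= sub0r normrN.
  have := Hd u ud; rewrite /= [u *: 1](mulr1) (addrC t) => Hu.
  have nu : 0 < `|u| by rewrite normr_gt0.
  rewrite distrC -(ler_pM2r nu) -normrM; apply: le_trans Hu.
  rewrite (_ : _ * u = phi (u + t) - phi t - m * u) // mulrBl.
  by rewrite [_ *: _]/(_ * _) mulrAC mulVf // mul1r.
by apply: DeriveDef; [apply/cvg_ex; exists m|apply: cvg_lim].
Unshelve. all: by end_near. Qed.

(** The real mean value theorem is used along the segment for the real part and for the imaginary
    part, whose intermediate points differ. This costs the factor 2. *)
Lemma mean_value_inequality f (f' : C -> C) z h M :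
  (forall t : R, 0 <= t <= 1 -> cdiff f (z + t%:C * h) (f' (z + t%:C * h))) ->
  (forall t : R, 0 <= t <= 1 -> normc (f' (z + t%:C * h)) <= M) ->
  normc (f (z + h) - f z) <= 2 * (M * normc h).
Proof.
move=> Hf HM.
(* The functional [p] stands for the real or the imaginary part, so both are treated at once. *)
have D (p : C -> R) : (forall x y, p (x - y) = p x - p y) ->
    (forall x (u : R), p (x * u%:C) = p x * u) -> (forall x, `|p x| <= normc x) ->
    `|p (f (z + h) - f z)| <= M * normc h.
  move=> pB pZ pn.
  pose phi (t : R) := p (f (z + t%:C * h)).
  have dphi t : 0 <= t <= 1 -> is_derive t 1 phi (p (f' (z + t%:C * h) * h)).
    move=> ht; apply: is_derive_eps => e e0.
    have h1 : 0 < normc h + 1 by have := normc_ge0 h; lra.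
    have e1 : 0 < e / (normc h + 1) by rewrite divr_gt0.
    have [d d0 Hd] := Hf t ht _ e1.
    exists (d / (normc h + 1)); first by rewrite divr_gt0.
    move=> u; rewrite ltr_pdivlMr // => hu.
    have nuh : normc (u%:C * h) <= `|u| * (normc h + 1).
      by rewrite normcM normc_real ler_wpM2l // lerDl.
    have := Hd (u%:C * h) (le_lt_trans nuh hu).
    rewrite (_ : z + t%:C * h + u%:C * h = z + (t + u)%:C * h); last by rewrite rmorphD; ring.
    rewrite -pZ /phi -!pB => H.
    apply: (le_trans (pn _)).
    rewrite (_ : _ * h * u%:C = f' (z + t%:C * h) * (u%:C * h)); last by ring.
    apply: (le_trans H); apply: (le_trans (ler_wpM2l (ltW e1) nuh)).
    by rewrite mulrCA -mulrA mulVf ?mulr1 ?gt_eqF // mulrC.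
  have dM (x : R) : x \in `]0, 1[ -> is_derive x 1 phi (p (f' (z + x%:C * h) * h)).
    by rewrite in_itv /= => /andP[t0 t1]; apply: dphi; rewrite !ltW.
  have cM : {within `[0, 1], continuous phi}.
    apply: continuous_on_segment_within => t ht e e0.
    have [ex dv] := dphi t ht.
    have : differentiable phi t by apply/derivable1_diffP.
    move=> /differentiable_continuous /cvgrPdist_le /(_ e e0).
    move/nbhs_ballP => [d d0 Hd]; exists d => // u hu.
    by rewrite distrC; apply: Hd; rewrite /ball /= distrC.
  have [c hc E] := MVT ltr01 dM cM.
  rewrite in_itv /= in hc; move/andP: hc => [c0 c1].
  move: E; rewrite /phi subr0 mulr1 rmorph1 mul1r rmorph0 mul0r addr0 => E.
  rewrite pB E; apply: (le_trans (pn _)); rewrite normcM ler_wpM2r ?normc_ge0 //.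
  by apply: HM; rewrite !ltW.
have hR := D Re _ _ (@Re_le_normc R).
have hI := D Im _ _ (@Im_le_normc R).
apply: (le_trans (normc_le _)); rewrite mulr2n mulrDl !mul1r; apply: lerD.
- by apply: hR => [x y|x u]; [rewrite Re_addc Re_oppc|rewrite Re_mulc /= mulr0 subr0].
- by apply: hI => [x y|x u]; [rewrite Im_addc Im_oppc|rewrite Im_mulc /= mulr0 add0r].
Qed.


Lemma in_square_sub a S z T w : in_square a S z -> in_square z T w -> in_square a (S + T) w.
Proof.
move=> [h1 h2] [k1 k2]; split.
  rewrite (_ : Re (w - a) = Re (z - a) + Re (w - z)); last first.
    by rewrite !(Re_addc, Re_oppc); ring.
  by apply: (le_trans (ler_normD _ _)); apply: lerD.
rewrite (_ : Im (w - a) = Im (z - a) + Im (w - z)); last first.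
  by rewrite !(Im_addc, Im_oppc); ring.
by apply: (le_trans (ler_normD _ _)); apply: lerD.
Qed.

Lemma in_square_trans a S z T U w : in_square a S z -> in_square z T w ->
  S + T <= U -> in_square a U w.
Proof.
move=> h1 h2 STU; have [k1 k2] := in_square_sub h1 h2.
by split; apply: le_trans STU.
Qed.

Lemma in_square_normc a S z : normc (z - a) <= S -> in_square a S z.
Proof.
by move=> h; split; [apply: le_trans (Re_le_normc _) h|apply: le_trans (Im_le_normc _) h].
Qed.

Lemma normc_in_square a S z : in_square a S z -> normc (z - a) <= 2 * S.
Proof. by move=> [h1 h2]; apply: (le_trans (normc_le _)); lra. Qed.

Lemma in_square_segment a S z h t : in_square a S z -> in_square a S (z + h) ->
  0 <= t <= 1 -> in_square a S (z + t%:C * h).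
Proof.
move=> [h1 h2] [k1 k2] /andP[t0 t1].
have aux (x y : R) : `|x| <= S -> `|x + y| <= S -> `|x + t * y| <= S.
  rewrite !ler_norml => /andP[? ?] /andP[? ?].
  by apply/andP; split; nra.
split.
  rewrite (_ : Re _ = Re (z - a) + t * Re h).
    apply: aux => //; move: k1; congr (`|_| <= _); rewrite !(Re_addc, Re_oppc); ring.
  by rewrite !(Re_addc, Re_oppc, Re_mulc) /= ; ring.
rewrite (_ : Im _ = Im (z - a) + t * Im h).
  apply: aux => //; move: k2; congr (`|_| <= _); rewrite !(Im_addc, Im_oppc); ring.
by rewrite !(Im_addc, Im_oppc, Im_mulc) /= ; ring.
Qed.

Lemma in_square_le a S T z : S <= T -> in_square a S z -> in_square a T z.
Proof. by move=> ST [h1 h2]; split; [apply: le_trans h1 ST|apply: le_trans h2 ST]. Qed.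

Lemma coef_ge0 (n : nat) (M x : R) : 0 <= M -> 0 <= x -> 0 <= n%:R * M / x.
Proof. by move=> M0 x0; rewrite divr_ge0 ?mulr_ge0. Qed.

Lemma fraction_le (x : R) : 0 < x -> [/\ x / 2 <= x, x / 4 <= x & x / 8 <= x / 4].
Proof. by move=> x0; split; lra. Qed.

Lemma fraction_leD (x : R) : 0 < x -> [/\ x / 8 + x / 8 <= x, x / 8 <= x / 2,
  x / 2 + x / 8 <= x & x / 8 + x / 8 <= x / 4].
Proof. by move=> x0; split; lra. Qed.

Section bounded_on_square.
Variables (f f' : C -> C) (a : C) (S M : R).
Hypotheses (S0 : 0 < S) (Hf : forall z, in_square a S z -> cdiff f z (f' z))
  (HM : forall z, in_square a S z -> normc (f z) <= M).

Lemma derivative_bound z : in_square a (S / 2) z -> normc (f' z) <= 8 * M / S.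
Proof.
move=> hz; have SS : S / 2 + S / 2 <= S by lra.
have S2 : 0 < S / 2 by rewrite divr_gt0.
rewrite (_ : 8 * M / S = 4 * M / (S / 2)); last by field; rewrite gt_eqF.
apply: (Cauchy_estimate S2 _ (Hf _)).
- by move=> w hw; exists (f' w); apply/Hf/(in_square_trans hz hw).
- by apply: (in_square_trans hz _ SS); rewrite /in_square subrr /= normr0 (ltW S2).
- by move=> w hw; apply/HM/(in_square_trans hz hw).
Qed.

Lemma lipschitz_on_square z h : in_square a (S / 2) z -> in_square a (S / 2) (z + h) ->
  normc (f (z + h) - f z) <= 16 * M / S * normc h.
Proof.
move=> hz hzh.
rewrite (_ : 16 * M / S * normc h = 2 * (8 * M / S * normc h)); last by ring.
have sub w : in_square a (S / 2) w -> in_square a S w.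
  by apply: in_square_le; have [] := fraction_le S0.
apply: (@mean_value_inequality f f') => t ht.
  by apply/Hf/sub/in_square_segment.
by apply/derivative_bound/in_square_segment.
Qed.

(** Without a second derivative at hand, the Cauchy estimate is applied to the increment
    [f (u + h) - f u], already known to be of order [h]. *)
Lemma derivative_lipschitz z h : in_square a (S / 4) z -> in_square a (S / 4) (z + h) ->
  normc (f' (z + h) - f' z) <= 256 * M / S ^+ 2 * normc h.
Proof.
move=> hz hzh.
have S4 : 0 < S / 4 by rewrite divr_gt0.
have SS : S / 4 + S / 4 <= S / 2 by lra.
have sub w : in_square a (S / 2) w -> in_square a S w.
  by apply: in_square_le; have [] := fraction_le S0.
have D w : in_square z (S / 4) w ->
    cdiff (fun u => f (u + h) - f u) w (f' (w + h) - f' w).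
  move=> hw; apply: cdiffB.
    have h1 : cdiff (fun u => u + h) w (1 + 0) by apply: cdiffD; [exact: cdiff_id|exact: cdiff_cst].
    have := cdiff_comp h1 (Hf _); rewrite addr0 mulr1; apply.
    apply/sub/(in_square_trans hzh _ SS).
    by move: hw; rewrite /in_square (_ : w + h - (z + h) = w - z) //; ring.
  by apply/Hf/sub/(in_square_trans hz hw).
rewrite (_ : 256 * M / S ^+ 2 * normc h = 4 * (16 * M / S * normc h) / (S / 4)); last first.
  by field; rewrite gt_eqF.
apply: (Cauchy_estimate S4 _ (D _ _)).
- by move=> w hw; eexists; exact: D hw.
- by rewrite /in_square subrr /= normr0 (ltW S4).
- move=> w hw; apply: lipschitz_on_square; first exact: in_square_trans hz hw SS.
  apply: (in_square_trans hzh _ SS).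
  by move: hw; rewrite /in_square (_ : w + h - (z + h) = w - z) //; ring.
Qed.

(** The mean value inequality is applied to [f u - f' z * u], whose derivative [f' u - f' z] is
    controlled by the Lipschitz bound. *)
Lemma Taylor_on_square z h : in_square a (S / 4) z -> in_square a (S / 4) (z + h) ->
  normc (f (z + h) - f z - f' z * h) <= 512 * M / S ^+ 2 * normc h ^+ 2.
Proof.
move=> hz hzh.
have sub w : in_square a (S / 4) w -> in_square a S w.
  by apply: in_square_le; have [] := fraction_le S0.
have M0 : 0 <= M by apply: le_trans (normc_ge0 _) (HM (sub _ hz)).
have E : f (z + h) - f z - f' z * h =
    (fun u => f u - f' z * u) (z + h) - (fun u => f u - f' z * u) z by ring.
rewrite E (_ : 512 * M / S ^+ 2 * normc h ^+ 2 = 2 * (256 * M / S ^+ 2 * normc h * normc h)); last by ring.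
apply: (@mean_value_inequality (fun u => f u - f' z * u) (fun u => f' u - f' z)) => t ht.
  have hw := in_square_segment hz hzh ht.
  apply: cdiffB; first exact/Hf/sub.
  rewrite -[X in cdiff _ _ X]mulr1; exact: cdiffMl (cdiff_id _).
have hw := in_square_segment hz hzh ht.
apply: (le_trans (derivative_lipschitz hz hw)).
apply: ler_wpM2l; first exact: coef_ge0 M0 (sqr_ge0 _).
rewrite normcM normc_real; move/andP: ht => [t0 t1].
by rewrite ger0_norm // ler_piMl ?normc_ge0.
Qed.

(* Both sides of [f'' = K^-1 * mean of f'] are limits of difference quotients *)
Lemma derivative_cdiff : exists m, cdiff f' a m.
Proof.
have [F1 F2 F3] := fraction_le S0; have [F4 F5 F6 F7] := fraction_leD S0.
pose s := S / 8; have s0 : 0 < s by rewrite divr_gt0.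
have M0 : 0 <= M.
  apply: le_trans (normc_ge0 _) (HM (z := a) _).
  by rewrite /in_square subrr /= normr0 (ltW S0).
have aT T : 0 <= T -> in_square a T a by rewrite /in_square subrr /= normr0.
have sub T w : T <= S -> in_square a T w -> in_square a S w.
  exact: in_square_le.
have K0 : K != 0 by rewrite -normc_gt0; have := normc_winding_constant; lra.
have spS w t : fourth_root_of_unity w -> -1 <= t <= 1 -> in_square a (S / 8) (square_point a w s t).
  by move=> hw ht; apply: in_square_point; rewrite // (ltW s0) lexx.
have cf' : ccontinuous_on_segment (square_mean f' a s) (-1) 1.
  apply: ccontinuous_square_mean_of => w hw t ht e e0.
  pose L := 256 * M / S ^+ 2 + 1.
  have L0 : 0 < L by apply: ltr_wpDl ltr01; exact: coef_ge0 M0 (sqr_ge0 _).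
  have eL : 0 < Num.min (e / L) (S / 8) by rewrite lt_min !divr_gt0.
  have [d d0 Hd] := cdiff2_ccont_snd (cdiff2_square_point a w s t) eL.
  exists d => // u /Hd; rewrite le_min => /andP[h1 h2].
  set p := square_point a w s t in h1 h2 *; set q := square_point a w s u in h1 h2 *.
  have ip : in_square a (S / 4) p.
    by apply: in_square_le (spS w t hw ht); have [] := fraction_le S0.
  have iq : in_square a (S / 4) (p + (q - p)).
    apply: (in_square_trans (spS w t hw ht) (T := S / 8)) => //.
    by apply: in_square_normc; rewrite -/p addrAC subrr add0r.
  have := derivative_lipschitz ip iq; rewrite (addrC p) subrK => h.
  apply: (le_trans h); apply: (le_trans (y := L * normc (q - p))).
    by rewrite ler_wpM2r ?normc_ge0 // lerDl.
  by rewrite mulrC -ler_pdivlMr.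
exists (K^-1 * Ci (square_mean f' a s) (-1) 1) => e e0.
pose B := 16 * (512 * M / S ^+ 2) / s + 1.
have B0 : 0 < B.
  by apply: ltr_wpDl ltr01; apply: coef_ge0 (ltW s0); exact: coef_ge0 M0 (sqr_ge0 _).
exists (Num.min (S / 8) (e / B)); first by rewrite lt_min !divr_gt0.
move=> h; rewrite lt_min => /andP[hS he].
have ih w T : T + S / 8 <= S -> in_square a T w -> in_square a (T + S / 8) (w + h).
  move=> TS hw; apply: (in_square_trans hw (T := S / 8)) => //.
  by apply: in_square_normc; rewrite addrAC subrr add0r ltW.
have D w : in_square a (S / 2) w -> cdiff (fun u => f (u + h) - f u) w (f' (w + h) - f' w).
  move=> hw; apply: cdiffB.
    have h1 : cdiff (fun u => u + h) w (1 + 0) by apply: cdiffD; [exact: cdiff_id|exact: cdiff_cst].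
    have := cdiff_comp h1 (Hf _); rewrite addr0 mulr1; apply.
    by apply: (sub (S / 2 + S / 8)); last apply: ih.
  by apply/Hf/(sub (S / 2)).
have sS : 0 < s <= S / 2 by rewrite s0 /s.
have E1 := Cauchy_square sS (fun z hz => ex_intro _ _ (D z hz)) (D a (aT _ (ltW (divr_gt0 S0 (ltr0n R 2))))).
have c1 := ccontinuous_square_mean sS (fun z hz => ex_intro _ _ (D z hz)).
rewrite -(ler_pM2l (x := normc K)); last by rewrite normc_gt0.
rewrite -normcM.
(* By linearity of the square mean, the first-order remainder of [f'] at [a] is a mean of
   first-order remainders of [f], and these are quadratic in [h]. *)
have -> : K * (f' (a + h) - f' a - K^-1 * Ci (square_mean f' a s) (-1) 1 * h)
   = Ci (square_mean (fun u => f (u + h) - f u - f' u * h) a s) (-1) 1.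
  rewrite mulrBr -E1 mulrA mulrA mulfV // mul1r (mulrC _ h).
  rewrite (_ : _ - _ = Ci (square_mean (fun u => f (u + h) - f u) a s) (-1) 1 + (- h) * Ci (square_mean f' a s) (-1) 1); last by rewrite mulNr.
  rewrite -csegment_integralZ // -csegment_integralD //; last first.
    by apply: ccontinuousM => //; exact: ccontinuous_cst.
  by apply: eq_csegment_integral => t _; rewrite /square_mean; ring.
have NB : normc (Ci (square_mean (fun u => f (u + h) - f u - f' u * h) a s) (-1) 1)
    <= 16 * (512 * M / S ^+ 2 * normc h ^+ 2) / s.
  apply: square_mean_bound => //.
    move=> w t hw ht; apply: Taylor_on_square.
      by apply: in_square_le (spS w t hw ht); have [] := fraction_le S0.
    have := ih _ _ _ (spS w t hw ht); rewrite (_ : S / 8 + S / 8 = S / 4); last by field.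
    by apply.
  rewrite (_ : square_mean _ a s = fun t => square_mean (fun u => f (u + h) - f u) a s t + (- h) * square_mean f' a s t).
    by apply: ccontinuousD => //; apply: ccontinuousM => //; exact: ccontinuous_cst.
  by apply/funext => t; rewrite /square_mean; ring.
apply: (le_trans NB).
have nh := normc_ge0 h.
rewrite (_ : _ / s = 16 * (512 * M / S ^+ 2) / s * normc h * normc h); last by ring.
rewrite [leRHS]mulrA; apply: ler_wpM2r => //.
apply: (le_trans (y := B * normc h)); first by apply: ler_wpM2r => //; rewrite lerDl.
have : B * normc h <= e by rewrite mulrC -ler_pdivlMr // ltW.
have := normc_winding_constant; nra.
Qed.

End bounded_on_square.

Lemma disk_square a S z : normc a + 2 * S < 1 -> in_square a S z -> normc z < 1.
Proof.
move=> h /normc_in_square k; have := normcD (z - a) a; rewrite subrK; lra.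
Qed.

Lemma locally_bounded f a : holomorphic_on_disk f -> normc a < 1 ->
  exists S M : R, [/\ 0 < S, normc a + 2 * S < 1 &
    forall z, in_square a S z -> normc (f z) <= M].
Proof.
move=> /holomorphicP Hf ha; have [d d0 Hd] := cdiff_lip (Hf a ha).
pose S := Num.min (d / 3) ((1 - normc a) / 4).
have S0 : 0 < S by rewrite lt_min !divr_gt0 // subr_gt0.
have S1 : S <= d / 3 by rewrite ge_min lexx.
have S2 : S <= (1 - normc a) / 4 by rewrite ge_min lexx orbT.
exists S, (normc (f a) + (normc (complex_derivative f a) + 1) * (2 * S)); split => //.
  lra.
move=> z /normc_in_square hz.
have := Hd (z - a); rewrite (addrC a) subrK => H.
have hd : normc (z - a) < d by lra.
have := normcD (f z - f a) (f a); rewrite subrK => h1.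
have h2 := H hd.
have : (normc (complex_derivative f a) + 1) * normc (z - a) <= (normc (complex_derivative f a) + 1) * (2 * S).
  by rewrite ler_wpM2l // addr_ge0 ?normc_ge0.
lra.
Qed.

(** Differentiability at one point already bounds [f] on a small square around it, which is all that
    the local argument asks for. *)
Theorem holomorphic_derivative f : holomorphic_on_disk f ->
  holomorphic_on_disk (complex_derivative f).
Proof.
move=> Hf z /diskE hz; have [S [M [S0 S1 HM]]] := locally_bounded Hf hz.
have [m hm] := derivative_cdiff S0 (fun w hw => (holomorphicP f).1 Hf w (disk_square S1 hw)) HM.
exact: cdiff_derivable hm.
Qed.

End Cauchy_consequences.

(** * The area mean value inequality *)

Section affine_change_of_variable.
Context {R : realType}.
Local Notation mu := (@lebesgue_measure R).
Local Open Scope ereal_scope.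

Local Notation mR := (measurableTypeR R).

Lemma measurable_affine (k c : R) :
  measurable_fun (T := mR) (U := mR) setT (fun t : R => k * t + c)%R.
Proof.
have h : measurable_fun (T := mR) (U := R) setT (fun t : R => k * t + c)%R.
  by apply: measurable_funD => //; apply: measurable_funM.
exact: h.
Qed.

Variables (k c : R).
Hypothesis k0 : (k != 0)%R.

Let aff : mR -> mR := fun t => (k * t + c)%R.
Let pm : {measure set mR -> \bar R} :=
  measure_function_pushforward__canonical__measure_function_Measure mu (measurable_affine k c).

Let nk : {nonneg R} := NngNum (normr_ge0 k).

Let nu := mscale nk pm.

(** Lebesgue measure is determined by its values on half-open intervals. For [k < 0] the preimage is
    half-open on the other side, whence the two cases. *)
Lemma affine_pushforward (A : set mR) : measurable A -> mu A = nu A.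
Proof.
apply: lebesgue_measure_unique => _ [[a b] /= _ <-].
rewrite /nu /mscale /= /pushforward.
have [ab|ba] := ltP a b; last first.
  rewrite set_itv_ge ?bnd_simp -?leNgt // preimage_set0 !measure0 mule0 //.
rewrite lebesgue_measure_itv /= lte_fin ab.
have [k1|k1] := ltP 0%R k.
  rewrite (_ : _ @^-1` _ = `]((a - c) / k)%R, ((b - c) / k)%R]%classic); last first.
    apply/seteqP; split => t /=; rewrite !in_itv /= /aff => /andP[h1 h2]; apply/andP; split;
    move: h1 h2; rewrite ?ltr_pdivrMr ?ler_pdivlMr // ?ltrBlDr ?lerBrDr ?(mulrC t) //.
  rewrite lebesgue_measure_itv /= lte_fin ltr_pM2r ?invr_gt0 // ltrD2r ab -!EFinD -EFinM.
  by congr EFin; rewrite gtr0_norm //; field.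
have kn : (k < 0)%R by rewrite lt_neqAle k0.
rewrite (_ : _ @^-1` _ = `[((b - c) / k)%R, ((a - c) / k)%R[%classic); last first.
  apply/seteqP; split => t /=; rewrite !in_itv /= /aff => /andP[h1 h2]; apply/andP; split;
  move: h1 h2; rewrite ?ler_ndivrMr ?ltr_ndivlMr // ?ltrBlDr ?lerBrDr ?(mulrC t) //.
rewrite lebesgue_measure_itv /= lte_fin ltr_nM2r ?invr_lt0 // ltrD2r ab -!EFinD -EFinM.
by congr EFin; rewrite ltr0_norm //; field.
Qed.

Lemma ge0_integral_affine (g : mR -> \bar R) : measurable_fun setT g -> (forall x, 0 <= g x) ->
  `|k|%:E * \int[mu]_t g (k * t + c)%R = \int[mu]_t g t.
Proof.
move=> mg g0.
have -> : \int[mu]_t g t = \int[nu]_t g t.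
  apply: (eq_measure_integral nu) => B mB _; exact: affine_pushforward.
rewrite /nu ge0_integral_mscale //; congr (_ * _).
by rewrite (ge0_integral_pushforward (measurable_affine k c)).
Qed.

End affine_change_of_variable.

(** * Measurability of continuous functions in the plane *)

Section plane_measurability.
Context {R : realType}.
Local Notation mR := (measurableTypeR R).

Definition box_open (U : set (mR * mR)) := forall p, U p -> exists2 r : R, 0 < r &
  forall q, `|q.1 - p.1| < r -> `|q.2 - p.2| < r -> U q.

(** Such a set is the union of the boxes with rational data that it contains, a countable union of
    product sets. *)
Lemma box_open_measurable U : box_open U -> measurable U.
Proof.
move=> oU.
pose B (x : rat * rat * rat) : set (mR * mR) :=
  let I := `](ratr x.1.1 - ratr x.2), (ratr x.1.1 + ratr x.2)[%classic `*`
           `](ratr x.1.2 - ratr x.2), (ratr x.1.2 + ratr x.2)[%classic in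
  if `[< I `<=` U >] then I else set0.
have -> : U = \bigcup_x B x.
  apply/seteqP; split => [[x y] Uxy|p [i _]]; last first.
    by rewrite /B; case: ifP => // /asboolP; apply.
  have [r r0 Hr] := oU _ Uxy.
  (* A half-side between [r / 3] and [r / 2] with a centre less than [r / 3] away gives a box that
     contains the point and stays within [r] of it. *)
  have [e] : exists e : rat, ratr e \in `](r / 3), (r / 2)[.
    by apply: rat_in_itvoo; lra.
  rewrite in_itv /= => /andP[e1 e2].
  have [q1] : exists q : rat, ratr q \in `](x - r / 3), (x + r / 3)[.
    by apply: rat_in_itvoo; lra.
  rewrite in_itv /= => /andP[qa qb].
  have [q2] : exists q : rat, ratr q \in `](y - r / 3), (y + r / 3)[.
    by apply: rat_in_itvoo; lra.
  rewrite in_itv /= => /andP[qc qd].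
  exists (q1, q2, e) => //; rewrite /B ifT /=.
    by rewrite !in_itv /=; split; apply/andP; lra.
  apply/asboolP => -[u v] /=; rewrite !in_itv /= => -[/andP[u1 u2] /andP[v1 v2]].
  by apply: Hr; rewrite /= ltr_norml; apply/andP; lra.
apply: countable_bigcupT_measurable; first exact: countableP.
move=> x; rewrite /B; case: ifP => // _.
by apply: measurableX; exact: measurable_itv.
Qed.

Definition plane_continuous_at (f : mR * mR -> R) p := forall e : R, 0 < e ->
  exists2 d : R, 0 < d & forall q, `|q.1 - p.1| < d -> `|q.2 - p.2| < d ->
    `|f q - f p| <= e.

(** The superlevel set in [D] is the trace on [D] of the set [U] of points around which [f] exceeds
    [x]. Openness of [U] holds by construction, so [D] itself need not be open. *)
Lemma plane_continuous_measurable (D : set (mR * mR)) (f : mR * mR -> R) :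
  (forall p, D p -> plane_continuous_at f p) -> measurable_fun D f.
Proof.
move=> Hf mD; apply: (measurability _ (RGenOInfty.measurableE R)) => //.
move=> _ [_ [x ->] <-].
pose U : set (mR * mR) := [set p | exists2 r : R, 0 < r &
  forall q, `|q.1 - p.1| < r -> `|q.2 - p.2| < r -> x < f q].
rewrite (_ : _ `&` _ = D `&` U).
  apply: measurableI => //; apply: box_open_measurable => p [r r0 Hr].
  exists (r / 2); first by rewrite divr_gt0.
  move=> q h1 h2; exists (r / 2); first by rewrite divr_gt0.
  move=> u k1 k2; apply: Hr.
  - have := ler_normD (u.1 - q.1) (q.1 - p.1); rewrite addrA subrK; lra.
  - have := ler_normD (u.2 - q.2) (q.2 - p.2); rewrite addrA subrK; lra.
apply/seteqP; split => p [Dp] /=; rewrite ?in_itv /= ?andbT => fp; split => //.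
  have e0 : 0 < (f p - x) / 2 by rewrite divr_gt0 // subr_gt0.
  have [d d0 Hd] := Hf p Dp _ e0; exists d => // q h1 h2.
  have := Hd q h1 h2; rewrite ler_norml => /andP[]; lra.
by have [r r0 Hr] := fp; apply: Hr; rewrite subrr normr0.
Qed.

Lemma measurable_normc_comp (D : set (mR * mR)) (f : R[i] -> R[i]) :
  (forall p, D p -> exists l, cdiff f (p.1 +i* p.2) l) ->
  measurable_fun D (fun p => normc (f (p.1 +i* p.2))).
Proof.
move=> H; apply: plane_continuous_measurable => p /H [l hl] e e0.
have [d d0 Hd] := cdiff_lip hl.
pose L := normc l + 1; have L0 : 0 < L by rewrite ltr_wpDl ?normc_ge0.
exists (Num.min (d / 2) (e / (2 * L))); first by rewrite lt_min !divr_gt0 // mulr_gt0.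
move=> q; rewrite !lt_min => /andP[h1 h2] /andP[h3 h4].
pose h := (q.1 - p.1) +i* (q.2 - p.2).
have E : q.1 +i* q.2 = (p.1 +i* p.2) + h.
  by apply/eqP; rewrite eq_complex /=; apply/andP; split; apply/eqP; ring.
have nh : normc h <= `|q.1 - p.1| + `|q.2 - p.2| := normc_le h.
have hd : normc h < d by lra.
have := Hd h hd; rewrite -E -/L => k.
have k2 : L * normc h <= e.
  have : normc h <= e / L.
    rewrite (_ : e / L = e / (2 * L) + e / (2 * L)); last by field; rewrite gt_eqF.
    lra.
  by rewrite ler_pdivlMr // mulrC.
apply: le_trans (le_trans k k2).
have a1 := normcD (f (q.1 +i* q.2) - f (p.1 +i* p.2)) (f (p.1 +i* p.2)).
have a2 := normcD (f (p.1 +i* p.2) - f (q.1 +i* q.2)) (f (q.1 +i* q.2)).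
rewrite !subrK in a1 a2; rewrite normc_dist in a2.
by rewrite ler_norml; apply/andP; lra.
Qed.

Lemma measurable_Re_comp (D : set (mR * mR)) (f : R[i] -> R[i]) :
  (forall p, D p -> exists l, cdiff f (p.1 +i* p.2) l) ->
  measurable_fun D (fun p => complex.Re (f (p.1 +i* p.2))) /\
  measurable_fun D (fun p => complex.Im (f (p.1 +i* p.2))).
Proof.
move=> H.
have key (g : R[i] -> R) : (forall z w, `|g z - g w| <= normc (z - w)) ->
    measurable_fun D (fun p => g (f (p.1 +i* p.2))).
  move=> Hg; apply: plane_continuous_measurable => p /H [l hl] e e0.
  have [d d0 Hd] := cdiff_lip hl.
  pose L := normc l + 1; have L0 : 0 < L by rewrite ltr_wpDl ?normc_ge0.
  exists (Num.min (d / 2) (e / (2 * L))); first by rewrite lt_min !divr_gt0 // mulr_gt0.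
  move=> q; rewrite !lt_min => /andP[h1 h2] /andP[h3 h4].
  pose h := (q.1 - p.1) +i* (q.2 - p.2).
  have E : q.1 +i* q.2 = (p.1 +i* p.2) + h.
    by apply/eqP; rewrite eq_complex /=; apply/andP; split; apply/eqP; ring.
  have nh : normc h <= `|q.1 - p.1| + `|q.2 - p.2| := normc_le h.
  have hd : normc h < d by lra.
  have := Hd h hd; rewrite -E -/L => k.
  have k2 : L * normc h <= e.
    have : normc h <= e / L.
      rewrite (_ : e / L = e / (2 * L) + e / (2 * L)); last by field; rewrite gt_eqF.
      lra.
    by rewrite ler_pdivlMr // mulrC.
  exact: le_trans (Hg _ _) (le_trans k k2).
split; apply: key => z w; first by rewrite -Re_oppc -Re_addc Re_le_normc.
by rewrite -Im_oppc -Im_addc Im_le_normc.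
Qed.

End plane_measurability.

(** * From boundary means to area means *)

Section square_energy.
Context {R : realType}.
Local Notation C := R[i].
Local Notation mR := (measurableTypeR R).
Local Notation mu := (@lebesgue_measure R).
Local Notation lebesgue2 := (mu \x mu)%E.
Local Notation Re := (@complex.Re R).
Local Notation Im := (@complex.Im R).
Implicit Types (f : C -> C) (a : C) (S : R).

Definition plane_square a S : set (mR * mR) :=
  `[(Re a - S)%R, (Re a + S)%R]%classic `*` `[(Im a - S)%R, (Im a + S)%R]%classic.

Lemma plane_squareP a S (p : R * R) : plane_square a S p <-> in_square a S (p.1 +i* p.2).
Proof.
case: a => ar ai; case: p => x y.
rewrite /plane_square /in_square /= !in_itv /= !ler_norml.
split=> -[/andP[h1 h2] /andP[h3 h4]]; split; apply/andP; lra.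
Qed.

Lemma measurable_plane_square a S : measurable (plane_square a S).
Proof. by apply: measurableX; exact: measurable_itv. Qed.

Definition energy_density f (p : mR * mR) : \bar R := (normc (f (p.1 +i* p.2)) ^+ 2)%:E.

Lemma energy_density_ge0 f p : (0 <= energy_density f p)%E.
Proof. by rewrite lee_fin sqr_ge0. Qed.

Lemma measurable_energy_density (D : set (mR * mR)) f :
  (forall p, D p -> exists l, cdiff f (p.1 +i* p.2) l) ->
  measurable_fun D (energy_density f).
Proof.
move=> H; apply/measurable_EFinP; apply: measurable_funX.
exact: measurable_normc_comp.
Qed.

Lemma square_pointE a s t : [/\ square_point a 1 s t = (1 * s + Re a) +i* (s * t + Im a),
  square_point a 'i s t = (- s * t + Re a) +i* (1 * s + Im a),
  square_point a (-1) s t = (-1 * s + Re a) +i* (- s * t + Im a) &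
  square_point a (- 'i) s t = (s * t + Re a) +i* (-1 * s + Im a)].
Proof.
by case: a => ar ai; split; apply/eqP; rewrite eq_complex /square_point /side /=;
  apply/andP; split; apply/eqP; ring.
Qed.

Local Open Scope ereal_scope.

Lemma side_energyE f a S s w : (0 < s <= S)%R -> fourth_root_of_unity w ->
  (forall z, in_square a S z -> exists l, cdiff f z l) ->
  (side_energy f a s w)%:E =
  \int[mu]_(t in `[(-1)%R, 1%R]) (normc (f (square_point a w s t)) ^+ 2)%:E.
Proof.
move=> /andP[s0 sS] hw Hf.
rewrite /side_energy /segment_integral /Rintegral fineK //.
apply: integrable_fin_num => //; apply: segment_integrable.
have c : ccontinuous_on_segment (fun t => f (square_point a w s t)) (-1) 1.
  apply: ccontinuous_square_point => t ht.
  by apply/Hf/in_square_point => //; rewrite (ltW s0).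
move=> t ht e e0.
have [d d0 Hd] := ccontinuous_normc (ccontinuousM c c) ht e0; exists d => // u /Hd.
by rewrite !normcM !expr2.
Qed.

(** The boundary inequality is integrated over half-sides [s] in [[S / 2, S]]. At a fixed [s], an
    affine change of variable turns each of the four sides into part of a vertical or horizontal
    section of the square, and integrating the sections over [s] gives at most the area integral. *)
Lemma sub_mean_value_area f a S : (0 < S)%R ->
  (forall z, in_square a S z -> exists l, cdiff f z l) ->
  (normc (f a) ^+ 2)%:E <=
  (32 / S ^+ 2)%:E * \int[lebesgue2]_(p in plane_square a S) energy_density f p.
Proof.
move=> S0 Hf; set A := (normc (f a) ^+ 2)%R.
have A0 : (0 <= A)%R by rewrite sqr_ge0.
pose Phi := energy_density f \_ (plane_square a S).
have mPhi : measurable_fun setT Phi.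
  apply/(measurable_restrictT _ (measurable_plane_square a S)).
  by apply: measurable_energy_density => p /plane_squareP; exact: Hf.
have Phi0 p : 0 <= Phi p.
  by rewrite /Phi patchE; case: ifP => // _; exact: energy_density_ge0.
(* [G] integrates over vertical sections and [H] over horizontal ones. Extension by zero lets both
   live on the whole line, where shifts and reflections are harmless. *)
pose G := fubini_F mu Phi; pose H := fubini_G mu Phi.
have mG : measurable_fun setT G by exact: measurable_fun_fubini_tonelli_F.
have mH : measurable_fun setT H by exact: measurable_fun_fubini_tonelli_G.
have G0 x : 0 <= G x by apply: integral_ge0.
have H0 x : 0 <= H x by apply: integral_ge0.
pose I := \int[lebesgue2]_p Phi p.
have IG : \int[mu]_x G x = I by rewrite /I (fubini_tonelli1 _ mPhi Phi0).
have IH : \int[mu]_x H x = I by rewrite /I (fubini_tonelli2 _ mPhi Phi0).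
have -> : \int[lebesgue2]_(p in plane_square a S) energy_density f p = I.
  by rewrite integral_mkcond.
have msec1 x : measurable_fun setT (fun y => Phi (x, y)) by exact: measurableT_comp.
have msec2 y : measurable_fun setT (fun x => Phi (x, y)) by exact: measurableT_comp.
(* one side of the square, in coordinates [P t + i Q t] *)
have side_le w s (P Q : R -> R) : fourth_root_of_unity w -> (0 < s <= S)%R ->
   (forall t, square_point a w s t = P t +i* Q t) ->
   measurable_fun (T := mR) setT (fun t => Phi (P t, Q t)) ->
   (side_energy f a s w)%:E <= \int[mu]_t Phi (P t, Q t).
  move=> hw hs PQ mPQ; rewrite (side_energyE hs hw Hf) integral_mkcond.
  apply: ge0_le_integral => //.
  - by move=> t _; rewrite patchE; case: ifP => // _; rewrite lee_fin sqr_ge0.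
  - have mI : measurable (`[(-1)%R, 1%R]%classic : set mR) by exact: measurable_itv.
    apply/(measurable_restrictT _ mI).
    apply: (eq_measurable_fun (fun t => Phi (P t, Q t))); last exact: measurable_funTS.
    move=> t; rewrite inE => /itvP ht.
    rewrite /Phi patchE ifT /energy_density /= ?PQ //.
    rewrite inE; apply/plane_squareP; rewrite /= -PQ; apply: in_square_point; rewrite ?ht //.
    by case/andP: hs => s0 ->; rewrite ltW.
  move=> t _; rewrite patchE; case: ifPn => [|_]; last exact: Phi0.
  rewrite inE => /itvP ht.
  rewrite /Phi patchE ifT /energy_density /= ?PQ //.
  rewrite inE; apply/plane_squareP; rewrite /= -PQ; apply: in_square_point; rewrite ?ht //.
  by case/andP: hs => s0 ->; rewrite ltW.
have bound s : (S / 2 <= s <= S)%R -> (A * (S / 2))%:E <=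
   2%:E * (G (1 * s + Re a)%R + G (-1 * s + Re a)%R + H (1 * s + Im a)%R + H (-1 * s + Im a)%R).
  move=> /andP[s1 s2]; have s0 : (0 < s)%R by lra.
  have hs : (0 < s <= S)%R by rewrite s0.
  have sn : (s != 0)%R by rewrite gt_eqF.
  have snn : (- s != 0)%R by rewrite oppr_eq0.
  have key w (P Q : R -> R) g : fourth_root_of_unity w ->
     (forall t, square_point a w s t = P t +i* Q t) ->
     measurable_fun (T := mR) setT (fun t => Phi (P t, Q t)) ->
     s%:E * (\int[mu]_t Phi (P t, Q t)) = g -> (s * side_energy f a s w)%:E <= g.
    move=> hw PQ mPQ <-; rewrite EFinM lee_pmul2l ?lte_fin //.
    exact: (side_le w s P Q hw hs PQ mPQ).
  have maff k c : measurable_fun (T := mR) (U := mR) setT (fun t : R => k * t + c)%R.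
    exact: measurable_affine.
  have k1 : (s * side_energy f a s 1)%:E <= G (1 * s + Re a)%R.
    apply: (key _ (fun t => 1 * s + Re a)%R (fun t => s * t + Im a)%R); first exact: Or41.
    - by move=> t; have [-> _ _ _] := square_pointE a s t.
    - exact: (measurableT_comp (msec1 _) (maff _ _)).
    - have := ge0_integral_affine (Im a) sn (msec1 (1 * s + Re a)%R) (fun x => Phi0 _); rewrite ?normrN (gtr0_norm s0) => h; exact: h.
  have k3 : (s * side_energy f a s (-1))%:E <= G (-1 * s + Re a)%R.
    apply: (key _ (fun t => -1 * s + Re a)%R (fun t => - s * t + Im a)%R); first exact: Or43.
    - by move=> t; have [_ _ -> _] := square_pointE a s t.
    - exact: (measurableT_comp (msec1 _) (maff _ _)).
    - have := ge0_integral_affine (Im a) snn (msec1 (-1 * s + Re a)%R) (fun x => Phi0 _); rewrite ?normrN (gtr0_norm s0) => h; exact: h.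
  have k2 : (s * side_energy f a s 'i)%:E <= H (1 * s + Im a)%R.
    apply: (key _ (fun t => - s * t + Re a)%R (fun t => 1 * s + Im a)%R); first exact: Or42.
    - by move=> t; have [_ -> _ _] := square_pointE a s t.
    - exact: (measurableT_comp (msec2 _) (maff _ _)).
    - have := ge0_integral_affine (Re a) snn (msec2 (1 * s + Im a)%R) (fun x => Phi0 _); rewrite ?normrN (gtr0_norm s0) => h; exact: h.
  have k4 : (s * side_energy f a s (- 'i))%:E <= H (-1 * s + Im a)%R.
    apply: (key _ (fun t => s * t + Re a)%R (fun t => -1 * s + Im a)%R); first exact: Or44.
    - by move=> t; have [_ _ _ ->] := square_pointE a s t.
    - exact: (measurableT_comp (msec2 _) (maff _ _)).
    - have := ge0_integral_affine (Re a) sn (msec2 (-1 * s + Im a)%R) (fun x => Phi0 _); rewrite ?normrN (gtr0_norm s0) => h; exact: h.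
  have L2 := mean_value_square_L2 hs Hf.
  apply: (le_trans (y := (2 * (s * side_energy f a s 1 + s * side_energy f a s (-1)
     + s * side_energy f a s 'i + s * side_energy f a s (- 'i)))%:E)).
    rewrite lee_fin; apply: (le_trans (y := A * s)%R); first by rewrite ler_wpM2l //; lra.
    by rewrite mulrC; apply: (le_trans (ler_wpM2l (ltW s0) L2)); rewrite le_eqVlt; apply/orP; left; apply/eqP; ring.
  rewrite EFinM lee_pmul2l ?lte_fin // !EFinD.
  exact: leeD (leeD (leeD k1 k3) k2) k4.
have mJ : measurable (`[(S / 2)%R, S]%classic : set mR) by exact: measurable_itv.
have S2 : (S / 2 < S)%R by lra.
have shift (g : mR -> \bar R) k c : (`|k| = 1)%R -> measurable_fun setT g -> (forall x, 0 <= g x) ->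
    \int[mu]_(s in `[(S / 2)%R, S]) g (k * s + c)%R <= \int[mu]_x g x.
  move=> k1 mg g0.
  have kn : (k != 0)%R by rewrite -normr_eq0 k1 oner_eq0.
  rewrite -(ge0_integral_affine c kn mg g0) k1 mul1e.
  apply: ge0_subset_integral => //.
  exact: (measurableT_comp mg (measurable_affine k c)).
have mc (g : mR -> \bar R) k c : measurable_fun setT g ->
    measurable_fun (`[(S / 2)%R, S]%classic : set mR) (fun s => g (k * s + c)%R).
  by move=> mg; apply: measurable_funTS; exact: (measurableT_comp mg (measurable_affine k c)).
have mG1 := mc G 1%R (Re a) mG; have mG2 := mc G (-1)%R (Re a) mG.
have mH1 := mc H 1%R (Im a) mH; have mH2 := mc H (-1)%R (Im a) mH.
have m2 := emeasurable_funD mG1 mG2; have m3 := emeasurable_funD m2 mH1.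
have m4 := emeasurable_funD m3 mH2.
have N1 : (`|1| = 1 :> R)%R by rewrite normr1.
have N2 : (`|-1| = 1 :> R)%R by rewrite normrN normr1.
(* The length [S / 2] of the range of [s] gives the second factor on the left; four sides, doubled
   by the boundary inequality, give the 8. *)
have total : (A * (S / 2) * (S / 2))%:E <= 8%:E * I.
  have -> : (A * (S / 2) * (S / 2))%:E = \int[mu]_(s in `[(S / 2)%R, S]) (A * (S / 2))%:E.
    by rewrite integral_cst //= lebesgue_measure_itv /= lte_fin S2 -EFinB -EFinM; congr EFin; field.
  apply: (le_trans (y := \int[mu]_(s in `[(S / 2)%R, S])
    (2%:E * (G (1 * s + Re a)%R + G (-1 * s + Re a)%R + H (1 * s + Im a)%R + H (-1 * s + Im a)%R)))).
    apply: ge0_le_integral => //.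
    - by move=> s _; rewrite lee_fin mulr_ge0 // ltW // divr_gt0.
    - exact: measurable_funeM m4.
  rewrite (ge0_integralZl_EFin _ mJ (fun s _ => adde_ge0 (adde_ge0 (adde_ge0 (G0 _) (G0 _)) (H0 _)) (H0 _)) m4) //.
  have -> : 8%:E * I = 2%:E * (I + I + I + I).
    have -> : I + I + I + I = 4%:E * I.
      rewrite (_ : 4%R = (1 + 1 + 1 + 1)%R :> R); last by ring.
      have I0 : 0 <= I by apply: integral_ge0.
      by rewrite !EFinD !ge0_muleDl ?mul1e ?adde_ge0 ?lee_fin.
    by rewrite muleA -EFinM; congr (_%:E * _); ring.
  rewrite lee_pmul2l ?lte_fin //.
  rewrite (ge0_integralD _ mJ (fun s _ => adde_ge0 (adde_ge0 (G0 _) (G0 _)) (H0 _)) m3 _ mH2) //.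
  rewrite (ge0_integralD _ mJ (fun s _ => adde_ge0 (G0 _) (G0 _)) m2 _ mH1) //.
  rewrite (ge0_integralD _ mJ _ mG1 _ mG2) //.
  have IG' := shift G _ (Re a) _ mG G0; have IH' := shift H _ (Im a) _ mH H0.
  rewrite IG in IG'; rewrite IH in IH'.
  by apply: leeD; [apply: leeD; [apply: leeD; exact: IG'|exact: IH']|exact: IH'].
rewrite (_ : (32 / S ^+ 2)%:E * I = (4 / S ^+ 2)%:E * (8%:E * I)); last first.
  by rewrite muleA -EFinM; congr (_%:E * _); ring.
apply: (le_trans (y := (4 / S ^+ 2)%:E * (A * (S / 2) * (S / 2))%:E)).
  by rewrite -EFinM lee_fin le_eqVlt; apply/orP; left; apply/eqP; field; rewrite gt_eqF.
by rewrite lee_pmul2l ?lte_fin // divr_gt0 // exprn_gt0.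
Qed.

End square_energy.

(** * Counting singular numbers *)

Lemma conjcM (R : realType) (a b : R[i]) : (a * b)^* = a^* * b^*.
Proof. by case: a b => ? ? [? ?]; apply/eqP; rewrite eq_complex /=; apply/andP; split; apply/eqP; ring. Qed.

Lemma conjcD (R : realType) (a b : R[i]) : (a + b)^* = a^* + b^*.
Proof. by case: a b => ? ? [? ?]; apply/eqP; rewrite eq_complex /=; apply/andP; split; apply/eqP; ring. Qed.

Section inner_product.
Context {R : realType} {V : lmodType R[i]}.
Local Notation C := R[i].
Local Notation Re := (@complex.Re R).
Variables (H : set V) (ip : V -> V -> C).

Definition inner_product_on := [/\ H 0,
  forall (a : C) f g, H f -> H g -> H (a *: f + g),
  forall (a : C) f g h, H f -> H g -> H h -> ip (a *: f + g) h = a * ip f h + ip g h,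
  forall f g, H f -> H g -> ip g f = (ip f g)^* &
  forall f, H f -> 0 <= Re (ip f f)].

Definition sqnorm f : R := Re (ip f f).

Hypothesis ipH : inner_product_on.

Let H0 : H 0. Proof. by case: ipH. Qed.
Let HL (a : C) f g : H f -> H g -> H (a *: f + g). Proof. by case: ipH => ? h ? ? ?; exact: h. Qed.
Let ipL (a : C) f g h : H f -> H g -> H h -> ip (a *: f + g) h = a * ip f h + ip g h.
Proof. by case: ipH => ? ? + ? ?; exact. Qed.
Let ipC f g : H f -> H g -> ip g f = (ip f g)^*. Proof. by case: ipH => ? ? ? + ?; exact. Qed.

Lemma sqnorm_ge0 f : H f -> 0 <= sqnorm f. Proof. by case: ipH => ? ? ? ?; exact. Qed.

Lemma hnorm_sqr f : H f -> hnorm ip f ^+ 2 = sqnorm f.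
Proof. by move=> hf; rewrite /hnorm sqr_sqrtr // sqnorm_ge0. Qed.

Lemma H_scale (a : C) f : H f -> H (a *: f).
Proof. by move=> hf; have := HL a hf H0; rewrite addr0. Qed.

Lemma H_add f g : H f -> H g -> H (f + g).
Proof. by move=> hf hg; have := HL 1 hf hg; rewrite scale1r. Qed.

Lemma H_sub f g : H f -> H g -> H (f - g).
Proof. by move=> hf hg; rewrite addrC -scaleN1r; exact: HL. Qed.

Lemma H_sum (I : Type) (r : seq I) (F : I -> V) : (forall i, H (F i)) -> H (\sum_(i <- r) F i).
Proof.
move=> hF; elim: r => [|i r IH]; first by rewrite big_nil.
by rewrite big_cons; exact: H_add.
Qed.

Lemma ip0l h : H h -> ip 0 h = 0.
Proof.
move=> hh; have := ipL 1 H0 H0 hh; rewrite scaler0 addr0 mul1r => E.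
by apply: (addrI (ip 0 h)); rewrite -E addr0.
Qed.

Lemma ipZl (a : C) f h : H f -> H h -> ip (a *: f) h = a * ip f h.
Proof. by move=> hf hh; have := ipL a hf H0 hh; rewrite ip0l // !addr0. Qed.

Lemma ipDl f g h : H f -> H g -> H h -> ip (f + g) h = ip f h + ip g h.
Proof. by move=> hf hg hh; have := ipL 1 hf hg hh; rewrite scale1r mul1r. Qed.

Lemma ipBl f g h : H f -> H g -> H h -> ip (f - g) h = ip f h - ip g h.
Proof. by move=> hf hg hh; rewrite addrC -scaleN1r ipL // mulN1r addrC. Qed.

Lemma ipZr (a : C) f h : H f -> H h -> ip f (a *: h) = a^* * ip f h.
Proof.
move=> hf hh; by rewrite (ipC (H_scale a hh) hf) ipZl // conjcM (ipC hh hf).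
Qed.

Lemma ipDr f g h : H f -> H g -> H h -> ip f (g + h) = ip f g + ip f h.
Proof.
move=> hf hg hh; rewrite (ipC (H_add hg hh) hf) ipDl // conjcD.
by rewrite (ipC hg hf) (ipC hh hf).
Qed.

Lemma ip_suml (I : Type) (r : seq I) (F : I -> V) h : (forall i, H (F i)) -> H h ->
  ip (\sum_(i <- r) F i) h = \sum_(i <- r) ip (F i) h.
Proof.
move=> hF hh; elim: r => [|i r IH]; first by rewrite !big_nil ip0l.
by rewrite !big_cons ipDl //; [rewrite IH|exact: H_sum].
Qed.

Lemma ip_sumr (I : Type) (r : seq I) (F : I -> V) h : (forall i, H (F i)) -> H h ->
  ip h (\sum_(i <- r) F i) = \sum_(i <- r) ip h (F i).
Proof.
move=> hF hh; elim: r => [|i r IH].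
  by rewrite !big_nil (ipC H0 hh) ip0l // conjc0.
by rewrite !big_cons ipDr //; [rewrite IH|exact: H_sum].
Qed.

Lemma ip_sqnorm f : H f -> ip f f = (sqnorm f)%:C.
Proof.
move=> hf; have := ipC hf hf; rewrite /sqnorm; case: (ip f f) => a b [] /= /eqP.
by rewrite -subr_eq0 opprK -mulr2n mulrn_eq0 /= => /eqP ->.
Qed.

Lemma sqnormZD (a : C) f g : H f -> H g ->
  sqnorm (a *: f + g) = normc a ^+ 2 * sqnorm f + 2 * Re (a * ip f g) + sqnorm g.
Proof.
move=> hf hg; have haf := H_scale a hf.
rewrite /sqnorm ipL //; last exact: HL.
rewrite !ipDr // !ipZr // (ipC hf hg) !ip_sqnorm // -/(sqnorm _).
rewrite normc_sqr; case: a {haf} => ar ai; case: (ip f g) => u v /=; ring.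
Qed.

(** Nonnegativity of the square norm of [f - l * <f, g> g], for real [l], gives the quadratic
    [K l]. *)
Lemma Cauchy_Schwarz f g : H f -> H g -> normc (ip f g) ^+ 2 <= sqnorm f * sqnorm g.
Proof.
move=> hf hg; have F0 := sqnorm_ge0 hf; have G0 := sqnorm_ge0 hg.
set N := normc (ip f g) ^+ 2; have N0 : 0 <= N by rewrite sqr_ge0.
have K (l : R) : 0 <= sqnorm f - 2 * l * N + l ^+ 2 * N * sqnorm g.
  have := sqnorm_ge0 (HL (- (l%:C * ip f g)) hg hf).
  rewrite sqnormZD // normcN normcM normc_real (ipC hf hg) exprMn real_normK ?num_real //.
  rewrite -/N (_ : Re _ = - (l * N)); first by move=> h; apply: le_trans h _; rewrite le_eqVlt; apply/orP; left; apply/eqP; ring.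
  by rewrite /N normc_sqr; case: (ip f g) => u v /=; ring.
have [G1|G1] := ltP 0 (sqnorm g); last first.
  (* Only semidefiniteness is available. If [sqnorm g = 0], the quadratic is affine in [l], and a
     large [l] excludes [N > 0]. *)
  have G2 : sqnorm g = 0 by apply/le_anti; rewrite G1.
  rewrite G2 mulr0; have := K ((sqnorm f + 1) / (2 * (N + 1))); rewrite G2 mulr0 addr0.
  rewrite leNgt => h; rewrite leNgt; apply: contra h => h.
  have := K ((sqnorm f + 1) / (2 * N)); rewrite G2 mulr0 addr0.
  rewrite (_ : 2 * _ * N = sqnorm f + 1); last by field; rewrite gt_eqF.
  by lra.
have := K (sqnorm g)^-1.
rewrite (_ : _ + _ = sqnorm f - N / sqnorm g); last by field; rewrite gt_eqF.
by rewrite subr_ge0 ler_pdivrMr.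
Qed.

(** Young's inequality on the cross term. A small [t] keeps the factor of [f] close to 1 and puts
    the cost on [g]. *)
Lemma sqnormD_le (t : R) f g : 0 < t -> H f -> H g ->
  sqnorm (f + g) <= (1 + t) * sqnorm f + (1 + t^-1) * sqnorm g.
Proof.
move=> t0 hf hg; have := sqnormZD 1 hf hg; rewrite scale1r mul1r => ->.
have -> : normc (1 : C) = 1 by rewrite -[X in normc X]/(1%:C) normc_real normr1.
have := sqnorm_ge0 (HL (- t%:C) hf hg).
rewrite sqnormZD // normcN normc_real real_normK ?num_real //.
rewrite (_ : Re (- t%:C * _) = - (t * Re (ip f g))); last by case: (ip f g) => u v /=; ring.
set X := Re _; set F := sqnorm f; set G := sqnorm g => h.
have : 0 <= t^-1 * (t ^+ 2 * F + 2 * - (t * X) + G) by rewrite mulr_ge0 // invr_ge0 ltW.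
rewrite (_ : t^-1 * _ = t * F - 2 * X + t^-1 * G); last by field; rewrite gt_eqF.
rewrite expr1n; lra.
Qed.

(** With [c m = <f m, e>] and [v] the sum of the [(c m)^* *: f m], one has [<v, e> = X]. The row
    bound on the Gram matrix gives [sqnorm v <= B * X] (Schur's test), and Cauchy-Schwarz yields
    [X ^ 2 <= B * X]. *)
Lemma Boas_Bellman N (f : nat -> V) e (B : R) : 0 <= B -> (forall m, H (f m)) -> H e -> sqnorm e = 1 ->
  (forall m, (m < N)%N -> \sum_(k < N) normc (ip (f m) (f k)) <= B) ->
  \sum_(m < N) normc (ip (f m) e) ^+ 2 <= B.
Proof.
move=> B0 hf he e1 HB.
set X := \sum_(m < N) _.
have X0 : 0 <= X by apply: sumr_ge0 => i _; rewrite sqr_ge0.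
pose c (m : 'I_N) := ip (f m) e.
pose v := \sum_(m < N) (c m)^* *: f m.
have hv : H v by apply: H_sum => i; exact: H_scale.
have Ev : ip v e = X%:C.
  rewrite /v ip_suml //; last by move=> i; exact: H_scale.
  rewrite /X rmorph_sum; apply: eq_bigr => i _; rewrite ipZl // -/(c i).
  by rewrite normc_sqr; case: (c i) => x y; apply/eqP; rewrite eq_complex /=; apply/andP; split; apply/eqP; ring.
have CS := Cauchy_Schwarz hv he; rewrite Ev normc_real e1 mulr1 real_normK ?num_real // in CS.
have Bv : sqnorm v <= B * X.
  apply: le_trans (ler_norm _) _; rewrite -normc_real -ip_sqnorm //.
  rewrite {1}/v ip_suml //; last by move=> i; exact: H_scale.
  have T (I : finType) (F : I -> C) : normc (\sum_i F i) <= \sum_i normc (F i).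
    apply: (big_rec2 (fun x y => normc x <= y)) => [|i y1 y2 _ h].
      by rewrite -[0]/(0%:C) normc_real normr0.
    by apply: (le_trans (normcD _ _)); rewrite lerD2l.
  apply: (le_trans (T _ _)).
  (* The product [|c i| |c k|] is split into half the sum of the squares; the two halves of the
     double sum agree by symmetry. *)
  have step (i : 'I_N) : normc (ip ((c i)^* *: f i) v) <=
     \sum_(k < N) (normc (c i) ^+ 2 / 2 * normc (ip (f i) (f k)) + normc (c k) ^+ 2 / 2 * normc (ip (f k) (f i))).
    rewrite ipZl // /v ip_sumr //; last by move=> k; exact: H_scale.
    rewrite normcM normc_conj; apply: (le_trans (ler_wpM2l (normc_ge0 _) (T _ _))).
    rewrite mulr_sumr; apply: ler_sum => k _.
    rewrite ipZr // normcM !normc_conj (ipC (hf k) (hf i)) normc_conj.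
    have := normc_ge0 (ip (f k) (f i)); have := sqr_ge0 (normc (c i) - normc (c k)).
    move: (normc (c i)) (normc (c k)) (normc (ip (f k) (f i))) => x y z; nra.
  apply: (le_trans (ler_sum _ (fun i _ => step i))).
  have E : \sum_(i < N) \sum_(k < N) normc (c i) ^+ 2 / 2 * normc (ip (f i) (f k)) <= B * X / 2.
    rewrite /X mulrAC mulr_sumr; apply: ler_sum => i _; rewrite -mulr_sumr.
    have h := HB i (ltn_ord i); have := sqr_ge0 (normc (c i)).
    by rewrite -/(c i); move: (normc (c i) ^+ 2) (\sum_(k < N) _) h => x y; nra.
  rewrite (_ : B * X = B * X / 2 + B * X / 2); last by field.
  under eq_bigr do rewrite big_split /=.
  rewrite big_split /=; apply: lerD => //.
  by rewrite exchange_big.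
have [X1|X1] := ltP 0 X; last exact: le_trans X1 B0.
by have := le_trans CS Bv; rewrite expr2 ler_pM2r.
Qed.


(** * Truncation along the singular vectors *)

Section singular_numbers_bound.
Variables (T S : V -> V) (s : nat -> R) (e : nat -> V).
Hypotheses (compT : is_compact_operator H ip T) (adj : is_adjoint H ip T S)
  (s_mono : nonincreasing_seq s) (s_ge0 : forall n, 0 <= s n)
  (orth : orthonormal_seq H ip e)
  (eigen : forall n, S (T (e n)) = (s n ^+ 2)%:C *: e n)
  (kernel : forall f, H f -> (forall n, ip f (e n) = 0) -> T f = 0).

Let HT f : H f -> H (T f). Proof. by case: compT => -[h _] _; exact: h. Qed.
Let TL (a : C) f g : H f -> H g -> T (a *: f + g) = a *: T f + T g.
Proof. by case: compT => -[_ h] _; exact: h. Qed.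
Let HS f : H f -> H (S f). Proof. by case: adj => -[h _] _; exact: h. Qed.
Let adjE f g : H f -> H g -> ip (T f) g = ip f (S g).
Proof. by case: adj => _; exact. Qed.
Let He n : H (e n). Proof. by case: orth. Qed.
Let ee m n : ip (e m) (e n) = (m == n)%:R. Proof. by case: orth. Qed.

Let HTe n : H (T (e n)). Proof. exact: HT. Qed.

Local Hint Resolve He HTe : core.

Let T0 : T 0 = 0.
Proof. by have := TL (-1) H0 H0; rewrite scaler0 addr0 scaleN1r addNr. Qed.

Lemma ip_T_T f n : H f -> ip (T f) (T (e n)) = (s n ^+ 2)%:C * ip f (e n).
Proof.
move=> hf; rewrite adjE  // eigen ipZr //; congr (_ * _).
by apply/eqP; rewrite eq_complex /= oppr0 !eqxx.
Qed.

Section projection.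
Variable f : V.
Hypothesis hf : H f.

Definition orthogonal_projection K := \sum_(k < K) ip f (e k) *: e k.
Local Notation P := orthogonal_projection.

Lemma H_projection K : H (P K).
Proof. by apply: H_sum => i; exact: H_scale. Qed.

Local Hint Resolve H_projection : core.

Lemma projection_recr K : P K.+1 = ip f (e K) *: e K + P K.
Proof. by rewrite /P big_ord_recr /= addrC. Qed.

Lemma ip_projection K l : ip (P K) (e l) = if (l < K)%N then ip f (e l) else 0.
Proof.
elim: K => [|K IH]; first by rewrite /P big_ord0 ip0l.
rewrite projection_recr ipL //.
rewrite IH ee; have [lK|Kl|->] := ltngtP l K.
- by rewrite ltnS (ltnW lK) mulr0 add0r.
- by rewrite ltnS leqNgt Kl mulr0 addr0.
- by rewrite ltnSn mulr1 addr0.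
Qed.

Lemma sqnorm_projection K : sqnorm (P K) = \sum_(k < K) normc (ip f (e k)) ^+ 2.
Proof.
elim: K => [|K IH]; first by rewrite /P !big_ord0 /sqnorm ip0l.
rewrite projection_recr big_ord_recr /= -IH sqnormZD //.
rewrite (ipC (H_projection K) (He K)) ip_projection ltnn conjc0 mulr0 /= mulr0 addr0.
by rewrite /sqnorm ee eqxx /= mulr1 addrC.
Qed.

Lemma sqnorm_residual K :
  sqnorm (f - P K) = sqnorm f - \sum_(k < K) normc (ip f (e k)) ^+ 2.
Proof.
have hP := H_projection K.
have E : ip f (P K) = (\sum_(k < K) normc (ip f (e k)) ^+ 2)%:C.
  rewrite /P ip_sumr //; last by move=> i; exact: H_scale.
  rewrite rmorph_sum; apply: eq_bigr => i _; rewrite ipZr // normc_sqr.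
  by case: (ip f (e i)) => x y; apply/eqP; rewrite eq_complex /=; apply/andP; split; apply/eqP; ring.
have := sqnormZD (-1) hP hf; rewrite scaleN1r addrC => ->.
rewrite (ipC hf hP) E sqnorm_projection normcN mulN1r conjc_real -rmorphN Re_real.
have -> : normc (1 : C) = 1 by rewrite -[X in normc X]/(1%:C) normc_real normr1.
ring.
Qed.

Lemma Bessel K : \sum_(k < K) normc (ip f (e k)) ^+ 2 <= sqnorm f.
Proof.
have := sqnorm_ge0 (H_sub hf (H_projection K)); rewrite sqnorm_residual; lra.
Qed.

Lemma sqnorm_T_projection K :
  sqnorm (T (P K)) = \sum_(k < K) s k ^+ 2 * normc (ip f (e k)) ^+ 2.
Proof.
elim: K => [|K IH]; first by rewrite /P !big_ord0 T0 /sqnorm ip0l.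
have hP := H_projection K; have hTP := HT hP.
rewrite projection_recr big_ord_recr /= -IH TL // sqnormZD  //.
rewrite (ipC (HT hP) (HT (He K))) ip_T_T // ip_projection ltnn mulr0 conjc0 mulr0 /= mulr0 addr0.
rewrite [sqnorm (T (e K))]/sqnorm ip_T_T // ee eqxx mulr1 /=.
ring.
Qed.

(** The vectors [T (e k)] are orthogonal with square norms [s k ^ 2]. Monotonicity replaces [s k] by
    [s 0] below [L] and by [s L] above, where Bessel's inequality finishes. *)
Lemma sqnorm_T_projection_le K L : (L <= K)%N ->
  sqnorm (T (P K)) <= s 0%N ^+ 2 * \sum_(k < L) normc (ip f (e k)) ^+ 2 + s L ^+ 2 * sqnorm f.
Proof.
move=> LK; rewrite sqnorm_T_projection.
have step k : s k ^+ 2 * normc (ip f (e k)) ^+ 2 <=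
    (if (k < L)%N then s 0%N ^+ 2 * normc (ip f (e k)) ^+ 2 else 0) + s L ^+ 2 * normc (ip f (e k)) ^+ 2.
  have n0 := sqr_ge0 (normc (ip f (e k))).
  case: ifP => kL; last first.
    rewrite add0r ler_wpM2r // ler_pXn2r ?nnegrE //.
    by apply: s_mono; rewrite leqNgt kL.
  apply: ler_wpDr; first by rewrite mulr_ge0 // sqr_ge0.
  by rewrite ler_wpM2r // ler_pXn2r ?nnegrE //; apply: s_mono.
apply: (le_trans (y := \sum_(k < K) ((if (k < L)%N then s 0%N ^+ 2 * normc (ip f (e k)) ^+ 2 else 0)
  + s L ^+ 2 * normc (ip f (e k)) ^+ 2))); first by apply: ler_sum.
rewrite big_split /= -mulr_sumr; apply: lerD; last first.
  by rewrite ler_wpM2l ?sqr_ge0 //; exact: Bessel.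
rewrite -big_mkcond /= mulr_sumr.
rewrite (big_ord_widen_cond K xpredT (fun k => s 0%N ^+ 2 * normc (ip f (e k)) ^+ 2) LK).
by rewrite le_eqVlt; apply/orP; left; apply/eqP; apply: eq_bigl => i; rewrite andTb.
Qed.

(* The residuals T (f - P K) cluster, by compactness, at some g with <g, T e_l> = 0;
   then S g is orthogonal to every e_l, so T S g = 0, S g = 0 and finally g = 0. *)
Lemma T_residual_small (d : R) K0 : 0 < d ->
  exists2 K, (K0 <= K)%N & sqnorm (T (f - P K)) <= d.
Proof.
move=> d0; pose r K := f - P K.
have hr K : H (r K) by exact: H_sub hf (H_projection K).
have rle K : sqnorm (r K) <= sqnorm f.
  by rewrite /r sqnorm_residual gerBl; apply: sumr_ge0 => i _; exact: sqr_ge0.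
case: compT => _ /(_ r hr) [|k [kmono [g [hg cvg_g]]]].
  by exists (hnorm ip f) => n; rewrite /hnorm ler_wsqrtr // rle.
have kge j : (j <= k j)%N by elim: j => // j IH; apply: leq_ltn_trans IH (kmono _ _ _).
have close (eps : R) : 0 < eps -> exists J, forall j, (J <= j)%N -> sqnorm (T (r (k j)) - g) <= eps.
  move=> e0; have se : 0 < Num.sqrt eps by rewrite sqrtr_gt0.
  move/cvgrPdist_le: cvg_g => /(_ _ se) [J _ HJ]; exists J => j Jj.
  have := HJ j Jj; rewrite /= sub0r normrN /hnorm ger0_norm ?sqrtr_ge0 //.
  by rewrite ler_sqrt // ltW.
have hT' j : H (T (r (k j))) by exact: HT.
have hTr j : H (T (r (k j)) - g) by apply: H_sub => //; exact: HT.
have small (x : R) : 0 <= x -> (forall eps : R, 0 < eps -> x <= eps) -> x = 0.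
  move=> x0 hx; apply/le_anti; rewrite x0 andbT; apply/ler_addgt0Pl => e1 e10.
  by rewrite addr0; exact: hx.
have gTe l : ip g (T (e l)) = 0.
  apply: eq0_normc; apply/eqP; rewrite -sqrf_eq0; apply/eqP.
  apply: small; first exact: sqr_ge0.
  move=> eps e0; set M := sqnorm (T (e l)) + 1.
  have M0 : 0 < M by rewrite ltr_wpDl // sqnorm_ge0 //; exact: HT.
  have [J HJ] := close (eps / M) (divr_gt0 e0 M0).
  pose j := maxn J l.+1.
  have h1 := HJ j (leq_maxl _ _).
  have z : ip (T (r (k j))) (T (e l)) = 0.
    have lk : (l < k j)%N by apply: leq_trans (kge j); exact: leq_maxr.
    by rewrite ip_T_T // /r ipBl // ?ip_projection ?lk ?subrr ?mulr0 //; exact: H_projection.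
  have : ip (T (r (k j)) - g) (T (e l)) = - ip g (T (e l)).
    by rewrite ipBl  // z sub0r.
  move=> E; rewrite -normcN -E.
  apply: (le_trans (Cauchy_Schwarz (hTr j) (HT (He l)))).
  apply: (le_trans (ler_wpM2r (sqnorm_ge0 (HT (He l))) h1)).
  rewrite mulrAC ler_pdivrMr // ler_wpM2l ?(ltW e0) // /M lerDl //.
have TSg : T (S g) = 0.
  apply: kernel; first exact: HS.
  move=> l; have hSg := HS hg.
  rewrite (ipC (He l) hSg) -adjE // (ipC hg (HTe l)) gTe.
  by rewrite !conjc0.
have Sg0 : sqnorm (S g) = 0.
  by have hSg := HS hg; rewrite /sqnorm -adjE // TSg ip0l.
have g0 : sqnorm g = 0.
  apply: small; first exact: sqnorm_ge0.
  move=> eps e0; have [J /(_ J (leqnn J)) HJ] := close eps e0.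
  have z : ip (T (r (k J))) g = 0.
    rewrite adjE //; apply: eq0_normc; apply/eqP; rewrite -sqrf_eq0 eq_le sqr_ge0 andbT.
    by have := Cauchy_Schwarz (hr (k J)) (HS hg); rewrite Sg0 mulr0.
  have E : ip (T (r (k J)) - g) g = - ip g g by rewrite ipBl  // z sub0r.
  have := Cauchy_Schwarz (hTr J) hg; rewrite E normcN ip_sqnorm // normc_real.
  rewrite real_normK ?num_real // expr2.
  have := sqnorm_ge0 hg; rewrite le_eqVlt => /orP[/eqP <- _|g0]; first exact: ltW.
  by rewrite ler_pM2r // => h; exact: le_trans h HJ.
have [J HJ] := close (d / 2) (divr_gt0 d0 (ltr0n R 2)).
pose j := maxn J K0; exists (k j).
  by apply: leq_trans (kge j); exact: leq_maxr.
rewrite -/(r _) -[T (r (k j))](subrK g).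
apply: (le_trans (sqnormD_le ltr01 (hTr j) hg)).
rewrite g0 mulr0 addr0; have := HJ j (leq_maxl _ _); lra.
Qed.

(** The vectors [e k] need not span [H]. What matters is that the part of [f] left out by a suitable
    projection has a small image, and [T_residual_small] provides this. *)
Lemma sqnorm_T_le L :
  sqnorm (T f) <= s 0%N ^+ 2 * \sum_(k < L) normc (ip f (e k)) ^+ 2 + s L ^+ 2 * sqnorm f.
Proof.
set X := _ + _.
have X0 : 0 <= X.
  rewrite addr_ge0 // mulr_ge0 ?sqr_ge0 ?sqnorm_ge0 //.
  by apply: sumr_ge0 => i _; exact: sqr_ge0.
apply/ler_addgt0Pl => eps e0.
(* Half of [eps] pays for the factor [1 + t] on the projected part. The residual is then made small
   enough for [1 + t^-1] to cost the other half. *)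
pose t := eps / (2 * (X + 1)).
have X1 : 0 < X + 1 by rewrite ltr_wpDl.
have t0 : 0 < t by rewrite divr_gt0 // mulr_gt0.
have tt : 0 < 1 + t^-1 by rewrite ltr_wpDr ?invr_ge0 ?(ltW t0).
have [K LK h] := T_residual_small L (divr_gt0 (divr_gt0 e0 (ltr0n R 2)) tt).
have hP := H_projection K; have hr := H_sub hf hP.
have E : T f = T (P K) + T (f - P K).
  by have := TL 1 hP hr; rewrite !scale1r addrC subrK.
rewrite E; apply: (le_trans (sqnormD_le t0 (HT hP) (HT hr))).
have h1 := sqnorm_T_projection_le LK; rewrite -/X in h1.
have h2 : (1 + t^-1) * sqnorm (T (f - P K)) <= eps / 2.
  by rewrite mulrC -ler_pdivlMr.
have h3 : (1 + t) * sqnorm (T (P K)) <= (1 + t) * X.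
  by rewrite ler_wpM2l // addr_ge0 // ltW.
have h4 : t * X <= eps / 2.
  rewrite /t mulrAC ler_pdivrMr ?mulr_gt0 //.
  rewrite (_ : eps / 2 * _ = eps * (X + 1)); last by field.
  by rewrite ler_wpM2l ?(ltW e0) // lerDl.
by rewrite mulrDl mul1r in h3; lra.
Qed.

End projection.

(** After exchange of the sums, each of the first [L] directions captures at most [B] of the whole
    family, however many functions there are. Only the term with [s L] grows with [N]. *)
Lemma singular_numbers_count N (f : nat -> V) (A B : R) L : 0 <= A -> 0 <= B ->
  (forall m, H (f m)) -> (forall m, sqnorm (f m) <= A) ->
  (forall m, (m < N)%N -> \sum_(k < N) normc (ip (f m) (f k)) <= B) ->
  \sum_(m < N) sqnorm (T (f m)) <= s 0%N ^+ 2 * (L%:R * B) + N%:R * (s L ^+ 2 * A).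
Proof.
move=> A0 B0 hf fA fB.
apply: (le_trans (y := \sum_(m < N) (s 0%N ^+ 2 * \sum_(k < L) normc (ip (f m) (e k)) ^+ 2
  + s L ^+ 2 * sqnorm (f m)))); first by apply: ler_sum => m _; exact: sqnorm_T_le.
rewrite big_split /=; apply: lerD; last first.
  apply: (le_trans (y := \sum_(m < N) s L ^+ 2 * A)).
    by apply: ler_sum => m _; rewrite ler_wpM2l ?sqr_ge0.
  by rewrite sumr_const card_ord mulr_natl.
rewrite -mulr_sumr ler_wpM2l ?sqr_ge0 // exchange_big /=.
apply: (le_trans (y := \sum_(k < L) B)).
  by apply: ler_sum => k _; apply: Boas_Bellman => //; rewrite /sqnorm ee eqxx.
by rewrite sumr_const card_ord mulr_natl.
Qed.

End singular_numbers_bound.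
End inner_product.

(** * The symbol *)

Section exponential_growth.

(** With [j = (d + 1) * m], the [d]-th power of [j + 4] is at most [(d + 5) ^ d * 2 ^ (d * m)], and
    one further factor [2 ^ m] absorbs the constants. The shift by 4 matches that in [theta]. *)
Lemma exponential_beats_power (R : realType) (d : nat) (K : R) :
  exists j : nat, K * (j + 4)%:R ^+ d <= 2 ^+ j.
Proof.
pose L : R := `|K| * (d + 5)%:R ^+ d.
have L0 : 0 <= L by rewrite mulr_ge0 // exprn_ge0.
pose m := Num.bound L.
exists (d.+1 * m)%N.
have m1 : (m.+1 <= 2 ^ m)%N by apply: ltn_expl.
have h1 : ((d.+1 * m + 4)%N%:R : R) <= (d + 5)%:R * 2 ^+ m.
  by rewrite -natrX -natrM ler_nat; nia.
have h2 : L <= 2 ^+ m.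
  apply: (le_trans (y := m%:R)); first by rewrite ltW // archi_boundP.
  by rewrite -natrX ler_nat ltnW.
have h3 : (d.+1 * m + 4)%:R ^+ d <= ((d + 5)%:R * 2 ^+ m) ^+ d :> R.
  by apply: lerXn2r => //; rewrite nnegrE // mulr_ge0 // exprn_ge0.
have h4 : K * (d.+1 * m + 4)%:R ^+ d <= `|K| * ((d + 5)%:R * 2 ^+ m) ^+ d.
  apply: (le_trans (y := `|K| * (d.+1 * m + 4)%:R ^+ d)).
    by rewrite ler_wpM2r ?ler_norm // exprn_ge0.
  by rewrite ler_wpM2l.
apply: (le_trans h4); rewrite exprMn mulrA -/L -exprM mulSn exprD mulnC.
by rewrite ler_wpM2r // exprn_ge0.
Qed.
End exponential_growth.

Section weights.
Context {R : realType}.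
Implicit Types (k m n : nat).

(* [trunc_log 2 k.+1] is the integer part of the binary logarithm; the shift by [4]
   keeps [theta k <= 1 / 4]. *)
Definition theta k : R := ((trunc_log 2 k.+1 + 4)%:R)^-1.

Lemma theta_gt0 k : 0 < theta k.
Proof. by rewrite invr_gt0 ltr0n addn4. Qed.

Lemma theta_le k : theta k <= 1 / 4.
Proof.
rewrite /theta mul1r lef_pV2 ?posrE ?ltr0n ?addn4 // ler_nat //.
Qed.

Lemma theta_decr k m : (k <= m)%N -> theta m <= theta k.
Proof.
move=> km; rewrite /theta lef_pV2 ?posrE ?ltr0n ?addn4 // ler_nat !ltnS.
by apply: leq_trunc_log; rewrite ltnS.
Qed.

Lemma trunc_logS k : (trunc_log 2 k.+2 <= (trunc_log 2 k.+1).+1)%N.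
Proof.
rewrite -ltnS -(ltn_exp2l _ _ (isT : 1 < 2)%N).
apply: leq_ltn_trans (trunc_logP (isT : 1 < 2)%N (isT : 0 < k.+2)%N) _.
have := trunc_log_ltn k.+1 (isT : 1 < 2)%N.
rewrite (expnS 2 (trunc_log 2 k.+1).+1).
by set P := (2 ^ (trunc_log 2 k.+1).+1)%N; lia.
Qed.

(** The integer logarithm rises by at most one per step, and the shift by 4 keeps the resulting
    ratio below [5 / 4]. *)
Lemma theta_slow k : theta k <= 5 / 4 * theta k.+1.
Proof.
have h : ((trunc_log 2 k.+2 + 4)%:R : R) <= 5 / 4 * (trunc_log 2 k.+1 + 4)%:R.
  apply: (le_trans (y := (trunc_log 2 k.+1 + 5)%:R)).
    by rewrite ler_nat; have := trunc_logS k; lia.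
  by rewrite !natrD; have := ler0n R (trunc_log 2 k.+1); lra.
have := theta_gt0 k; have := theta_gt0 k.+1; rewrite /theta !invr_gt0.
move: (_%:R) (_%:R) h => y x h y0 x0.
by rewrite ler_pdivlMr // mulrC ler_pdivrMr // mulrC.
Qed.

Lemma theta_pow j : theta (2 ^ j).-1 = ((j + 4)%:R)^-1.
Proof. by rewrite /theta prednK ?expn_gt0 // trunc_expnK. Qed.

Fixpoint remainder k : R := if k is k'.+1 then remainder k' * (1 - theta k') else 1.
Local Notation C := remainder.
Definition weight k : R := theta k * C k.
Local Notation c := weight.

Lemma remainderS k : C k.+1 = C k - c k.
Proof. by rewrite /= /c; ring. Qed.

Lemma remainder_gt0 k : 0 < C k.
Proof.
elim: k => //= k IH; rewrite mulr_gt0 //; have := theta_le k; lra.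
Qed.

Lemma remainder_step k : 3 / 4 * C k <= C k.+1 /\ C k.+1 <= C k.
Proof.
have := remainder_gt0 k; have := theta_le k; have := theta_gt0 k => /= *; split; nra.
Qed.

Lemma remainder_decr k m : (k <= m)%N -> C m <= C k.
Proof.
elim: m => [|m IH]; first by rewrite leqn0 => /eqP ->.
rewrite leq_eqVlt => /orP[/eqP -> //|]; rewrite ltnS => /IH.
by apply: le_trans; have [] := remainder_step m.
Qed.

Lemma remainder_le1 k : C k <= 1.
Proof. exact: (remainder_decr (leq0n k)). Qed.

Lemma weight_gt0 k : 0 < c k.
Proof. by rewrite mulr_gt0 ?theta_gt0 ?remainder_gt0. Qed.

Lemma weight_decr k m : (k <= m)%N -> c m <= c k.
Proof.
move=> km; apply: ler_pM; rewrite ?(ltW (theta_gt0 _)) ?(ltW (remainder_gt0 _)) //.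
  exact: theta_decr.
exact: remainder_decr.
Qed.

(** From [5 / 4 * (4 / 3) < 2]. Against the ratio 4 of successive [delta k], this makes the
    quotients [c k / delta k] at least double at each step. *)
Lemma weight_slow k : c k <= 2 * c k.+1.
Proof.
have := theta_slow k; have [] := remainder_step k; have := theta_gt0 k.+1; have := remainder_gt0 k.
rewrite /c; move: (theta k) (theta k.+1) (C k) (C k.+1) => x y u v h1 h2 h3 h4 h5.
have : x * u <= 5 / 4 * y * u by rewrite ler_wpM2r // ltW.
have : y * (3 / 4 * u) <= y * v by rewrite ler_wpM2l // ltW.
nra.
Qed.

Lemma sum_weight n : \sum_(k < n) c k = 1 - C n.
Proof.
elim: n => [|n IH]; first by rewrite big_ord0 /= subrr.
by rewrite big_ord_recr /= IH /c; ring.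
Qed.

(** Each factor [1 - theta m] is beaten by the growth of [1 + m * theta n], since
    [theta m >= theta n]. As [n * theta n] is unbounded, the remainders tend to 0. *)
Lemma remainder_theta n : C n * (1 + n%:R * theta n) <= 1.
Proof.
have key m : (m <= n)%N -> C m * (1 + m%:R * theta n) <= 1.
  elim: m => [|m IH] mn; first by rewrite mul0r addr0 mulr1.
  have h := IH (ltnW mn); have t := theta_decr (ltnW mn).
  have C0 := remainder_gt0 m; have t0 := theta_gt0 n; have t1 := theta_le m.
  have m0 : 0 <= m%:R :> R by [].
  apply: le_trans h; rewrite /= -mulrA ler_pM2l // -natr1.
  move: (theta m) (theta n) (m%:R : R) t t0 t1 m0 => x y u *.
  have : 0 <= u * y * (x - 0) by rewrite mulr_ge0 ?mulr_ge0 //; lra.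
  nra.
exact: key.
Qed.

Lemma remainder_cvg0 (e : R) : 0 < e -> exists n, C n <= e.
Proof.
move=> e0; have [j hj] := exponential_beats_power 1 (e^-1 + 1).
exists (2 ^ j).-1; have := remainder_theta (2 ^ j).-1; rewrite theta_pow.
have C0 := remainder_gt0 (2 ^ j).-1.
have E : ((2 ^ j).-1%:R : R) = 2 ^+ j - 1.
  by rewrite -subn1 natrB ?expn_gt0 // natrX.
rewrite E expr1 in hj *.
have j0 : 0 < (j + 4)%:R :> R by rewrite ltr0n addn4.
have j1 : 1 <= (j + 4)%:R :> R by rewrite ler1n addn4.
have h : e^-1 <= (2 ^+ j - 1) / (j + 4)%:R by rewrite ler_pdivlMr //; nra.
move=> k; have : C (2 ^ j).-1 * e^-1 <= 1.
  apply: le_trans k; rewrite ler_pM2l //; lra.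
by rewrite ler_pdivrMr // mul1r.
Qed.

Definition delta k : R := 4 ^- k.

Lemma delta_gt0 k : 0 < delta k.
Proof. by rewrite invr_gt0 exprn_gt0. Qed.

Lemma deltaS k : delta k.+1 = delta k / 4.
Proof. by rewrite /delta exprS invfM mulrC. Qed.

Lemma delta_decr k m : (k <= m)%N -> delta m <= delta k.
Proof.
move=> km; rewrite /delta lef_pV2 ?posrE ?exprn_gt0 //.
by rewrite ler_weXn2l // ler1n.
Qed.

Lemma delta_le1 k : delta k <= 1.
Proof. by have := delta_decr (leq0n k); rewrite /delta expr0 invr1. Qed.

(** This controls the terms of the symbol already close to 1 at scale [delta m]. The induction
    closes because [1 / 2 + theta <= 2 * (1 - theta)] for [theta <= 1 / 4]. *)
Lemma sum_weight_delta m : \sum_(k < m) c k / delta k <= C m / (2 * delta m).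
Proof.
elim: m => [|m IH]; first by rewrite big_ord0 divr_ge0 ?mulr_ge0 // ltW ?remainder_gt0 ?delta_gt0.
rewrite big_ord_recr /= -/(C m.+1); apply: (le_trans (lerD IH (lexx _))).
rewrite deltaS /c; have := theta_le m; have := remainder_gt0 m; have := delta_gt0 m.
have -> : C m.+1 = (1 - theta m) * C m by rewrite /= mulrC.
move: (theta m) (C m) (delta m) => t x d d0 x0 t4.
rewrite (_ : _ + _ = (x / 2 + t * x) / d); last by field; rewrite gt_eqF.
rewrite (_ : _ * x / _ = 2 * ((1 - t) * x) / d); last by field; rewrite gt_eqF.
by rewrite ler_wpM2r ?invr_ge0 ?(ltW d0) //; nra.
Qed.

(** A sum of terms that at least double is at most twice its last one. *)
Lemma sum_weight_delta2 m : \sum_(k < m.+1) c k / delta k <= 2 * (c m / delta m).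
Proof.
elim: m => [|m IH].
  rewrite big_ord_recr big_ord0 /= add0r; have : 0 <= c 0 / delta 0 by rewrite divr_ge0 // ltW ?weight_gt0 ?delta_gt0.
  lra.
rewrite big_ord_recr /=; apply: (le_trans (lerD IH (lexx _))).
rewrite deltaS; have := weight_slow m; have := delta_gt0 m.
move: (c m) (c m.+1) (delta m) => x y d d0 h.
rewrite (_ : y / (d / 4) = 4 * y / d); last by field; rewrite gt_eqF.
rewrite !mulrA -mulrDl ler_wpM2r ?invr_ge0 ?(ltW d0) //; lra.
Qed.

Lemma sum_delta_tail m n : \sum_(m <= k < n) delta k <= 2 * delta m.
Proof.
have H k : \sum_(0 <= i < k) delta (i + m) <= 2 * delta m - 2 * delta (k + m).
  elim: k => [|k IH]; first by rewrite big_geq // add0n subrr.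
  rewrite big_nat_recr //=; apply: (le_trans (lerD IH (lexx _))).
  rewrite addSn deltaS; have := delta_gt0 (k + m); lra.
have [nm|mn] := leqP n m; first by rewrite big_geq // mulr_ge0 // ltW // delta_gt0.
rewrite -{1}[m]add0n big_addn; apply: (le_trans (H _)).
have := delta_gt0 (n - m + m); lra.
Qed.


Definition bounded_by (M : R) (a : nat -> R) := forall k, `|a k| <= M.

(** The mean of [a] for the probability weights [c]. It is used for bounded sequences, where
    [wsum_cvg] guarantees the limit. *)
Definition wsum (a : nat -> R) : R := limn (series (fun k => c k * a k)).

Lemma series_weight M n : series (fun k => c k * M) n <= `|M|.
Proof.
rewrite /series /= big_mkord -mulr_suml sum_weight.
apply: (le_trans (y := (1 - C n) * `|M|)).
  by apply: ler_wpM2l (ler_norm _); have := remainder_le1 n; lra.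
have := normr_ge0 M; have := remainder_gt0 n; nra.
Qed.

Lemma wsum_cvg M a : bounded_by M a -> cvgn (series (fun k => c k * a k)).
Proof.
move=> aM; have M0 : 0 <= M := le_trans (normr_ge0 _) (aM 0).
apply: normed_cvg; apply: (series_le_cvg (v_ := fun k => c k * M)).
- by move=> n; rewrite normr_ge0.
- by move=> n; rewrite mulr_ge0 // ltW ?weight_gt0.
- by move=> n /=; rewrite normrM (gtr0_norm (weight_gt0 n)) ler_wpM2l // ltW ?weight_gt0.
apply: nondecreasing_is_cvgn.
  by apply/nondecreasing_seqP => n; rewrite seriesSr lerDl mulr_ge0 // ltW ?weight_gt0.
by exists `|M| => _ [n _ <-]; exact: series_weight.
Qed.

Lemma wsum_le M N a b : bounded_by M a -> bounded_by N b ->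
  (forall k, a k <= b k) -> wsum a <= wsum b.
Proof.
move=> /wsum_cvg ha /wsum_cvg hb ab; apply: lim_series_le => // k.
by rewrite ler_wpM2l // ltW ?weight_gt0.
Qed.

Lemma wsumD M N a b : bounded_by M a -> bounded_by N b ->
  wsum (fun k => a k + b k) = wsum a + wsum b.
Proof.
move=> /wsum_cvg ha /wsum_cvg hb; rewrite /wsum -lim_seriesD //.
by congr (limn (series _)); apply/funext => k; rewrite /= -mulrDr.
Qed.

Lemma wsumZ M x a : bounded_by M a -> wsum (fun k => x * a k) = x * wsum a.
Proof.
move=> /wsum_cvg ha; rewrite /wsum; etransitivity; last exact: (lim_seriesZ (V := R^o) x ha).
by congr (limn (series _)); apply/funext => k; rewrite /= mulrCA.
Qed.

Lemma wsum_upper M a B m : bounded_by M a ->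
  (forall n, \sum_(k < m + n) c k * a k <= B) -> wsum a <= B.
Proof.
move=> /wsum_cvg ha h; apply: limr_le => //; exists m => // n /= mn.
by rewrite /series /= big_mkord; have := h (n - m)%N; rewrite subnKC.
Qed.

Lemma wsum_lower M a B m : bounded_by M a ->
  (forall n, B <= \sum_(k < m + n) c k * a k) -> B <= wsum a.
Proof.
move=> /wsum_cvg ha h; apply: limr_ge => //; exists m => // n /= mn.
by rewrite /series /= big_mkord; have := h (n - m)%N; rewrite subnKC.
Qed.

(** The partial sums telescope to [C m - C (m + n)], and [C] tends to 0. For [m = 0] this says that
    the weights have total mass 1. *)
Lemma wsum_step M a m : bounded_by M a ->
  (forall k, a k = (m <= k)%:R) -> wsum a = C m.
Proof.
move=> ha E; have S n : \sum_(k < m + n) c k * a k = C m - C (m + n).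
  elim: n => [|n IH].
    rewrite addn0 subrr; apply: big1 => -[k km] _; rewrite E /= leqNgt km mulr0 //.
  by rewrite addnS big_ord_recr IH E /= leq_addr mulr1 -/(C (m + n).+1) remainderS; ring.
apply/eqP; rewrite eq_le; apply/andP; split.
  by apply: (wsum_upper (m := m) ha) => n; rewrite S; have := remainder_gt0 (m + n); lra.
apply/ler_addgt0Pr => e e0; have [p hp] := remainder_cvg0 e0.
rewrite -lerBlDr; apply: (wsum_lower (m := m + p) ha) => n.
rewrite -addnA S lerB // (le_trans _ hp) //; apply: remainder_decr; lia.
Qed.

Lemma wsum_cst x : wsum (fun=> x) = x.
Proof.
have b : bounded_by 1 (fun=> 1) by move=> k; rewrite normr1.
have b1 : wsum (fun=> 1) = 1 by rewrite (wsum_step (m := 0) b).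
rewrite -[RHS]mulr1 -[in RHS]b1 -(wsumZ _ b).
by congr wsum; apply/funext => k; rewrite mulr1.
Qed.

Lemma wsum_ge_term M a m : bounded_by M a -> (forall k, 0 <= a k) ->
  c m * a m <= wsum a.
Proof.
move=> ha a0; apply: (wsum_lower (m := m.+1) ha) => n.
rewrite (bigD1 (Ordinal (leq_addr n m.+1 : m < m.+1 + n)%N)) //= lerDl.
by apply: sumr_ge0 => i _; rewrite mulr_ge0 // ltW ?weight_gt0.
Qed.

Definition cwsum (a : nat -> R[i]) : R[i] :=
  wsum (fun k => complex.Re (a k)) +i* wsum (fun k => complex.Im (a k)).

Definition cbounded_by (M : R) (a : nat -> R[i]) := forall k, normc (a k) <= M.

Lemma cbounded_Re M a : cbounded_by M a -> bounded_by M (fun k => complex.Re (a k)).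
Proof. by move=> h k; exact: le_trans (Re_le_normc _) (h k). Qed.

Lemma cbounded_Im M a : cbounded_by M a -> bounded_by M (fun k => complex.Im (a k)).
Proof. by move=> h k; exact: le_trans (Im_le_normc _) (h k). Qed.

Lemma cbounded_norm M a : cbounded_by M a -> bounded_by M (fun k => normc (a k)).
Proof. by move=> h k; rewrite ger0_norm ?normc_ge0. Qed.

Lemma cbounded_Z M x a : cbounded_by M a -> cbounded_by (normc x * M) (fun k => x * a k).
Proof. by move=> h k; rewrite normcM ler_wpM2l ?normc_ge0. Qed.

Lemma cwsumD M N a b : cbounded_by M a -> cbounded_by N b ->
  cwsum (fun k => a k + b k) = cwsum a + cwsum b.
Proof.
move=> ha hb; rewrite /cwsum; apply/eqP; rewrite eq_complex; apply/andP; split; apply/eqP => /=.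
  rewrite -(wsumD (cbounded_Re ha) (cbounded_Re hb)).
  by congr wsum; apply/funext => k; rewrite Re_addc.
rewrite -(wsumD (cbounded_Im ha) (cbounded_Im hb)).
by congr wsum; apply/funext => k; rewrite Im_addc.
Qed.

Lemma cwsumZ M x a : cbounded_by M a -> cwsum (fun k => x * a k) = x * cwsum a.
Proof.
move=> ha; have hr := cbounded_Re ha; have hi := cbounded_Im ha.
have b y f : bounded_by M f -> bounded_by (`|y| * M) (fun k => y * f k).
  by move=> h k; rewrite normrM ler_wpM2l.
have hD := wsumD (b _ _ hr) (b _ _ hi).
case: x => u v; rewrite /cwsum; apply/eqP; rewrite eq_complex; apply/andP; split; apply/eqP => /=.
  rewrite -(wsumZ _ hr) -mulNr -(wsumZ _ hi) -hD.
  by congr wsum; apply/funext => k; case: (a k) => p q /=; rewrite mulNr.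
rewrite -(wsumZ _ hr) -(wsumZ _ hi) addrC -hD.
by congr wsum; apply/funext => k; case: (a k) => p q /=; rewrite addrC.
Qed.

Lemma cwsum_cst x : cwsum (fun=> x) = x.
Proof. by rewrite /cwsum !wsum_cst; case: x. Qed.

(** A rotation by [u] makes the sum real and positive, so a real comparison applies. Separate bounds
    on real and imaginary parts would lose a factor that the symbol cannot afford, as it must remain
    in the disk. *)
Lemma normc_cwsum M a : cbounded_by M a -> normc (cwsum a) <= wsum (fun k => normc (a k)).
Proof.
move=> ha; have [w0|w0] := eqVneq (cwsum a) 0.
  rewrite w0 normc0; apply: (wsum_lower (m := 0) (cbounded_norm ha)) => n.
  by apply: sumr_ge0 => i _; rewrite mulr_ge0 ?normc_ge0 // ltW ?weight_gt0.
have n0 : 0 < normc (cwsum a) by rewrite normc_gt0.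
pose u : R[i] := (cwsum a)^* / (normc (cwsum a))%:C.
have u1 : normc u = 1.
  by rewrite normcM normcV normc_conj normc_real ger0_norm ?normc_ge0 // divff ?gt_eqF.
have E : normc (cwsum a) = complex.Re (cwsum (fun k => u * a k)).
  rewrite (cwsumZ _ ha) /u mulrAC (mulrC _^*).
  have -> : cwsum a * (cwsum a)^* = ((normc (cwsum a)) ^+ 2)%:C.
    by case: (cwsum a) => x y; rewrite normc_sqr; simpc; congr (_ +i* _); ring.
  by rewrite -rmorphV ?unitfE ?gt_eqF // -rmorphM /= expr2 mulfK // gt_eqF.
rewrite {1}E; apply: wsum_le (cbounded_Re (cbounded_Z u ha)) (cbounded_norm ha) _ => k.
by apply: (le_trans (ler_norm _)); apply: (le_trans (Re_le_normc _)); rewrite normcM u1 mul1r.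
Qed.

End weights.

(** * The Moebius building blocks and the symbol *)

Section symbol.
Context {R : realType}.
Local Notation C := R[i].
Implicit Types (z w : C) (d : R).

Lemma Re_lt1 z : normc z < 1 -> 0 < complex.Re (1 - z).
Proof.
move=> z1; rewrite Re_addc Re_oppc /= subr_gt0.
by apply: le_lt_trans z1; apply: le_trans (Re_le_normc z); exact: ler_norm.
Qed.

(** The two sides differ by [2 * d * Re (1 - z)]. The added [d ^ 2] yields both the bound for the
    Moebius factor far from 1 and the decay of the test functions. *)
Lemma shift_norm d z : 0 < d -> 0 <= complex.Re (1 - z) ->
  d ^+ 2 + normc (1 - z) ^+ 2 <= normc (1 + d%:C - z) ^+ 2.
Proof.
move=> d0; rewrite !normc_sqr; case: z => a b; simpc => /= h; nra.
Qed.

Lemma shift_normP d z : 0 < d -> 0 <= complex.Re (1 - z) ->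
  [/\ 0 < normc (1 + d%:C - z), d <= normc (1 + d%:C - z) &
      normc (1 - z) <= normc (1 + d%:C - z)].
Proof.
move=> d0 hz; have h := shift_norm d0 hz; have := normc_ge0 (1 - z).
have := normc_ge0 (1 + d%:C - z); move: h.
by move: (normc _) (normc _) => A r h A0 r0; split; nra.
Qed.

Lemma normc_div z w : normc (z / w) = normc z / normc w.
Proof. by rewrite normcM normcV. Qed.

Lemma normc1_real d : 0 <= d -> normc (1 + d%:C) = 1 + d.
Proof.
by move=> d0; rewrite -[1]/(1%:C) -rmorphD normc_real ger0_norm // addr_ge0.
Qed.

(** It maps the disk onto the disk with diameter from [- d / (2 + d)] to 1, internally tangent to
    the circle at 1. *)
Definition mobius d z : C := d%:C * z / (1 + d%:C - z).

Lemma mobius_norm d z : 0 < d -> normc (mobius d z) = normc z * (d / normc (1 + d%:C - z)).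
Proof. by move=> d0; rewrite normc_div normcM normc_real gtr0_norm // mulrA (mulrC d). Qed.

Lemma mobius_le d z : 0 < d -> normc z < 1 -> normc (mobius d z) <= normc z.
Proof.
move=> d0 z1; have [A0 dA _] := shift_normP d0 (ltW (Re_lt1 z1)).
by rewrite mobius_norm // ler_piMr ?normc_ge0 // ler_pdivrMr // mul1r.
Qed.

(** Here [|1 + d - z| ^ 2 >= 2 * d ^ 2], and [1 / sqrt 2 <= 3 / 4]. *)
Lemma mobius_far d z : 0 < d -> normc z < 1 -> d <= normc (1 - z) ->
  normc (mobius d z) <= 3 / 4.
Proof.
move=> d0 z1 hz; have h := shift_norm d0 (ltW (Re_lt1 z1)).
have [A0 _ _] := shift_normP d0 (ltW (Re_lt1 z1)).
rewrite mobius_norm // (le_trans (y := d / normc (1 + d%:C - z))) //.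
  by rewrite ler_piMl ?(ltW z1) // divr_ge0 ?ltW.
rewrite ler_pdivrMr //.
by move: h A0 hz; move: (normc _) (normc _) => A r *; nra.
Qed.

Lemma one_sub_mobius d z : 0 < d -> normc z < 1 ->
  1 - mobius d z = (1 + d%:C) * (1 - z) / (1 + d%:C - z).
Proof.
move=> d0 z1; have [A0 _ _] := shift_normP d0 (ltW (Re_lt1 z1)).
by rewrite normc_gt0 in A0; rewrite /mobius; field.
Qed.

Lemma one_sub_mobius_le d z : 0 < d -> d <= 1 -> normc z < 1 ->
  normc (1 - mobius d z) <= 2 * normc (1 - z) / d.
Proof.
move=> d0 d1 z1; have [A0 dA _] := shift_normP d0 (ltW (Re_lt1 z1)).
rewrite one_sub_mobius // normc_div normcM normc1_real ?(ltW d0) //.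
apply: ler_pM; rewrite ?mulr_ge0 ?invr_ge0 ?normc_ge0 //.
- by rewrite addr_ge0 ?(ltW d0).
- by apply: ler_wpM2r; [exact: normc_ge0|lra].
- by rewrite lef_pV2 ?posrE.
Qed.

Definition mobius' d z : C := d%:C * (1 + d%:C) / (1 + d%:C - z) ^+ 2.

Lemma mobius'_norm d z : 0 < d ->
  normc (mobius' d z) = d * (1 + d) / normc (1 + d%:C - z) ^+ 2.
Proof.
by move=> d0; rewrite normc_div normcM normc_real normc1_real ?(ltW d0) // normcX gtr0_norm.
Qed.

(** The remainder is exact, and its denominator is bounded below by [|1 - (z + w)|] independently of
    [d]. This uniformity is what permits differentiation of the series term by term. *)
Lemma mobius_Taylor d z w : 1 + d%:C - z != 0 -> 1 + d%:C - (z + w) != 0 ->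
  mobius d (z + w) - mobius d z - mobius' d z * w =
  mobius' d z * (w ^+ 2 / (1 + d%:C - (z + w))).
Proof. by move=> h1 h2; rewrite /mobius /mobius'; field; rewrite h1 h2. Qed.

Lemma mobius'_le d z : 0 < d -> d <= 1 -> normc z < 1 ->
  normc (mobius' d z) <= 2 * d / normc (1 - z) ^+ 2 /\ normc (mobius' d z) <= 2 / d.
Proof.
move=> d0 d1 z1; have h := ltW (Re_lt1 z1).
have [A0 dA rA] := shift_normP d0 h.
have r0 : 0 < normc (1 - z).
  by apply: lt_le_trans (Re_lt1 z1) _; apply: le_trans (Re_le_normc _); exact: ler_norm.
rewrite mobius'_norm //; move: A0 dA rA r0.
move: (normc (1 + _ - z)) (normc (1 - z)) => A r A0 dA rA r0.
have X : d * (1 + d) <= 2 * d by nra.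
split.
  apply: ler_pM => //; rewrite ?invr_ge0 ?sqr_ge0 ?mulr_ge0 ?(ltW d0) ?addr_ge0 ?(ltW d0) //.
  by rewrite lef_pV2 ?posrE ?exprn_gt0 // lerXn2r ?nnegrE ?(ltW A0) ?(ltW r0).
rewrite ler_pdivrMr ?exprn_gt0 // mulrAC ler_pdivlMr //; nra.
Qed.

Definition symbol z : C := cwsum (fun k => mobius (delta k) z).
Definition symbol' z : C := cwsum (fun k => mobius' (delta k) z).

Lemma mobius_bounded z : normc z < 1 -> cbounded_by (normc z) (fun k => mobius (delta k) z).
Proof. by move=> z1 k; apply: mobius_le => //; exact: delta_gt0. Qed.

Lemma mobius'_bounded z : normc z < 1 ->
  cbounded_by (2 / normc (1 - z) ^+ 2) (fun k => mobius' (delta k) z).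
Proof.
move=> z1 k; have [h _] := mobius'_le (delta_gt0 k) (delta_le1 k) z1.
apply: le_trans h _; rewrite ler_wpM2r ?invr_ge0 ?sqr_ge0 //.
have := delta_le1 (R := R) k; lra.
Qed.

Lemma symbol0 : symbol 0 = 0.
Proof.
have -> : symbol 0 = cwsum (fun=> 0 : C).
  by congr cwsum; apply/funext => k; rewrite /mobius mulr0 mul0r.
exact: cwsum_cst.
Qed.

Lemma symbol_le z : normc z < 1 -> normc (symbol z) <= normc z.
Proof.
move=> z1; have h := mobius_bounded z1; apply: le_trans (normc_cwsum h) _.
rewrite -[leRHS]wsum_cst; apply: wsum_le (cbounded_norm h) _ h.
by move=> k; rewrite ger0_norm ?normc_ge0.
Qed.

(** The terms with [k >= m], of total weight [C m], have modulus at most [3 / 4]; the others are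
    bounded by 1. *)
Lemma symbol_far z m : normc z < 1 -> delta m <= normc (1 - z) ->
  normc (symbol z) <= 1 - remainder m / 4.
Proof.
move=> z1 hz; have h := mobius_bounded z1; apply: le_trans (normc_cwsum h) _.
have b : bounded_by 1 (fun k => (m <= k)%:R : R).
  by move=> k; case: (m <= k)%N; rewrite ?normr1 ?normr0.
have b' : bounded_by (`|- (1 / 4)| * 1) (fun k => - (1 / 4) * (m <= k)%:R : R).
  by move=> k; rewrite normrM ler_wpM2l.
have b1 : bounded_by 1 (fun=> 1 : R) by move=> k; rewrite normr1.
have := wsumD b1 b'; rewrite wsum_cst (wsumZ _ b) (wsum_step (m := m) b) // => E.
rewrite (_ : 1 - _ = 1 + - (1 / 4) * remainder m); last by field.
rewrite -E; apply: (wsum_le (N := 1 + `|- (1 / 4)| * 1) (cbounded_norm h)).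
  by move=> k; apply: le_trans (ler_normD _ _) _; exact: lerD (b1 k) (b' k).
move=> k; have [mk|_] := leqP m k; rewrite ?mulr1 ?mulr0 ?addr0.
  have : normc (mobius (delta k) z) <= 3 / 4; last lra.
  by apply: mobius_far => //; [exact: delta_gt0|apply: le_trans hz; exact: delta_decr].
exact: le_trans (h k) (ltW z1).
Qed.

(** The terms with [k < m] differ from 1 by at most [2 * delta m / delta k] and contribute [C m] in
    all. The tail has weight [C m], each of its terms being within 2 of 1. *)
Lemma symbol_near z m : normc z < 1 -> normc (1 - z) <= delta m ->
  normc (1 - symbol z) <= 3 * remainder m.
Proof.
move=> z1 hz; have hb := mobius_bounded z1.
have h1 : cbounded_by 1 (fun=> 1 : C) by move=> k; rewrite normc1.
have hN : cbounded_by (normc (-1 : C) * normc z) (fun k => -1 * mobius (delta k) z).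
  exact: cbounded_Z.
have E : 1 - symbol z = cwsum (fun k => 1 - mobius (delta k) z).
  have := cwsumD h1 hN; rewrite cwsum_cst (cwsumZ _ hb) mulN1r => <-.
  by congr cwsum; apply/funext => k; rewrite mulN1r.
have h : cbounded_by 2 (fun k => 1 - mobius (delta k) z).
  move=> k; apply: le_trans (normcB _ _) _; rewrite normc1.
  have := hb k; lra.
rewrite E; apply: le_trans (normc_cwsum h) _.
apply: (wsum_upper (m := m) (cbounded_norm h)) => n.
rewrite big_split_ord /=.
have d0 := delta_gt0 (R := R) m.
have s1 : \sum_(i < m) weight i * normc (1 - mobius (delta i) z) <= remainder m.
  apply: (le_trans (y := \sum_(i < m) 2 * delta m * (weight i / delta i))).
    apply: ler_sum => i _; rewrite mulrCA; apply: ler_wpM2l; first exact/ltW/weight_gt0.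
    apply: le_trans (one_sub_mobius_le (delta_gt0 i) (delta_le1 i) z1) _.
    by apply: ler_wpM2r; [rewrite invr_ge0 ltW // delta_gt0|lra].
  rewrite -mulr_sumr; have := sum_weight_delta (R := R) m.
  by rewrite ler_pdivlMr ?mulr_gt0 // mulrC.
have s2 : \sum_(i < n) weight (m + i) * normc (1 - mobius (delta (m + i)) z) <=
          2 * (remainder m - remainder (m + n)).
  elim: n => [|n IH]; first by rewrite big_ord0 addn0 subrr mulr0.
  rewrite big_ord_recr addnS remainderS; apply: (le_trans (lerD IH (lexx _))) => /=.
  have := h (m + n)%N; have := weight_gt0 (R := R) (m + n)%N; nra.
have := remainder_gt0 (R := R) (m + n)%N; lra.
Qed.

Lemma symbol'_le z : normc z < 1 -> normc (symbol' z) <= 2 / normc (1 - z) ^+ 2.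
Proof.
move=> z1; have h := mobius'_bounded z1; apply: le_trans (normc_cwsum h) _.
rewrite -[leRHS]wsum_cst; apply: (wsum_le (N := 2 / normc (1 - z) ^+ 2) (cbounded_norm h) _ h).
by move=> k; rewrite ger0_norm //; exact: le_trans (normc_ge0 _) (h 0%N).
Qed.

(** For [k <= m] the bound [2 / delta k] sums geometrically to [4 * c m / delta m]. For [k > m] the
    bound [2 * delta k / |1 - z| ^ 2] is summable in [delta k] and gives the remaining 16. *)
Lemma symbol'_shell z m : normc z < 1 -> delta m.+1 <= normc (1 - z) ->
  normc (symbol' z) <= 20 * (weight m / delta m).
Proof.
move=> z1 hz; have h := mobius'_bounded z1; apply: le_trans (normc_cwsum h) _.
apply: (wsum_upper (m := m.+1) (cbounded_norm h)) => n.
rewrite big_split_ord /=.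
have d0 := delta_gt0 (R := R) m; have c0 := weight_gt0 (R := R) m.
have s1 : \sum_(i < m.+1) weight i * normc (mobius' (delta i) z) <= 4 * (weight m / delta m).
  apply: (le_trans (y := \sum_(i < m.+1) 2 * (weight i / delta i))).
    apply: ler_sum => i _; rewrite mulrCA; apply: ler_wpM2l; first exact/ltW/weight_gt0.
    by have [_] := mobius'_le (delta_gt0 i) (delta_le1 i) z1.
  rewrite -mulr_sumr; have := sum_weight_delta2 (R := R) m; lra.
have s2 : \sum_(i < n) weight (m.+1 + i) * normc (mobius' (delta (m.+1 + i)) z) <=
          16 * (weight m / delta m).
  apply: (le_trans (y := \sum_(i < n) 32 * weight m / delta m ^+ 2 * delta (m.+1 + i))).
    apply: ler_sum => i _; have [g _] := mobius'_le (delta_gt0 (m.+1 + i)) (delta_le1 (m.+1 + i)) z1.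
    rewrite (_ : 32 * _ / _ * _ = weight m * (32 * delta (m.+1 + i) / delta m ^+ 2)); last by ring.
    apply: ler_pM; rewrite ?normc_ge0 //; first exact/ltW/weight_gt0.
      by apply: weight_decr; lia.
    apply: le_trans g _.
    rewrite deltaS in hz; have := delta_gt0 (R := R) (m.+1 + i).
    move: (delta (m.+1 + i)) (delta m) (normc (1 - z)) d0 hz => e d r d0 dr e0.
    have r0 : 0 < r by lra.
    rewrite ler_pdivrMr ?exprn_gt0 //.
    rewrite mulrAC ler_pdivlMr ?exprn_gt0 //.
    have : d ^+ 2 <= 16 * r ^+ 2 by nra.
    nra.
  rewrite -mulr_sumr (_ : 16 * _ = 32 * weight m / delta m ^+ 2 * (2 * delta m.+1)).
    apply: ler_wpM2l; first by apply: divr_ge0; [apply: mulr_ge0 => //; exact: ltW|exact: sqr_ge0].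
    have := sum_delta_tail (R := R) m.+1 (m.+1 + n).
    rewrite -{1}[m.+1]add0n big_addn addKn big_mkord.
    by under eq_bigr do rewrite addnC.
  by rewrite deltaS; field; rewrite gt_eqF.
lra.
Qed.

(** On the real axis every term of the derivative is positive, so the [m]-th one alone is a lower
    bound. *)
Lemma symbol'_lower m : (0 < m)%N ->
  weight m / (4 * delta m) <= normc (symbol' (1 - (delta m : R)%:C)).
Proof.
move=> m0; have d0 := delta_gt0 (R := R) m; have d1 : delta m < 1 :> R.
  rewrite -(prednK m0) deltaS; have := delta_le1 (R := R) m.-1; lra.
have E1 : normc (1 - (delta m : R)%:C) = 1 - delta m.
  by rewrite -[1]/(1%:C) -rmorphB normc_real ger0_norm //; lra.
have z1 : normc (1 - (delta m : R)%:C) < 1 by rewrite E1; lra.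
have hb := mobius'_bounded z1.
have T k : mobius' (delta k) (1 - (delta m : R)%:C) =
    (delta k * (1 + delta k) / (delta k + delta m) ^+ 2)%:C.
  move: (delta k) (delta m) => d e; rewrite /mobius'.
  have -> : 1 + d%:C - (1 - e%:C) = (d + e)%:C by rewrite rmorphD; ring.
  have -> : 1 + d%:C = (1 + d)%:C by rewrite rmorphD.
  by rewrite -rmorphM -rmorphXn -fmorphV -rmorphM.
apply: le_trans (le_trans (ler_norm _) (Re_le_normc _)).
have c0 := weight_gt0 (R := R) m.
have := wsum_ge_term m (cbounded_Re hb); rewrite T Re_real => H.
apply: le_trans (H _); last first.
  move=> k; rewrite T /=; have := delta_gt0 (R := R) k => k0.
  by rewrite divr_ge0 ?sqr_ge0 // mulr_ge0 ?addr_ge0 ?(ltW k0).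
apply: ler_wpM2l; first exact: ltW.
rewrite -div1r ler_pdivrMr ?mulr_gt0 //.
have -> : delta m * (1 + delta m) / (delta m + delta m) ^+ 2 * (4 * delta m) = 1 + delta m :> R.
  by rewrite -mulr2n -mulr_natl; field; rewrite gt_eqF.
by rewrite lerDl ltW.
Qed.

Lemma cdiff_symbol z : normc z < 1 -> cdiff symbol z (symbol' z).
Proof.
move=> z1 e e0; pose r : R := normc (1 - z).
have r0 : 0 < r.
  by apply: lt_le_trans (Re_lt1 z1) _; apply: le_trans (Re_le_normc _); exact: ler_norm.
pose t : R := Num.min (1 - normc z) (Num.min (r / 2) (e * r ^+ 3 / 4)).
have t0 : 0 < t.
  by rewrite !lt_min subr_gt0 z1 divr_gt0 // divr_gt0 // mulr_gt0 // exprn_gt0.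
have alg (a b : R) : b != 0 -> 2 / b ^+ 2 * (a ^+ 2 / (b / 2)) = 4 * a / b ^+ 3 * a.
  by move=> b0; field.
exists t => // w; rewrite !lt_min => /and3P[w1 w2 w3].
have w0 := normc_ge0 w.
have zw1 : normc (z + w) < 1 by apply: le_lt_trans (normcD _ _) _; lra.
have hb := mobius_bounded z1; have hb' := mobius'_bounded z1.
have hbw := mobius_bounded zw1.
have hbN := cbounded_Z (-1) hb; have hbN' := cbounded_Z (- w) hb'.
have hDN : cbounded_by (normc (z + w) + normc (-1 : C) * normc z)
    (fun k => mobius (delta k) (z + w) + -1 * mobius (delta k) z).
  by move=> k; apply: le_trans (normcD _ _) _; apply: lerD; [exact: hbw|exact: hbN].
have E : symbol (z + w) - symbol z - symbol' z * w =
    cwsum (fun k => mobius (delta k) (z + w) - mobius (delta k) z - mobius' (delta k) z * w).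
  have := cwsumD hDN hbN'; rewrite (cwsumD hbw hbN) (cwsumZ _ hb) (cwsumZ _ hb').
  rewrite mulN1r mulNr (mulrC w) => <-; congr cwsum; apply/funext => k.
  by rewrite mulN1r mulNr (mulrC w).
have bd k : normc (mobius (delta k) (z + w) - mobius (delta k) z - mobius' (delta k) z * w) <=
    e * normc w.
  have d0 := delta_gt0 (R := R) k.
  have [A0 _ rA] := shift_normP d0 (ltW (Re_lt1 z1)).
  have [B0 _ rB] := shift_normP d0 (ltW (Re_lt1 zw1)).
  have r2 : r / 2 <= normc (1 - (z + w)).
    have := normcBD (1 - z - w) (1 - z) 0; rewrite !subr0.
    rewrite (_ : 1 - z - (1 - z - w) = w); last by ring.
    by rewrite (_ : 1 - z - w = 1 - (z + w)); [rewrite -/r; lra|ring].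
  rewrite mobius_Taylor; rewrite -?normc_gt0 //.
  rewrite normcM normc_div normcX.
  apply: (le_trans (y := 2 / r ^+ 2 * (normc w ^+ 2 / (r / 2)))).
    apply: ler_pM; [exact: normc_ge0| |exact: hb'|].
      by rewrite divr_ge0 ?sqr_ge0 ?normc_ge0.
    apply: ler_wpM2l; first exact: sqr_ge0.
    rewrite lef_pV2 ?posrE ?divr_gt0 //; exact: le_trans rB.
  rewrite alg ?gt_eqF //.
  apply: ler_wpM2r => //; rewrite ler_pdivrMr ?exprn_gt0 //; lra.
rewrite E; apply: le_trans (normc_cwsum bd) _.
rewrite -[leRHS]wsum_cst; apply: wsum_le (cbounded_norm bd) _ bd.
by move=> k; rewrite ger0_norm // mulr_ge0 // ltW.
Qed.

Lemma symbol_derivative z : normc z < 1 -> complex_derivative symbol z = symbol' z.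
Proof. by move=> z1; exact/cdiff_derivative/cdiff_symbol. Qed.

Lemma symbol_schur : schur_function symbol.
Proof.
split; last by move=> z /diskE z1; apply/diskE; exact: le_lt_trans (symbol_le z1) z1.
by apply/holomorphicP => z z1; rewrite symbol_derivative //; exact: cdiff_symbol.
Qed.

End symbol.

(** * The Dirichlet space *)

Section integral_combinations.
Context {d : measure_display} {T : measurableType d} {R : realType}.
Variables (mu : {measure set T -> \bar R}) (D : set T).
Hypothesis mD : measurable D.

Lemma ge0_le_integral_combination (u v w : T -> \bar R) (k l : R) : 0 <= k -> 0 <= l ->
  (forall x, 0 <= u x)%E -> (forall x, 0 <= v x)%E -> (forall x, 0 <= w x)%E ->
  measurable_fun D u -> measurable_fun D v -> measurable_fun D w ->
  (forall x, D x -> w x <= k%:E * u x + l%:E * v x)%E ->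
  (\int[mu]_(x in D) w x <=
   k%:E * \int[mu]_(x in D) u x + l%:E * \int[mu]_(x in D) v x)%E.
Proof.
move=> k0 l0 u0 v0 w0 mu' mv mw H.
rewrite -!ge0_integralZl_EFin // -ge0_integralD //; last 4 first.
- by move=> x _; apply: mule_ge0.
- exact: measurable_funeM.
- by move=> x _; apply: mule_ge0.
- exact: measurable_funeM.
apply: ge0_le_integral => //.
- by apply: emeasurable_funD; exact: measurable_funeM.
Qed.

Lemma dominated_integrable (u v : T -> \bar R) (w : T -> R) :
  (forall x, 0 <= u x)%E -> (forall x, 0 <= v x)%E ->
  measurable_fun D u -> measurable_fun D v -> measurable_fun D w ->
  (\int[mu]_(x in D) u x < +oo)%E -> (\int[mu]_(x in D) v x < +oo)%E ->
  (forall x, `|w x|%:E <= u x + v x)%E ->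
  mu.-integrable D (EFin \o w).
Proof.
move=> u0 v0 mu' mv mw uoo voo H.
have I f : (forall x, 0 <= f x)%E -> measurable_fun D f ->
    (\int[mu]_(x in D) f x < +oo)%E -> mu.-integrable D f.
  move=> f0 mf foo; apply/integrableP; split => //.
  by under eq_integral do rewrite gee0_abs //.
have dom := integrableD mD (I _ u0 mu' uoo) (I _ v0 mv voo).
apply: (le_integrable mD _ _ dom); first exact/measurable_EFinP.
by move=> x _; rewrite (gee0_abs (adde_ge0 (u0 x) (v0 x))); exact: H.
Qed.

Lemma Rintegral_combination (t u v w : T -> R) (x y : R) :
  (forall p, D p -> t p = x * u p + y * v p + w p) ->
  mu.-integrable D (EFin \o u) -> mu.-integrable D (EFin \o v) ->
  mu.-integrable D (EFin \o w) ->
  \int[mu]_(p in D) t p =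
  x * \int[mu]_(p in D) u p + y * \int[mu]_(p in D) v p + \int[mu]_(p in D) w p.
Proof.
move=> tE iu iv iw.
have -> : \int[mu]_(p in D) t p = \int[mu]_(p in D) (x * u p + y * v p + w p).
  by apply: eq_Rintegral => p; rewrite inE => /tE.
have iZ (z : R) (f : T -> R) : mu.-integrable D (EFin \o f) ->
    mu.-integrable D (EFin \o (fun p => z * f p)).
  by move=> h; have := integrableZl mD z h; apply: eq_integrable => // p _; rewrite /= EFinM.
have iD := integrableD mD (iZ x u iu) (iZ y v iv).
by rewrite RintegralD // ?RintegralD // ?RintegralZl //; exact: iZ.
Qed.

Lemma complex_integral_combination (q : R) (a : R[i]) (t u w : T -> R[i]) :
  (forall p, D p -> t p = a * u p + w p) ->
  mu.-integrable D (EFin \o (fun p => complex.Re (u p))) ->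
  mu.-integrable D (EFin \o (fun p => complex.Im (u p))) ->
  mu.-integrable D (EFin \o (fun p => complex.Re (w p))) ->
  mu.-integrable D (EFin \o (fun p => complex.Im (w p))) ->
  (q * \int[mu]_(p in D) complex.Re (t p)) +i* (q * \int[mu]_(p in D) complex.Im (t p)) =
  a * ((q * \int[mu]_(p in D) complex.Re (u p)) +i* (q * \int[mu]_(p in D) complex.Im (u p))) +
  ((q * \int[mu]_(p in D) complex.Re (w p)) +i* (q * \int[mu]_(p in D) complex.Im (w p))).
Proof.
case: a => x y tE iru iiu irw iiw; apply/eqP; rewrite eq_complex /=.
rewrite (Rintegral_combination (t := fun p => complex.Re (t p)) (x := x) (y := - y) _ iru iiu irw); last first.
  by move=> p /tE ->; rewrite Re_addc Re_mulc /= mulNr.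
rewrite (Rintegral_combination (t := fun p => complex.Im (t p)) (x := x) (y := y) _ iiu iru iiw); last first.
  by move=> p /tE ->; rewrite Im_addc Im_mulc.
by apply/andP; split; apply/eqP; ring.
Qed.

Lemma complex_integral_conj (q : R) (t u : T -> R[i]) : (forall p, t p = (u p)^*) ->
  mu.-integrable D (EFin \o (fun p => complex.Im (u p))) ->
  (q * \int[mu]_(p in D) complex.Re (t p)) +i* (q * \int[mu]_(p in D) complex.Im (t p)) =
  ((q * \int[mu]_(p in D) complex.Re (u p)) +i* (q * \int[mu]_(p in D) complex.Im (u p)))^*.
Proof.
move=> tE iu; apply/eqP; rewrite eq_complex; apply/andP; split; apply/eqP => /=.
  by congr (_ * _); apply: eq_Rintegral => p _; rewrite tE; case: (u p).
rewrite -mulrN; congr (_ * _); rewrite -mulN1r -RintegralZl //.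
by apply: eq_Rintegral => p _; rewrite tE mulN1r; case: (u p).
Qed.

End integral_combinations.

Section dirichlet.
Context {R : realType}.
Local Notation C := R[i].
Local Notation Re := (@complex.Re R).
Local Notation Im := (@complex.Im R).
Local Notation mR := (measurableTypeR R).
Local Notation lebesgue2 := (@lebesgue_measure R \x @lebesgue_measure R)%E.
Local Notation D := (plane_disk : set (mR * mR)).
Local Notation der := complex_derivative.
Implicit Types (f g h : C -> C) (a : C).

Lemma plane_diskP (p : mR * mR) : D p <-> normc (p.1 +i* p.2) < 1.
Proof. exact: diskE. Qed.

Lemma measurable_plane_disk : measurable D.
Proof.
rewrite -[D]setTI (_ : D = (fun p : mR * mR => normc (p.1 +i* p.2)) @^-1` `]-oo, 1[%classic).
  apply: (measurable_normc_comp (D := setT) (f := id)) => //.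
  by move=> p _; exists 1; exact: cdiff_id.
by apply/seteqP; split=> p /=; rewrite in_itv /= => /plane_diskP.
Qed.

Lemma dirichlet_energyE f :
  dirichlet_energy f = ((pi^-1)%:E * \int[lebesgue2]_(p in D) energy_density (der f) p)%E.
Proof. by []. Qed.

Lemma derivative_on_disk f : holomorphic_on_disk f ->
  forall p, D p -> exists l, cdiff (der f) (p.1 +i* p.2) l.
Proof.
by move=> /holomorphic_derivative /holomorphicP h p /plane_diskP /h; eexists; eassumption.
Qed.

Lemma measurable_derivative_density f : holomorphic_on_disk f ->
  measurable_fun D (energy_density (der f)).
Proof. by move=> /derivative_on_disk hf; exact: measurable_energy_density. Qed.

Lemma energy_finite f : dirichlet_space f ->
  (\int[lebesgue2]_(p in D) energy_density (der f) p < +oo)%E.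
Proof.
move=> [_ _ _]; rewrite dirichlet_energyE => h.
have p0 : 0 < pi^-1 :> R by rewrite invr_gt0 pi_gt0.
move: h; have : (0 <= \int[lebesgue2]_(p in D) energy_density (der f) p)%E.
  by apply: integral_ge0 => p _; exact: energy_density_ge0.
case: (\int[_]_(_ in _) _)%E => [r| |] //=; rewrite ?ltry //.
by rewrite mulry gtr0_sg // mul1e.
Qed.

Lemma dirichletP f : dirichlet_space f <-> [/\ holomorphic_on_disk f,
  forall z, ~ disk z -> f z = 0, f 0 = 0 &
  (\int[lebesgue2]_(p in D) energy_density (der f) p < +oo)%E].
Proof.
split=> [hf|[h1 h2 h3 h4]]; first by have := energy_finite hf; case: hf.
split=> //; rewrite dirichlet_energyE; move: h4.
have : (0 <= \int[lebesgue2]_(p in D) energy_density (der f) p)%E.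
  by apply: integral_ge0 => p _; exact: energy_density_ge0.
by case: (\int[_]_(_ in _) _)%E => [r| |] //= _ _; exact: ltry.
Qed.

Lemma derivative_linear a f g z : holomorphic_on_disk f -> holomorphic_on_disk g ->
  normc z < 1 -> cdiff (a *: f + g) z (a * (der f) z + (der g) z).
Proof.
move=> /holomorphicP hf /holomorphicP hg z1.
exact: cdiffD (cdiffMl a (hf z z1)) (hg z z1).
Qed.

Lemma holomorphic_linear a f g : holomorphic_on_disk f -> holomorphic_on_disk g ->
  holomorphic_on_disk (a *: f + g).
Proof.
by move=> hf hg z /diskE z1; apply: cdiff_derivable (derivative_linear a hf hg z1).
Qed.

Lemma derivative_linearE a f g z : holomorphic_on_disk f -> holomorphic_on_disk g ->
  normc z < 1 -> (der (a *: f + g)) z = a * (der f) z + (der g) z.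
Proof. by move=> hf hg z1; apply/cdiff_derivative/derivative_linear. Qed.

Lemma normcD_sqr z w : normc (z + w : C) ^+ 2 <= 2 * normc z ^+ 2 + 2 * normc w ^+ 2.
Proof.
apply: (le_trans (y := (normc z + normc w) ^+ 2)).
  by rewrite lerXn2r ?nnegrE ?normc_ge0 ?normcD // addr_ge0 ?normc_ge0.
rewrite -subr_ge0; have -> : 2 * normc z ^+ 2 + 2 * normc w ^+ 2 - (normc z + normc w) ^+ 2 =
  (normc z - normc w) ^+ 2 by ring.
exact: sqr_ge0.
Qed.

Lemma energy_linear a f g : holomorphic_on_disk f -> holomorphic_on_disk g ->
  (\int[lebesgue2]_(p in D) energy_density (der (a *: f + g)%R) p <=
   (2 * normc a ^+ 2)%:E * \int[lebesgue2]_(p in D) energy_density (der f) p +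
   2%:E * \int[lebesgue2]_(p in D) energy_density (der g) p)%E.
Proof.
move=> hf hg; have mD := measurable_plane_disk.
have mf := measurable_derivative_density hf; have mg := measurable_derivative_density hg.
have a0 : 0 <= 2 * normc a ^+ 2 by rewrite mulr_ge0 ?sqr_ge0.
have mfg := measurable_derivative_density (holomorphic_linear (a := a) hf hg).
apply: (@ge0_le_integral_combination _ _ R lebesgue2 D mD _ _ _ _ _ a0 (ler0n R 2)
  (energy_density_ge0 _) (energy_density_ge0 _) (energy_density_ge0 _) mf mg mfg).
move=> p /plane_diskP hp; rewrite /energy_density derivative_linearE // -!EFinM -EFinD lee_fin.
by apply: le_trans (normcD_sqr _ _) _; rewrite normcM exprMn mulrA.
Qed.

Lemma dirichlet_linear a f g : dirichlet_space f -> dirichlet_space g ->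
  dirichlet_space (a *: f + g).
Proof.
move=> /dirichletP[f1 f2 f3 f4] /dirichletP[g1 g2 g3 g4]; apply/dirichletP; split.
- exact: holomorphic_linear.
- by move=> z hz; rewrite /= !fctE /= f2 // g2 // scaler0 addr0.
- by rewrite /= !fctE /= f3 g3 scaler0 addr0.
apply: le_lt_trans (energy_linear a f1 g1) _; apply: lte_add_pinfty.
  by apply: (lte_mul_pinfty _ _ f4); rewrite // lee_fin mulr_ge0 ?sqr_ge0.
by apply: (lte_mul_pinfty _ _ g4); rewrite // lee_fin.
Qed.

Lemma dirichlet0 : dirichlet_space (0 : C -> C).
Proof.
have h z : cdiff (0 : C -> C) z 0 by exact: cdiff_cst.
apply/dirichletP; split; [by move=> z _; exact: cdiff_derivable (h z)|by []|by []|].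
rewrite integral0_eq ?ltry // => p _; rewrite /energy_density (cdiff_derivative (h _)) normc0.
by rewrite expr0n.
Qed.

Lemma Re_mul_conj (z w : C) : Re (z * w^*) = Re z * Re w + Im z * Im w.
Proof. by case: z; case: w => ? ? ? ? /=; ring. Qed.

Lemma Im_mul_conj (z w : C) : Im (z * w^*) = Im z * Re w - Re z * Im w.
Proof. by case: z; case: w => ? ? ? ? /=; ring. Qed.

Lemma normc_mul_conj (z w : C) : normc (z * w^*) <= normc z ^+ 2 + normc w ^+ 2.
Proof.
rewrite normcM normc_conj; apply: (le_trans (y := 2 * (normc z * normc w))).
  by rewrite ler_peMl ?mulr_ge0 ?normc_ge0 // ler1n.
rewrite -subr_ge0; have -> : normc z ^+ 2 + normc w ^+ 2 - 2 * (normc z * normc w) =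
  (normc z - normc w) ^+ 2 by ring.
exact: sqr_ge0.
Qed.

Lemma product_integrable f g : dirichlet_space f -> dirichlet_space g ->
  lebesgue2.-integrable D (EFin \o fun p => Re ((der f) (p.1 +i* p.2) * ((der g) (p.1 +i* p.2))^*)) /\
  lebesgue2.-integrable D (EFin \o fun p => Im ((der f) (p.1 +i* p.2) * ((der g) (p.1 +i* p.2))^*)).
Proof.
move=> /dirichletP[f1 _ _ f4] /dirichletP[g1 _ _ g4]; have mD := measurable_plane_disk.
have mf := measurable_derivative_density f1; have mg := measurable_derivative_density g1.
have [f'1 f'2] := measurable_Re_comp (derivative_on_disk f1).
have [g'1 g'2] := measurable_Re_comp (derivative_on_disk g1).
split; apply: (@dominated_integrable _ _ R lebesgue2 D mD _ _ _
    (energy_density_ge0 (der f)) (energy_density_ge0 (der g)) mf mg _ f4 g4).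
- have -> : (fun p : mR * mR => Re (der f (p.1 +i* p.2) * (der g (p.1 +i* p.2))^*)) =
    (fun p => Re (der f (p.1 +i* p.2)) * Re (der g (p.1 +i* p.2)) +
              Im (der f (p.1 +i* p.2)) * Im (der g (p.1 +i* p.2))).
    by apply/funext => p; exact: Re_mul_conj.
  exact: (measurable_funD (measurable_funM f'1 g'1) (measurable_funM f'2 g'2)).
- by move=> p; rewrite -EFinD lee_fin; exact: le_trans (Re_le_normc _) (normc_mul_conj _ _).
- have -> : (fun p : mR * mR => Im (der f (p.1 +i* p.2) * (der g (p.1 +i* p.2))^*)) =
    (fun p => Im (der f (p.1 +i* p.2)) * Re (der g (p.1 +i* p.2)) -
              Re (der f (p.1 +i* p.2)) * Im (der g (p.1 +i* p.2))).
    by apply/funext => p; exact: Im_mul_conj.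
  exact: (measurable_funB (measurable_funM f'2 g'1) (measurable_funM f'1 g'2)).
- by move=> p; rewrite -EFinD lee_fin; exact: le_trans (Im_le_normc _) (normc_mul_conj _ _).
Qed.

Lemma dirichlet_ip_linear a f g h :
  dirichlet_space f -> dirichlet_space g -> dirichlet_space h ->
  dirichlet_ip (a *: f + g) h = a * dirichlet_ip f h + dirichlet_ip g h.
Proof.
move=> hf hg hh; have mD := measurable_plane_disk.
have [f1 f2] := product_integrable hf hh; have [g1 g2] := product_integrable hg hh.
have [f0 _ _ _] := hf; have [g0 _ _ _] := hg.
apply: (complex_integral_combination (mu := lebesgue2) mD _ _ f1 f2 g1 g2) => p /plane_diskP hp.
by rewrite derivative_linearE // mulrDl mulrA.
Qed.

Lemma conj_mul_conj (z w : C) : w * z^* = (z * w^*)^*.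
Proof.
by case: z => a b; case: w => c e; apply/eqP; rewrite eq_complex /=; apply/andP; split; apply/eqP; ring.
Qed.

Lemma dirichlet_inner_product : inner_product_on (@dirichlet_space R) dirichlet_ip.
Proof.
split; [exact: dirichlet0|exact: dirichlet_linear|exact: dirichlet_ip_linear| |].
- move=> f g hf hg; have mD := measurable_plane_disk.
  have [_ fg2] := product_integrable hf hg.
  apply: (complex_integral_conj (mu := lebesgue2) mD _ _ fg2) => p.
  exact: conj_mul_conj.
- move=> f hf; rewrite /dirichlet_ip /area_integral /= mulr_ge0 ?invr_ge0 ?pi_ge0 //.
  by apply: Rintegral_ge0 => p _; rewrite Re_conj_mul sqr_ge0.
Qed.

Lemma sqnorm_dirichlet f : dirichlet_space f -> (sqnorm dirichlet_ip f)%:E =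
  ((pi^-1)%:E * \int[lebesgue2]_(p in D) energy_density (der f) p)%E.
Proof.
move=> hf; have h4 := energy_finite hf.
rewrite /sqnorm /dirichlet_ip /area_integral /= EFinM; congr (_ * _)%E.
rewrite /Rintegral fineK; first by apply: eq_integral => p _; rewrite Re_conj_mul.
rewrite ge0_fin_numE; first by under eq_integral do rewrite Re_conj_mul.
by apply: integral_ge0 => p _; rewrite Re_conj_mul lee_fin sqr_ge0.
Qed.

End dirichlet.

(** * Boundedness and decay near 1 *)

Section measure_estimates.
Context {d : measure_display} {T : measurableType d} {R : realType}.
Variables (mu : {measure set T -> \bar R}) (D : set T).
Hypothesis mD : measurable D.
Local Open Scope ereal_scope.

Lemma ge0_integral_le_cst (A : set T) (G : T -> \bar R) (c : \bar R) : measurable A ->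
  measurable_fun A G -> (forall x, 0 <= G x) -> (forall x, A x -> G x <= c) ->
  \int[mu]_(x in A) G x <= c * mu A.
Proof.
move=> mA mG G0 Gc; rewrite -(integral_cst mu mA c).
by apply: ge0_le_integral => // x Ax /=; exact: le_trans (G0 x) (Gc x Ax).
Qed.

(** The regions [W i] may overlap. After the exchange of sum and integral only their weighted
    multiplicity, bounded by [B], matters. *)
Lemma Carleson_sum (e G : T -> \bar R) (E W : nat -> set T) (a : nat -> R) (B : R) :
  measurable_fun D e -> (forall x, 0 <= e x) -> (forall x, 0 <= G x) ->
  (forall i, measurable (E i)) -> trivIset setT E ->
  measurable_fun (\bigcup_i E i) G ->
  (forall i, measurable (W i)) -> (forall i, W i `<=` D) -> (forall i, (0 <= a i)%R) ->
  (forall i, \int[mu]_(x in E i) G x <= (a i)%:E * \int[mu]_(x in W i) e x) ->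
  (forall n x, D x -> (\sum_(i < n) a i * \1_(W i) x <= B)%R) ->
  \int[mu]_(x in \bigcup_i E i) G x <= B%:E * \int[mu]_(x in D) e x.
Proof.
move=> me e0 G0 mE tE mG mW WD a0 H ov.
rewrite (ge0_integral_bigcup mu mE mG (fun x _ => G0 x) tE).
apply: lime_le.
  by apply: is_cvg_nneseries => n _ _; apply: integral_ge0.
apply: nearW => n; rewrite big_mkord.
apply: (le_trans (y := \sum_(i < n) (a i)%:E * \int[mu]_(x in W i) e x)).
  by apply: lee_sum => i _; exact: H.
have B0 x : D x -> (0 <= B)%R.
  by move=> Dx; have := ov 0%N x Dx; rewrite big_ord0.
have -> : \sum_(i < n) (a i)%:E * \int[mu]_(x in W i) e x =
    \int[mu]_(x in D) (\sum_(i < n) (a i * \1_(W i) x)%:E * e x).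
  rewrite ge0_integral_sum //; last 2 first.
  - move=> i; apply: emeasurable_funM => //; apply/measurable_EFinP.
    by apply: measurable_funM => //; exact: measurable_indic.
  - by move=> i x _; rewrite mule_ge0 // lee_fin mulr_ge0.
  apply: eq_bigr => i _.
  have -> : \int[mu]_(x in D) ((a i * \1_(W i) x)%:E * e x) =
      \int[mu]_(x in D) ((a i)%:E * ((\1_(W i) x)%:E * e x)).
    by apply: eq_integral => x _; rewrite EFinM muleA.
  rewrite ge0_integralZl_EFin //; last 2 first.
  - by move=> x _; rewrite mule_ge0 // lee_fin.
  - by apply: emeasurable_funM => //; apply/measurable_EFinP; exact: measurable_indic.
  congr (_ * _); rewrite integral_mkcond [RHS]integral_mkcond; apply: eq_integral => x _.
  rewrite !patchE indicE; case: (boolP (x \in W i)) => xW /=; last first.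
    by rewrite mul0e; case: ifP.
  have -> : x \in D by rewrite inE in xW; rewrite inE; exact: (WD i).
  by rewrite mul1e.
case: (pselect (D !=set0)) => [[y Dy]|D0]; last first.
  have -> : D = set0 by apply/seteqP; split => // x Dx; case: D0; exists x.
  by rewrite !integral_set0 mule0.
rewrite -ge0_integralZl_EFin //; last exact: B0 Dy.
apply: ge0_le_integral => //.
- by move=> x _; apply: sume_ge0 => i _; rewrite mule_ge0 // lee_fin mulr_ge0.
- apply: emeasurable_sum => i; apply: emeasurable_funM => //; apply/measurable_EFinP.
  by apply: measurable_funM => //; exact: measurable_indic.
- exact: measurable_funeM.
move=> x Dx; rewrite -ge0_sume_distrl; last by move=> i _; rewrite lee_fin mulr_ge0.
by rewrite sumEFin lee_wpmul2r // lee_fin; exact: ov.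
Qed.

End measure_estimates.

Section overlap.
Context {R : realType}.
Local Notation C := (@remainder R).

Definition in_annulus m (s : R) := (C m.+1 <= 8 * s) && (s <= 4 * C m).

(** The weights telescope. The first selected index [m] has [C m <= 4 / 3 * C m.+1 <= 32 / 3 * s],
    and the maximum with 0 is the invariant before any index is selected. *)
Lemma sum_weight_window (s : R) M n :
  \sum_(i < n | C (M + i).+1 <= 8 * s) weight (M + i) <= Num.max 0 (32 / 3 * s - C (M + n)).
Proof.
pose P m := C m.+1 <= 8 * s.
change (\sum_(i < n | P (M + i)%N) weight (M + i) <= Num.max 0 (32 / 3 * s - C (M + n))).
elim: n => [|n IH]; first by rewrite big_ord0 le_max lexx.
rewrite big_mkcond big_ord_recr -big_mkcond addnS /= -/(C (M + n).+1).
have [h1 h2] := remainder_step (R := R) (M + n).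
case: ifP => h; last first.
  rewrite addr0; apply: le_trans IH _; rewrite ge_max !le_max lexx.
  by apply/orP; right; rewrite lerD2l lerN2.
rewrite /P in h; rewrite le_max; apply/orP; right.
have E : Num.max 0 (32 / 3 * s - C (M + n)) = 32 / 3 * s - C (M + n).
  by apply/max_idPr; lra.
by rewrite E in IH; have := remainderS (R := R) (M + n); lra.
Qed.

(** One factor [theta] is bounded by [theta M]; the other is at most [4 / s] times a weight, because
    [s <= 4 * C]. The weights in the window add up to [32 / 3 * s], and [128 / 3 <= 43]. *)
Lemma overlap_bound M n (s : R) : 0 < s ->
  \sum_(i < n) (theta (M + i) : R) ^+ 2 * (in_annulus (M + i) s)%:R <= 43 * theta M.
Proof.
move=> s0; have tM := theta_gt0 (R := R) M.
apply: (le_trans (y := \sum_(i < n | C (M + i).+1 <= 8 * s) theta M * (4 / s) * weight (M + i))).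
  rewrite [leRHS]big_mkcond; apply: ler_sum => i _; rewrite /in_annulus.
  case: ifP => h1 /=; last by rewrite mulr0.
  have c0 := weight_gt0 (R := R) (M + i).
  case: (boolP (s <= 4 * C (M + i))) => h2 /=; last first.
    rewrite mulr0; apply: mulr_ge0; last exact: ltW.
    by apply: mulr_ge0; [exact: ltW|rewrite divr_ge0 // ltW].
  rewrite mulr1 expr2 -mulrA; apply: ler_pM; rewrite ?(ltW (theta_gt0 _)) //.
    by apply: theta_decr; exact: leq_addr.
  rewrite mulrAC ler_pdivlMr // /weight.
  have := theta_gt0 (R := R) (M + i); nra.
rewrite -mulr_sumr.
have h := sum_weight_window s M n; have C0 := remainder_gt0 (R := R) (M + n).
have : \sum_(i < n | C (M + i).+1 <= 8 * s) weight (M + i) <= 32 / 3 * s.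
  apply: le_trans h _; rewrite ge_max; apply/andP; split; lra.
move=> h3; apply: le_trans (ler_wpM2l _ h3) _.
  by rewrite mulr_ge0 ?(ltW tM) // divr_ge0 // ltW.
have -> : theta M * (4 / s) * (32 / 3 * s) = 128 / 3 * (theta M : R) by field; rewrite gt_eqF.
by rewrite ler_wpM2r ?(ltW tM) //; lra.
Qed.

End overlap.

Lemma in_itv_cc (R : realType) (x a b : R) : (x \in `[a, b]) = (a <= x <= b).
Proof. by rewrite in_itv. Qed.

(** * Energy estimates on shells around 1 *)

Section Carleson.
#[local] Arguments normc {R} x : simpl never.
#[local] Arguments remainder {R} k : simpl never.
Context {R : realType}.
Local Notation C := R[i].
Local Notation mR := (measurableTypeR R).
Local Notation lebesgue2 := (@lebesgue_measure R \x @lebesgue_measure R)%E.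
Local Notation D := (plane_disk : set (mR * mR)).
Local Notation der := complex_derivative.
Local Notation T := (composition_operator (@symbol R)).
Local Notation Cm := (@remainder R).
Implicit Types (f F : C -> C) (z w : C).

Definition plane_point (p : mR * mR) : C := p.1 +i* p.2.

Lemma T_cdiff f z : holomorphic_on_disk f -> normc z < 1 ->
  cdiff (T f) z (der f (symbol z) * symbol' z).
Proof.
move=> /holomorphicP hf z1; have s1 := le_lt_trans (symbol_le z1) z1.
apply: cdiff_ext (cdiff_comp (cdiff_symbol z1) (hf _ s1)).
exists (1 - normc z); first by rewrite subr_gt0.
move=> h hh; rewrite /composition_operator norm_normc -[1]/(1%:C) ltcR ifT //.
by apply: le_lt_trans (normcD _ _) _; lra.
Qed.

Lemma T_derivative f z : holomorphic_on_disk f -> normc z < 1 ->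
  der (T f) z = der f (symbol z) * symbol' z.
Proof. by move=> hf z1; exact/cdiff_derivative/T_cdiff. Qed.

Lemma T_holomorphic f : holomorphic_on_disk f -> holomorphic_on_disk (T f).
Proof. by move=> hf z /diskE z1; exact: cdiff_derivable (T_cdiff hf z1). Qed.

Lemma measurable_plane_square_area (a : C) (S : R) : 0 < S ->
  lebesgue2 (plane_square a S) = ((2 * S) ^+ 2)%:E.
Proof.
move=> S0; rewrite /plane_square product_measure1E; [|exact: measurable_itv|exact: measurable_itv].
rewrite /= !lebesgue_measure_itv /= !lte_fin !ifT; [|lra|lra].
by rewrite -!EFinB -EFinM; congr EFin; ring.
Qed.

Lemma sub_mean_value_disk F w (S : R) (A : set (mR * mR)) : holomorphic_on_disk F ->
  0 < S -> normc w + 2 * S < 1 -> measurable A -> A `<=` D -> plane_square w S `<=` A ->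
  ((normc (F w) ^+ 2)%:E <=
   (32 / S ^+ 2)%:E * \int[lebesgue2]_(p in A) energy_density F p)%E.
Proof.
move=> hF S0 h mA AD sA.
have H z : in_square w S z -> exists l, cdiff F z l.
  by move=> hz; exists (der F z); exact: (holomorphicP F).1 hF z (disk_square h hz).
apply: le_trans (sub_mean_value_area S0 H) _.
apply: lee_wpmul2l; first by rewrite lee_fin divr_ge0 ?sqr_ge0.
apply: (ge0_subset_integral _ (measurable_plane_square _ _) mA _ _ sA).
  apply: measurable_energy_density => p /AD /plane_diskP hp.
  by exists (der F (p.1 +i* p.2)); exact: (holomorphicP F).1 hF _ hp.
by move=> p _; exact: energy_density_ge0.
Qed.

Definition shell m : set (mR * mR) :=
  D `&` (fun p => normc (1 - plane_point p)) @^-1` `]delta m.+1, delta m]%classic.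
Definition near_part m : set (mR * mR) :=
  D `&` (fun p => normc (1 - plane_point p)) @^-1` `]-oo, delta m]%classic.
Definition far_part m : set (mR * mR) :=
  D `&` (fun p => normc (1 - plane_point p)) @^-1` `]delta m, +oo[%classic.
(* Contains the square of half-side [C m.+1 / 16] around [symbol z], for [z] in [shell m]. *)
Definition window m : set (mR * mR) :=
  D `&` (fun p => 1 - normc (plane_point p)) @^-1` `[Cm m.+1 / 8, 4 * Cm m]%classic.

Lemma measurable_parts m : [/\ measurable (shell m), measurable (near_part m),
  measurable (far_part m) & measurable (window m)].
Proof.
have h1 : measurable_fun D (fun p => normc (1 - plane_point p)).
  apply: (measurable_normc_comp (f := fun z => 1 - z)) => p _.
  by exists (0 - 1); apply: cdiffB; [exact: cdiff_cst|exact: cdiff_id].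
have h2 : measurable_fun D (fun p => 1 - normc (plane_point p)).
  have h : measurable_fun D (fun p => normc (plane_point p)).
    by apply: (measurable_normc_comp (f := id)) => p _; exists 1; exact: cdiff_id.
  exact: (measurable_funB (measurable_cst _) h).
have mD := measurable_plane_disk (R := R).
by split; [apply: h1|apply: h1|apply: h1|apply: h2] => //; exact: measurable_itv.
Qed.

Lemma shellP m p : shell m p <-> [/\ normc (plane_point p) < 1, delta m.+1 < normc (1 - plane_point p) &
  normc (1 - plane_point p) <= delta m].
Proof.
rewrite /shell /= in_itv /=; split.
  by move=> [/plane_diskP h /andP[h1 h2]].
by move=> [h h1 h2]; split; [exact/plane_diskP|apply/andP].
Qed.

Lemma windowP m p : window m p <-> normc (plane_point p) < 1 /\ in_annulus m (1 - normc (plane_point p)).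
Proof.
rewrite /window /in_annulus; split.
  move=> [/plane_diskP h1]; rewrite /preimage /mkset in_itv_cc => /andP[h2 h3].
  by split => //; rewrite mulrC -ler_pdivrMr // h2 h3.
move=> [h1 /andP[h2 h3]]; split; first exact/plane_diskP.
by rewrite /preimage /mkset in_itv_cc h3 andbT ler_pdivrMr // mulrC.
Qed.

(** The factors come from the bound on [symbol'], the mean value inequality with half-side [C / 16],
    the area of a square containing the shell, and [weight m / C m.+1 <= 4 / 3 * theta m]. *)
Definition shell_constant : R := 20 ^+ 2 * (32 * 16 ^+ 2) * 2 ^+ 2 * (4 / 3) ^+ 2.

Lemma shell_constant_gt0 : 0 < shell_constant.
Proof. by rewrite /shell_constant !mulr_gt0 ?exprn_gt0. Qed.

Lemma shell_constantE m :
  (20 * (weight m / delta m)) ^+ 2 * (32 / (Cm m.+1 / 16) ^+ 2) * (2 * delta m) ^+ 2 <=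
  shell_constant * theta m ^+ 2.
Proof.
have d0 := delta_gt0 (R := R) m; have C0 := remainder_gt0 (R := R) m.+1.
have c0 := weight_gt0 (R := R) m; have t0 := theta_gt0 (R := R) m.
have [h _] := remainder_step (R := R) m.
have hc : weight m / Cm m.+1 <= 4 / 3 * theta m.
  by rewrite ler_pdivrMr // /weight; nra.
have E (c e C' : R) : e != 0 -> C' != 0 ->
   (20 * (c / e)) ^+ 2 * (32 / (C' / 16) ^+ 2) * (2 * e) ^+ 2 =
   20 ^+ 2 * (32 * 16 ^+ 2) * 2 ^+ 2 * (c / C') ^+ 2.
  by move=> e0 c'0; field; rewrite e0 c'0.
rewrite E ?gt_eqF // /shell_constant -[leRHS]mulrA -exprMn.
apply: ler_wpM2l; first by rewrite !mulr_ge0 ?exprn_ge0.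
apply: lerXn2r hc; rewrite nnegrE; first by rewrite divr_ge0 // ltW.
by apply: mulr_ge0; [exact: divr_ge0|exact: ltW].
Qed.

(** Points of the square are within [C m.+1 / 8] of its centre, half of the guaranteed distance from
    the centre to the circle. *)
Lemma annulus_square z w m : normc z < 1 -> normc w <= 1 - Cm m.+1 / 4 ->
  normc (1 - w) <= 3 * Cm m -> plane_square w (Cm m.+1 / 16) `<=` window m.
Proof.
move=> z1 h1 h2 p /plane_squareP /normc_in_square; rewrite -/(plane_point p) => h3.
have C0 := remainder_gt0 (R := R) m.+1; have [_ C1] := remainder_step (R := R) m.
have k1 := normcD (plane_point p - w) w; rewrite subrK in k1.
have k2 := normcD (1 - w) (w - plane_point p); rewrite subrKA in k2.
have k3 := normcD (1 - plane_point p) (plane_point p); rewrite subrK normc1 in k3.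
rewrite normc_dist in h3; rewrite [X in _ <= X + _]normc_dist in k1.
apply/windowP; split; first lra.
by rewrite /in_annulus; apply/andP; split; lra.
Qed.

Lemma energy_T f p : holomorphic_on_disk f -> normc (plane_point p) < 1 ->
  energy_density (der (T f)) p =
  ((normc (symbol' (plane_point p)) ^+ 2)%:E * (normc (der f (symbol (plane_point p))) ^+ 2)%:E)%E.
Proof.
move=> hf p1; rewrite /energy_density -/(plane_point p) T_derivative // normcM exprMn -EFinM mulrC //.
Qed.

Lemma shell_pointwise f m p : holomorphic_on_disk f -> shell m p ->
  (energy_density (der (T f)) p <= ((20 * (weight m / delta m)) ^+ 2)%:E *
    ((32 / (Cm m.+1 / 16) ^+ 2)%:E * \int[lebesgue2]_(p in window m) energy_density (der f) p))%E.
Proof.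
move=> hf /shellP[p1 h1 h2]; rewrite [leLHS](energy_T hf p1).
have C0 := remainder_gt0 (R := R) m.+1; have [_ _ _ mW] := measurable_parts m.
have k1 := symbol_far p1 (ltW h1); have k2 := symbol_near p1 h2.
apply: lee_pmul; rewrite ?lee_fin ?sqr_ge0 //.
  rewrite lerXn2r ?nnegrE ?normc_ge0 //; last exact: symbol'_shell (ltW h1).
  by apply: mulr_ge0 => //; apply: divr_ge0; apply: ltW; [exact: weight_gt0|exact: delta_gt0].
apply: (sub_mean_value_disk (F := der f) (w := symbol (plane_point p)) (S := Cm m.+1 / 16)
  (holomorphic_derivative hf) _ _ mW (@subIsetl _ _ _) (annulus_square p1 k1 k2)).
  by rewrite divr_gt0.
lra.
Qed.

(** The pointwise bound has order [(c / (delta * C)) ^ 2] and the shell has area of order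
    [delta ^ 2]. The [delta m] cancel and leave [theta m ^ 2]. *)
Lemma shell_estimate f m : holomorphic_on_disk f ->
  (\int[lebesgue2]_(p in shell m) energy_density (der (T f)) p <=
   (shell_constant * theta m ^+ 2)%:E *
   \int[lebesgue2]_(p in window m) energy_density (der f) p)%E.
Proof.
move=> hf; have [mS _ _ mW] := measurable_parts m.
have mG : measurable_fun (shell m) (energy_density (der (T f))).
  have mD := measurable_derivative_density (T_holomorphic hf).
  exact: (measurable_funS measurable_plane_disk (@subIsetl _ _ _) mD).
set J := (\int[_]_(_ in window m) _)%E.
have J0 : (0 <= J)%E by apply: integral_ge0 => p _; exact: energy_density_ge0.
apply: le_trans (ge0_integral_le_cst lebesgue2 mS mG (energy_density_ge0 _)
  (fun p hp => shell_pointwise hf hp)) _.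
have mu : (lebesgue2 (shell m) <= ((2 * delta m) ^+ 2)%:E)%E.
  rewrite -(measurable_plane_square_area 1 (delta_gt0 m)).
  apply: le_measure; rewrite ?inE //; first exact: measurable_plane_square.
  move=> p /shellP[_ _ h]; apply/plane_squareP/in_square_normc.
  by rewrite normc_dist.
apply: le_trans (lee_pmul _ _ (lexx _) mu) _ => //.
  by rewrite !mule_ge0 // lee_fin ?sqr_ge0 // divr_ge0 ?sqr_ge0.
rewrite -/J muleA -EFinM muleAC -EFinM lee_wpmul2r // lee_fin.
exact: shell_constantE.
Qed.

Lemma near_partE M : near_part M = \bigcup_i shell (M + i).
Proof.
apply/seteqP; split=> p.
  move=> [/plane_diskP p1 /=]; rewrite in_itv /= => h.
  have r0 : 0 < normc (1 - plane_point p).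
    by apply: lt_le_trans (Re_lt1 p1) _; apply: le_trans (Re_le_normc _); exact: ler_norm.
  have ex : exists n, delta (M + n).+1 < normc (1 - plane_point p).
    have [n hn] := exponential_beats_power (R := R) 0 ((normc (1 - plane_point p))^-1 + 1).
    exists n; rewrite -[ltRHS]invrK ltf_pV2 ?posrE ?invr_gt0 ?exprn_gt0 //.
    rewrite expr0 mulr1 in hn; apply: (lt_le_trans (y := 2 ^+ n)); first lra.
    apply: (le_trans (y := 4 ^+ n)); first by rewrite lerXn2r ?nnegrE // ler_nat.
    by apply: ler_weXn2l; [rewrite ler1n|lia].
  case: (ex_minnP ex) => n hn mn; exists n => //; apply/shellP; split => //.
  case: n hn mn => [|n] hn mn; first by rewrite addn0.
  by rewrite leNgt addnS; apply/negP => /mn; rewrite ltnn.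
move=> [n _ /shellP[p1 h1 h2]]; split; first exact/plane_diskP.
by rewrite /= in_itv /=; apply: le_trans h2 _; apply: delta_decr; exact: leq_addr.
Qed.

Lemma shell_disjoint M : trivIset setT (fun i => shell (M + i)).
Proof.
apply/trivIsetP => i j _ _ ij; wlog : i j ij / (i < j)%N.
  move=> H; have [h|h|h] := ltngtP i j; [exact: H|rewrite setIC; apply: H => //|].
    by rewrite eq_sym.
  by rewrite h eqxx in ij.
move=> lij; apply/seteqP; split=> // p [/shellP[_ h1 _] /shellP[_ _ h2]].
have : delta (M + j) <= delta (M + i).+1 :> R by apply: delta_decr; lia.
by move=> h3; have := lt_le_trans h1 (le_trans h2 h3); rewrite ltxx.
Qed.

(** It serves twice: with [M = 0] for boundedness, and with [M] large, where [theta M] is small, for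
    compactness. *)
Lemma near_estimate f M : holomorphic_on_disk f ->
  (\int[lebesgue2]_(p in near_part M) energy_density (der (T f)) p <=
   (shell_constant * (43 * theta M))%:E *
   \int[lebesgue2]_(p in D) energy_density (der f) p)%E.
Proof.
move=> hf; have [_ mN _ _] := measurable_parts M.
have mG : measurable_fun (near_part M) (energy_density (der (T f))).
  have mD := measurable_derivative_density (T_holomorphic hf).
  exact: (measurable_funS measurable_plane_disk (@subIsetl _ _ _) mD).
rewrite near_partE in mG *.
refine (@Carleson_sum _ _ R lebesgue2 D measurable_plane_disk (energy_density (der f))
  (energy_density (der (T f))) (fun i => shell (M + i)) (fun i => window (M + i))
  (fun i => shell_constant * theta (M + i) ^+ 2) _
  (measurable_derivative_density hf) (energy_density_ge0 _) (energy_density_ge0 _)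
  _ (@shell_disjoint M) mG _ _ _ _ _).
- by move=> i; have [] := measurable_parts (M + i).
- by move=> i; have [] := measurable_parts (M + i).
- by move=> i p [].
- by move=> i; rewrite mulr_ge0 ?sqr_ge0 // ltW // shell_constant_gt0.
- by move=> i; exact: shell_estimate.
move=> n p /plane_diskP p1.
have s0 : 0 < 1 - normc (plane_point p) by rewrite subr_gt0.
apply: le_trans (ler_wpM2l (ltW shell_constant_gt0) (overlap_bound M n s0)).
rewrite mulr_sumr; apply: ler_sum => i _; rewrite -mulrA indicE.
have -> : (p \in window (M + i)) = in_annulus (M + i) (1 - normc (plane_point p)).
  apply/idP/idP; first by rewrite inE => /windowP[].
  by move=> h; rewrite inE; exact/windowP.
by [].
Qed.

(** Away from 1 the symbol stays in a smaller disk, where derivatives are controlled by the energy.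
    The constant blows up with [M] but is uniform in the point. *)
Lemma far_pointwise f M p : holomorphic_on_disk f -> far_part M p ->
  (energy_density (der (T f)) p <= ((2 / delta M ^+ 2) ^+ 2 * (32 / (Cm M / 16) ^+ 2))%:E *
    \int[lebesgue2]_(p in D) energy_density (der f) p)%E.
Proof.
move=> hf [/plane_diskP p1 /=]; rewrite in_itv /= andbT => h; rewrite [leLHS](energy_T hf p1).
have C0 := remainder_gt0 (R := R) M; have d0 := delta_gt0 (R := R) M.
have k1 := symbol_far p1 (ltW h).
rewrite (EFinM ((2 / delta M ^+ 2) ^+ 2)) -muleA; apply: lee_pmul; rewrite ?lee_fin ?sqr_ge0 //.
  apply: lerXn2r; [exact: normc_ge0|by rewrite nnegrE divr_ge0 // sqr_ge0|].
  apply: le_trans (symbol'_le p1) _; rewrite ler_pM2l // lef_pV2 ?posrE ?exprn_gt0 //.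
    by rewrite lerXn2r ?nnegrE ?normc_ge0 ?(ltW d0) ?(ltW h).
  exact: lt_trans h.
apply: (sub_mean_value_disk (F := der f) (w := symbol (plane_point p)) (S := Cm M / 16)
  (holomorphic_derivative hf) _ _ measurable_plane_disk (@subset_refl _ _)).
- by rewrite divr_gt0.
- lra.
by move=> q /plane_squareP hq; apply/plane_diskP; apply: disk_square hq; lra.
Qed.

Lemma far_area M : (lebesgue2 (far_part M) < +oo)%E.
Proof.
have [_ _ mF _] := measurable_parts M.
apply: (@le_lt_trans _ _ (lebesgue2 (plane_square (0 : C) 1))); last first.
  by rewrite measurable_plane_square_area // ltry.
apply: le_measure; rewrite ?inE //; first exact: measurable_plane_square.
move=> p [/plane_diskP p1 _]; apply/plane_squareP/in_square_normc.
by rewrite subr0 ltW.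
Qed.

Lemma near_far_split f M : holomorphic_on_disk f ->
  (\int[lebesgue2]_(p in D) energy_density (der (T f)) p =
   \int[lebesgue2]_(p in near_part M) energy_density (der (T f)) p +
   \int[lebesgue2]_(p in far_part M) energy_density (der (T f)) p)%E.
Proof.
move=> hf; have [_ mN mF _] := measurable_parts M.
have E : D = near_part M `|` far_part M.
  apply/seteqP; split=> [p Dp|p [[]|[]] //].
  have [h|h] := leP (normc (1 - plane_point p)) (delta M); [left|right]; split => //=;
    by rewrite in_itv /= ?andbT.
rewrite {1}E (ge0_integral_setU lebesgue2 mN mF) //.
- by have mT := measurable_derivative_density (T_holomorphic hf); rewrite E in mT.
- by move=> p _; exact: energy_density_ge0.
- apply/disj_setPS => p [[_ h1] [_ h2]]; move: h1 h2; rewrite /= !in_itv /= andbT => h1 h2.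
  by have := le_lt_trans h1 h2; rewrite ltxx.
Qed.

End Carleson.

(** * Compactness *)

Section limits_of_integrals.
Context {d : measure_display} {T : measurableType d} {R : realType}.
Variables (mu : {measure set T -> \bar R}) (A : set T).
Hypothesis mA : measurable A.
Implicit Types (g : nat -> T -> R).

Definition converges_at g (l : T -> R) x :=
  forall e : R, 0 < e -> exists N, forall n, (N <= n)%N -> `|g n x - l x| <= e.

Lemma converges_at_cvg g l x : converges_at g l x ->
  (fun n => (g n x)%:E) @ \oo --> (l x)%:E.
Proof.
move=> h; apply: cvg_EFin; first exact: nearW.
apply/cvgrPdist_le => e e0; have [N hN] := h e e0.
by exists N => // n /= Nn; rewrite distrC; exact: hN.
Qed.

Lemma fatou_bound g (l : T -> R) (Q : \bar R) :
  (forall n, measurable_fun A (g n)) -> (forall n x, 0 <= g n x) ->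
  (forall x, A x -> converges_at g l x) ->
  (forall n, \int[mu]_(x in A) (g n x)%:E <= Q)%E ->
  (\int[mu]_(x in A) (l x)%:E <= Q)%E.
Proof.
move=> mg g0 gl gQ.
have := @fatou _ T R mu A mA (fun n x => (g n x)%:E)
  (fun n => (measurable_EFinP A (g n)).2 (mg n)) (fun n x _ => g0 n x).
have -> : (\int[mu]_(x in A) limn_einf (fun n => (g n x)%:E) = \int[mu]_(x in A) (l x)%:E)%E.
  apply: eq_integral => x; rewrite inE => Ax.
  by have [-> _] := cvg_limn_einf_sup (converges_at_cvg (gl x Ax)).
move=> h; apply: (le_trans h); rewrite limn_einf_lim; apply: lime_le.
  exact: is_cvg_einfs.
apply: nearW => n; apply: le_trans (gQ n).
by apply: ereal_inf_lbound; exists n => /=.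
Qed.

Lemma bounded_convergence g (c : R) :
  (mu A < +oo)%E -> (forall n, measurable_fun A (g n)) -> (forall n x, 0 <= g n x) ->
  (forall n x, A x -> g n x <= c) -> (forall x, A x -> converges_at g (fun=> 0) x) ->
  forall e : R, 0 < e -> exists N, forall n, (N <= n)%N ->
  (\int[mu]_(x in A) (g n x)%:E <= e%:E)%E.
Proof.
move=> muA mg g0 gc gl e e0.
have ic : mu.-integrable A (fun=> c%:E).
  apply/integrableP; split; first exact: measurable_cst.
  by rewrite (integral_cst mu mA) lte_mul_pinfty.
have dom x n : A x -> (`|(g n x)%:E| <= c%:E)%E.
  by move=> Ax; rewrite /= lee_fin ger0_norm // gc.
have [_ _] := @dominated_convergence _ T R mu A mA (fun n x => (g n x)%:E) (fun=> 0%:E)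
  (fun=> c%:E) (fun n => (measurable_EFinP A (g n)).2 (mg n)) (measurable_cst _)
  (aeW mu (fun x Ax => converges_at_cvg (gl x Ax))) ic (aeW mu (fun x n => dom x n)).
rewrite integral0 => /fine_cvgP[[N1 _ h1] /cvgrPdist_le /(_ e e0)[N2 _ h2]].
exists (N1 + N2)%N => n Nn.
have {}h1 := h1 n (leq_trans (leq_addr _ _) Nn).
have := h2 n (leq_trans (leq_addl _ _) Nn); rewrite /= sub0r normrN => h3.
by rewrite -[leLHS](fineK h1) lee_fin; apply: le_trans (ler_norm _) h3.
Qed.

End limits_of_integrals.

Section cluster.
Context {R : realType}.

(* The limit is taken along an ultrafilter, which spares the diagonal extraction. *)
Lemma bounded_cluster_real (X : eqType) (v : nat -> X -> R) (B : X -> R) :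
  (forall n x, `|v n x| <= B x) -> exists l : X -> R,
  forall (s : seq X) (e : R) N, 0 < e ->
  exists2 n, (N <= n)%N & forall x, x \in s -> `|v n x - l x| <= e.
Proof.
move=> vB; have [U [UU sU]] := ultraFilterLemma (eventually_filter : ProperFilter \oo).
have PU : ProperFilter U := @ultra_proper _ _ UU.
have lim x : exists p : R, forall e : R, 0 < e -> U [set n | `|v n x - p| <= e].
  have [|p [_ hp]] := @segment_compact R (- B x) (B x) ((v^~ x) @ U) (fmap_proper_filter _ PU).
    by apply: (filterS (F := U)) (filterT : U setT) => n _ /=; rewrite in_itv /= -ler_norml.
  exists p => e e0; have [//|h] := in_ultra_setVsetC [set n | `|v n x - p| <= e] UU.
  have := hp [set y | ~ (`|y - p| <= e)] [set y | `|y - p| <= e] h _.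
  case; last by move=> y [].
  by apply/nbhs_ballP; exists e => // y /=; rewrite /ball /= distrC => /ltW.
have [l hl] := choice lim.
exists l => s e N e0.
suff : U [set n | (N <= n)%N /\ forall x, x \in s -> `|v n x - l x| <= e].
  by move=> /filter_ex[n [h1 h2]]; exists n.
elim: s => [|x s IH].
  by apply: sU; exists N => // n /= Nn.
apply: filterS (filterI (hl x e e0) IH) => n [h1 [h2 h3]]; split => // y.
by rewrite inE => /orP[/eqP ->|/h3].
Qed.

Lemma bounded_cluster (X : eqType) (v : nat -> X -> R[i]) (B : X -> R) :
  (forall n x, normc (v n x) <= B x) -> exists l : X -> R[i],
  forall (s : seq X) (e : R) N, 0 < e ->
  exists2 n, (N <= n)%N & forall x, x \in s -> normc (v n x - l x) <= e.
Proof.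
move=> vB; pose w n (y : bool * X) := if y.1 then complex.Re (v n y.2) else complex.Im (v n y.2).
have [|l hl] := @bounded_cluster_real _ w (fun y => B y.2).
  by move=> n [[] x] /=; apply: le_trans (vB n x); [exact: Re_le_normc|exact: Im_le_normc].
exists (fun x => l (true, x) +i* l (false, x)) => s e N e0.
have [|n Nn hn] := hl ([seq (true, x) | x <- s] ++ [seq (false, x) | x <- s]) (e / 2) N.
  by rewrite divr_gt0.
exists n => // x xs; apply: le_trans (normc_le _) _.
have h1 := hn (true, x); have h2 := hn (false, x).
have {h1} : `|w n (true, x) - l (true, x)| <= e / 2.
  by apply: h1; rewrite mem_cat map_f.
have {h2} : `|w n (false, x) - l (false, x)| <= e / 2.
  by apply: h2; rewrite mem_cat map_f // orbT.
rewrite /w /=; case: (v n x) => a b /= k1 k2; lra.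
Qed.

Lemma increasing_choice (P : nat -> nat -> Prop) :
  (forall j N, exists2 n, (N <= n)%N & P j n) ->
  exists k : nat -> nat, {homo k : m n / (m < n)%N} /\ forall j, P j (k j).
Proof.
move=> H; have /choice[g hg] : forall x : nat * nat, exists n, (x.2 <= n)%N /\ P x.1 n.
  by move=> [j N]; have [n h1 h2] := H j N; exists n.
pose k := fix k j := if j is i.+1 then g (i.+1, (k i).+1) else g (0, 0)%N.
exists k; split.
  apply: homo_ltn => [y x z|i]; first exact: ltn_trans.
  by have [] := hg (i.+1, (k i).+1).
by case=> [|i]; [have [] := hg (0, 0)%N|have [] := hg (i.+1, (k i).+1)].
Qed.

Lemma quadratic_cdiff (f : R[i] -> R[i]) z l (K r : R) : 0 < r -> 0 <= K ->
  (forall h, normc h <= r -> normc (f (z + h) - f z - l * h) <= K * normc h ^+ 2) -> cdiff f z l.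
Proof.
move=> r0 K0 H e e0; exists (Num.min r (e / (K + 1))).
  by rewrite lt_min r0 divr_gt0 // ltr_pwDr.
move=> h; rewrite lt_min => /andP[h1 h2]; apply: le_trans (H h (ltW h1)) _.
rewrite expr2 mulrA ler_wpM2r ?normc_ge0 //.
rewrite ltr_pdivlMr ?ltr_pwDr // in h2; have := normc_ge0 h; nra.
Qed.

End cluster.

Lemma normc_perturb (R : realType) (x y x' y' : R[i]) :
  normc (x' - y') <= normc (x - y) + normc (x - x') + normc (y - y').
Proof.
rewrite (_ : x' - y' = x - y - (x - x') + (y - y')); last by ring.
by apply: le_trans (normcD _ _) _; apply: lerD => //; exact: normcB.
Qed.

Lemma converges_normc_sqr (R : realType) (a : nat -> R[i]) (b : R[i]) :
  (forall e : R, 0 < e -> exists J, forall j, (J <= j)%N -> normc (a j - b) <= e) ->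
  forall e : R, 0 < e ->
  exists J, forall j, (J <= j)%N -> `|normc (a j) ^+ 2 - normc b ^+ 2| <= e.
Proof.
move=> H e e0; have B0 := normc_ge0 b.
have [|J hJ] := H (Num.min 1 (e / (2 * normc b + 1))).
  by rewrite lt_min ltr01 divr_gt0 // ltr_pwDr // mulr_ge0.
exists J => n /hJ; rewrite le_min => /andP[h1 h2].
rewrite ler_pdivlMr ?ltr_pwDr ?mulr_ge0 // in h2.
have a1 := normcD (a n - b) b; rewrite subrK in a1.
have a2 := normcB (a n) (a n - b); rewrite subKr in a2.
have a3 := normc_ge0 (a n).
rewrite subr_sqr normrM; apply: le_trans h2; apply: ler_pM => //.
  by rewrite ler_norml; apply/andP; split; lra.
by rewrite ger0_norm ?addr_ge0 //; lra.
Qed.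

Lemma le_third (R : realType) (K t e : R) :
  0 <= K -> 0 < t -> t * (6 * (K + 1)) <= e -> K * (2 * t) <= e / 3.
Proof. by move=> *; nra. Qed.

Lemma add_thirds (R : realType) (a b e : R) : a <= e / 3 -> b <= e / 3 -> a + (b + a) <= e.
Proof. by move=> *; lra. Qed.

(** * Normal families in the Dirichlet space *)

Section Montel.
Context {R : realType}.
Local Notation C := R[i].
Local Notation mR := (measurableTypeR R).
Local Notation lebesgue2 := (@lebesgue_measure R \x @lebesgue_measure R)%E.
Local Notation D := (plane_disk : set (mR * mR)).
Local Notation der := complex_derivative.
#[local] Arguments normc {R} x : simpl never.
Variables (u : nat -> C -> C) (Q : R).
Hypotheses (uD : forall n, dirichlet_space (u n))
  (uQ : forall n, (\int[lebesgue2]_(p in D) energy_density (der (u n)) p <= Q%:E)%E).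

Let hol n : holomorphic_on_disk (u n). Proof. by have [] := uD n. Qed.

Let Q0 : 0 <= Q.
Proof.
rewrite -lee_fin; apply: le_trans (uQ 0%N).
by apply: integral_ge0 => p _; exact: energy_density_ge0.
Qed.

(** The constant is [32 * 4 ^ 2], from squares of half-side [(1 - r) / 4]. *)
Let A : R := Num.sqrt (512%:R * Q).
Let A0 : 0 <= A. Proof. exact: sqrtr_ge0. Qed.
Let A2 : A ^+ 2 = 512%:R * Q. Proof. exact: (sqr_sqrtr (mulr_ge0 (ler0n R 512) Q0)). Qed.

Lemma derivative_bounded n w (r : R) : normc w <= r -> r < 1 -> normc (der (u n) w) <= A / (1 - r).
Proof.
move=> wr r1; have r0 := le_trans (normc_ge0 w) wr.
have S0 : 0 < (1 - r) / 4 by lra.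
have H := sub_mean_value_disk (F := der (u n)) (w := w) (S := (1 - r) / 4)
  (holomorphic_derivative (@hol n)) S0 _ measurable_plane_disk (@subset_refl _ _).
have {}H : ((normc (der (u n) w) ^+ 2)%:E <= (32 / ((1 - r) / 4) ^+ 2)%:E * Q%:E)%E.
  apply: le_trans (H _ _) _; first lra.
    by move=> q /plane_squareP hq; apply/plane_diskP; apply: disk_square hq; lra.
  by apply: lee_wpmul2l (uQ n); rewrite lee_fin divr_ge0 // sqr_ge0.
rewrite -EFinM lee_fin in H.
rewrite -(@ler_pXn2r R 2) // ?nnegrE ?normc_ge0 ?divr_ge0 //; last lra.
apply: (le_trans H); have -> : (A / (1 - r)) ^+ 2 = 512%:R * Q / (1 - r) ^+ 2.
  by rewrite expr_div_n A2.
have e0 : 1 - r != 0 by rewrite gt_eqF // subr_gt0.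
by rewrite le_eqVlt; apply/orP; left; apply/eqP; field.
Qed.

Lemma value_bounded n w (r : R) : normc w <= r -> r < 1 -> normc (u n w) <= 2 * (A / (1 - r)).
Proof.
move=> wr r1; have r0 := le_trans (normc_ge0 w) wr.
have [_ _ u0 _] := uD n.
have inr (t : R) : 0 <= t <= 1 -> normc (0 + t%:C * w) <= r.
  move=> /andP[t0 t1]; rewrite add0r normcM normc_real ger0_norm //.
  by apply: le_trans wr; rewrite ler_piMl ?normc_ge0.
have H := @mean_value_inequality R (u n) (der (u n)) 0 w (A / (1 - r)).
have {}H := H (fun t ht => (holomorphicP (u n)).1 (@hol n) _ (le_lt_trans (inr t ht) r1))
  (fun t ht => derivative_bounded n (inr t ht) r1).
rewrite add0r u0 subr0 in H; apply: (le_trans H).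
rewrite ler_pM2l // ler_piMr ?divr_ge0 //; last exact: le_trans wr (ltW r1).
by rewrite subr_ge0 ltW.
Qed.

(** Values and derivatives are followed together, so that one cluster point provides both the limit
    function and its candidate derivative. *)
Let v n (y : (bool * C)%type) : C :=
  if normc y.2 < 1 then if y.1 then u n y.2 else der (u n) y.2 else 0.

Let vB n y : normc (v n y) <= if normc y.2 < 1 then 2 * (A / (1 - normc y.2)) else 0.
Proof.
rewrite /v; case: ifP => [y1|_]; last by rewrite normc0.
case: ifP => _; first exact: value_bounded.
apply: le_trans (derivative_bounded n (lexx _) y1) _.
by rewrite ler_peMl ?ler1n // divr_ge0 // subr_ge0 ltW.
Qed.

Section limit.
Variable l : bool * C -> C.
Hypothesis hl : forall (s : seq (bool * C)) (e : R) N, 0 < e ->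
  exists2 n, (N <= n)%N & forall x, x \in s -> normc (v n x - l x) <= e.

Let L z := if normc z < 1 then l (true, z) else 0.
Let L' z := l (false, z).

(** The Taylor and Lipschitz bounds have constants independent of [n], and each involves at most
    three points. Approximation on finite sets of points therefore carries them to the cluster
    values. *)
Lemma limit_Taylor z h : normc z < 1 -> normc h <= (1 - normc z) / 16 ->
  let S := (1 - normc z) / 4 in let M := 2 * (A / (1 - (1 + normc z) / 2)) in
  normc (L (z + h) - L z - L' z * h) <= 512 * M / S ^+ 2 * normc h ^+ 2 /\
  normc (L' (z + h) - L' z) <= 256 * M / S ^+ 2 * normc h /\
  forall n, normc (der (u n) (z + h) - der (u n) z) <= 256 * M / S ^+ 2 * normc h.
Proof.
move=> z1 hh S M; have S0 : 0 < S by rewrite /S; lra.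
have z0 := normc_ge0 z.
have sq w : in_square z S w -> normc w <= (1 + normc z) / 2.
  move=> /normc_in_square k; have := normcD (w - z) z; rewrite subrK => k'.
  by rewrite /S in k; lra.
have dsk w : in_square z S w -> normc w < 1 by move=> /sq k; lra.
have hf n w : in_square z S w -> cdiff (u n) w (der (u n) w).
  by move=> /dsk k; exact: (holomorphicP (u n)).1 (@hol n) w k.
have hM n w : in_square z S w -> normc (u n w) <= M.
  by move=> /sq k; apply: value_bounded k _; lra.
have i0 : in_square z (S / 4) z by apply: in_square_normc; rewrite subrr normc0 divr_ge0 // ltW.
have ih : in_square z (S / 4) (z + h).
  by apply: in_square_normc; rewrite addrAC subrr add0r /S; lra.
have T n := Taylor_on_square S0 (hf n) (hM n) i0 ih.
have T' n := derivative_lipschitz S0 (hf n) (hM n) i0 ih.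
have zh1 : normc (z + h) < 1 by apply: le_lt_trans (normcD _ _) _; lra.
split; last split => //.
  (* Two values are approximated, and one derivative multiplied by [h], hence the divisor
     [2 + normc h]. *)
  apply/ler_addgt0Pr => e e0; pose e' := e / (2 + normc h).
  have h0 := normc_ge0 h; have e'0 : 0 < e' by rewrite divr_gt0 // ltr_pwDl.
  have [n _ hn] := hl [:: (true, z); (true, z + h); (false, z)] 0 e'0.
  have k1 := hn (true, z); have k2 := hn (true, z + h); have k3 := hn (false, z).
  rewrite /v /= z1 !inE eqxx in k1; rewrite /v /= zh1 !inE eqxx !orbT in k2.
  rewrite /v /= z1 !inE eqxx !orbT in k3.
  have {}k1 := k1 isT; have {}k2 := k2 isT; have {}k3 := k3 isT.
  rewrite /L z1 zh1.
  rewrite (_ : _ - _ = (u n (z + h) - u n z - der (u n) z * h) - (u n (z + h) - l (true, z + h))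
     + (u n z - l (true, z)) + (der (u n) z - l (false, z)) * h); last by rewrite /L'; ring.
  apply: le_trans (normcD _ _) _; rewrite normcM.
  apply: le_trans (lerD (normcD _ _) (lexx _)) _.
  apply: le_trans (lerD (lerD (normcB _ _) (lexx _)) (lexx _)) _.
  have := T n; have : e' * (2 + normc h) = e by rewrite /e' divfK // gt_eqF // ltr_pwDl.
  have : normc (der (u n) z - l (false, z)) * normc h <= e' * normc h by rewrite ler_wpM2r.
  lra.
apply/ler_addgt0Pr => e e0; have e'0 : 0 < e / 2 by rewrite divr_gt0.
have [n _ hn] := hl [:: (false, z); (false, z + h)] 0 e'0.
have k1 := hn (false, z); have k2 := hn (false, z + h).
rewrite /v /= z1 !inE eqxx in k1; rewrite /v /= zh1 !inE eqxx !orbT in k2.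
have {}k1 := k1 isT; have {}k2 := k2 isT.
apply: le_trans (normc_perturb (der (u n) (z + h)) (der (u n) z) _ _) _.
have := T' n; lra.
Qed.

Lemma limit_cdiff z : normc z < 1 -> cdiff L z (L' z).
Proof.
move=> z1; pose M := 2 * (A / (1 - (1 + normc z) / 2)).
apply: (quadratic_cdiff (r := (1 - normc z) / 16) (K := 512%:R * M / ((1 - normc z) / 4) ^+ 2)).
- by lra.
- apply: (coef_ge0 512); last exact: sqr_ge0.
  by rewrite mulr_ge0 // divr_ge0 //; lra.
- by move=> h hh; have [h1 _] := limit_Taylor z1 hh; exact: h1.
Qed.

Lemma limit_derivative z : normc z < 1 -> der L z = L' z.
Proof. by move=> /limit_cdiff; exact: cdiff_derivative. Qed.

Lemma limit0 : L 0 = 0.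
Proof.
rewrite /L normc0 ltr01; apply/eqP; rewrite -normc_eq0; apply/eqP/le_anti.
rewrite normc_ge0 andbT; apply/ler_addgt0Pr => e e0; rewrite add0r.
have [n _ hn] := hl [:: (true, 0)] 0 e0.
have := hn (true, 0); rewrite inE eqxx /v /= normc0 ltr01 => /(_ isT).
by have [_ _ -> _] := uD n; rewrite sub0r normcN.
Qed.

(** The [j]-th index approximates the derivatives, to within [1 / (j + 1)], at the rational points
    coded by integers below [j]. The common Lipschitz bound extends convergence from rational points
    to all others. *)
Lemma limit_subsequence : exists k : nat -> nat, {homo k : m n / (m < n)%N} /\
  forall z, normc z < 1 -> forall e : R, 0 < e -> exists J, forall j, (J <= j)%N ->
  normc (der (u (k j)) z - der L z) <= e.
Proof.
pose q (x : rat * rat) : C := ratr x.1 +i* ratr x.2.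
pose s j : seq (bool * C) := [seq (false, q x) | x <- pmap (@unpickle (rat * rat)%type) (iota 0 j)].
have [j N|k [k1 k2]] := increasing_choice
  (P := fun j n => forall x, x \in s j -> normc (v n x - l x) <= (j.+1%:R)^-1).
  by apply: hl; rewrite invr_gt0.
exists k; split => // z z1 e e0.
pose K := 256 * (2 * (A / (1 - (1 + normc z) / 2))) / ((1 - normc z) / 4) ^+ 2.
have K0 : 0 <= K.
  apply: (coef_ge0 256); last exact: sqr_ge0.
  by rewrite mulr_ge0 // divr_ge0 //; lra.
(* A rational point within [2 * t] of [z] lies in the range of [limit_Taylor] and moves each
   derivative by at most [e / 3]. *)
pose t := Num.min ((1 - normc z) / 32) (e / (6 * (K + 1))).
have t0 : 0 < t.
  rewrite lt_min; apply/andP; split; first lra.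
  by rewrite divr_gt0 // mulr_gt0 // ltr_pwDr.
have [x hx] : exists x : rat * rat, normc (q x - z) <= 2 * t.
  have [|a] := @rat_in_itvoo R (complex.Re z) (complex.Re z + t); first by rewrite ltrDl.
  rewrite in_itv /= => /andP[a1 a2].
  have [|b] := @rat_in_itvoo R (complex.Im z) (complex.Im z + t); first by rewrite ltrDl.
  rewrite in_itv /= => /andP[b1 b2].
  exists (a, b); apply: le_trans (normc_le _) _.
  rewrite !(Re_addc, Im_addc, Re_oppc, Im_oppc) /= !gtr0_norm; lra.
have t1 : t <= (1 - normc z) / 32 by rewrite ge_min lexx.
have t2 : t <= e / (6 * (K + 1)) by rewrite ge_min lexx orbT.
rewrite ler_pdivlMr ?mulr_gt0 ?ltr_pwDr // in t2.
have [|_ [hL hu]] := limit_Taylor (h := q x - z) z1; first by lra.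
rewrite (addrC z) subrK -/K in hL; rewrite (addrC z) subrK -/K in hu.
have q1 : normc (q x) < 1.
  have := normcD (q x - z) z; rewrite subrK; lra.
pose i := pickle x; pose m := Num.bound (3 / e).
exists (i.+1 + m)%N => j hj; rewrite limit_derivative //.
have xs : (false, q x) \in s j.
  apply: map_f; rewrite mem_pmap; apply/mapP; exists i; last by rewrite pickleK.
  by rewrite mem_iota add0n; exact: leq_trans (leq_addr m i.+1) hj.
have := k2 j _ xs; rewrite /v /= q1 -/(L' (q x)) => h1.
have h2 : (j.+1%:R)^-1 <= e / 3.
  rewrite -[e / 3]invrK lef_pV2 ?posrE ?ltr0n ?invr_gt0 ?divr_gt0 // invf_div.
  apply: le_trans (ltW (archi_boundP _)) _; first by rewrite divr_ge0 // ltW.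
  by rewrite ler_nat; apply: leqW; exact: leq_trans (leq_addl i.+1 m) hj.
have h3 := hu (k j); rewrite normc_dist in h3.
apply: le_trans (normcBD (der (u (k j)) (q x)) _ _) _.
apply: le_trans (lerD (lexx _) (normcBD (l (false, q x)) _ _)) _.
rewrite -/(L' (q x)).
have h4 : K * normc (q x - z) <= e / 3.
  exact: le_trans (ler_wpM2l K0 hx) (le_third K0 t0 t2).
apply: le_trans (lerD h3 (lerD h1 hL)) _.
exact: add_thirds h4 h2.
Qed.

(** Fatou's lemma along the subsequence keeps the energy bound; pointwise convergence of the
    derivatives suffices. *)
Lemma limit_dirichlet : dirichlet_space L /\
  (\int[lebesgue2]_(p in D) energy_density (der L) p <= Q%:E)%E.
Proof.
have [k [_ hk]] := limit_subsequence.
have hol_L : holomorphic_on_disk L by move=> z /diskE z1; exact: cdiff_derivable (limit_cdiff z1).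
have E : (\int[lebesgue2]_(p in D) energy_density (der L) p <= Q%:E)%E.
  apply: (fatou_bound measurable_plane_disk (g := fun n p => normc (der (u (k n)) (p.1 +i* p.2)) ^+ 2)
    (l := fun p => normc (der L (p.1 +i* p.2)) ^+ 2)).
  - by move=> n; apply/measurable_EFinP; exact: measurable_derivative_density (@hol (k n)).
  - by move=> n p; exact: sqr_ge0.
  - by move=> p /plane_diskP p1 e e0; exact: (converges_normc_sqr (hk _ p1) e0).
  - by move=> n; exact: uQ.
split; last exact: E.
apply/dirichletP; split => //; [|exact: limit0|exact: le_lt_trans E (ltry _)].
by move=> z /diskE; rewrite /L; case: ifP.
Qed.

End limit.

Lemma Montel : exists (k : nat -> nat) (g : C -> C), [/\ {homo k : m n / (m < n)%N},
  dirichlet_space g, (\int[lebesgue2]_(p in D) energy_density (der g) p <= Q%:E)%E &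
  forall z, normc z < 1 -> forall e : R, 0 < e -> exists J, forall j, (J <= j)%N ->
  normc (der (u (k j)) z - der g z) <= e].
Proof.
have [l hl] := bounded_cluster vB.
have [k [k1 k2]] := limit_subsequence hl; have [h1 h2] := limit_dirichlet hl.
by exists k, (fun z => if normc z < 1 then l (true, z) else 0).
Qed.

End Montel.

(** * The composition operator is compact *)

Section compactness.
Context {R : realType}.
Local Notation C := R[i].
Local Notation mR := (measurableTypeR R).
Local Notation lebesgue2 := (@lebesgue_measure R \x @lebesgue_measure R)%E.
Local Notation D := (plane_disk : set (mR * mR)).
Local Notation der := complex_derivative.
Local Notation T := (composition_operator (@symbol R)).
Local Notation H := (@dirichlet_space R).
#[local] Arguments normc {R} x : simpl never.

Lemma energy_sqnorm (f : C -> C) : H f ->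
  (\int[lebesgue2]_(p in D) energy_density (der f) p = (pi * sqnorm dirichlet_ip f)%:E)%E.
Proof.
move=> hf; have := sqnorm_dirichlet hf; have := energy_finite hf.
have : (0 <= \int[lebesgue2]_(p in D) energy_density (der f) p)%E.
  by apply: integral_ge0 => p _; exact: energy_density_ge0.
case: (\int[lebesgue2]_(p in D) energy_density (der f) p)%E => [r| |] // _ _.
by rewrite -EFinM => -[->]; rewrite mulrA divff ?mul1r // gt_eqF // pi_gt0.
Qed.

Definition far_constant M : R := (2 / delta M ^+ 2) ^+ 2 * (32 / (remainder M / 16) ^+ 2).

Lemma far_constant_ge0 M : 0 <= far_constant M.
Proof. by rewrite mulr_ge0 ?sqr_ge0 // divr_ge0 // sqr_ge0. Qed.

Lemma measurable_T_far (f : C -> C) M : holomorphic_on_disk f ->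
  measurable_fun (far_part M) (energy_density (der (T f))).
Proof.
move=> hf; have mD := measurable_derivative_density (T_holomorphic hf).
exact: (measurable_funS measurable_plane_disk (@subIsetl _ _ _) mD).
Qed.

Lemma T_maps (f : C -> C) : H f -> H (T f).
Proof.
move=> hf; have := energy_sqnorm hf; have [f1 f2 f3 _] := hf => E.
have s0 : 0 <= pi * sqnorm dirichlet_ip f.
  by rewrite mulr_ge0 ?pi_ge0 // (sqnorm_ge0 dirichlet_inner_product hf).
apply/dirichletP; split.
- exact: T_holomorphic.
- by move=> z hz; rewrite /composition_operator ifF //; apply/negbTE/negP.
- by rewrite /composition_operator normr0 ltr01 symbol0.
rewrite (near_far_split 0 f1); apply: lte_add_pinfty.
  by apply: le_lt_trans (near_estimate 0 f1) _; rewrite E -EFinM ltry.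
have [_ _ mF _] := measurable_parts (R := R) 0.
have fp p : far_part 0 p -> (energy_density (der (T f)) p <=
    (far_constant 0 * (pi * sqnorm dirichlet_ip f))%:E)%E.
  by move=> hp; have := far_pointwise f1 hp; rewrite E -EFinM.
have B := ge0_integral_le_cst lebesgue2 mF (measurable_T_far (M := 0) f1) (energy_density_ge0 _) fp.
apply: le_lt_trans B _.
by apply: lte_mul_pinfty => //; [rewrite lee_fin mulr_ge0 // far_constant_ge0|exact: far_area].
Qed.

Lemma T_operator : is_operator H T.
Proof.
split; first exact: T_maps.
move=> a f g _ _; apply/funext => z; rewrite /composition_operator !fctE /=.
by case: ifP => _ //=; rewrite scaler0 addr0.
Qed.

Lemma theta_cvg0 (K e : R) : 0 <= K -> 0 < e -> exists M, K * theta M <= e.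
Proof.
move=> K0 e0; exists (2 ^ Num.bound (K / e)).-1; rewrite theta_pow.
rewrite ler_pdivrMr ?ltr0n ?addn4 // mulrC -ler_pdivrMr //.
apply: le_trans (ltW (archi_boundP _)) _; first by rewrite divr_ge0 // ltW.
by rewrite ler_nat -addn4 leq_addr.
Qed.

(** The part near 1 is small uniformly in [n], by the choice of [M]. On the rest the densities are
    uniformly bounded and tend to 0 pointwise, so bounded convergence applies. *)
Lemma compact_tail (w : nat -> C -> C) (Q : R) : 0 <= Q -> (forall n, H (w n)) ->
  (forall n, (\int[lebesgue2]_(p in D) energy_density (der (w n)) p <= Q%:E)%E) ->
  (forall z, normc z < 1 -> forall e : R, 0 < e -> exists J, forall j, (J <= j)%N ->
    normc (der (w j) z) <= e) ->
  forall e : R, 0 < e -> exists N, forall n, (N <= n)%N ->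
  (\int[lebesgue2]_(p in D) energy_density (der (T (w n))) p <= e%:E)%E.
Proof.
move=> Q0 hw wQ w0 e e0; have hol n : holomorphic_on_disk (w n) by have [] := hw n.
have e2 : 0 < e / 2 by rewrite divr_gt0.
have [|M hM] := theta_cvg0 (K := shell_constant * 43 * Q) _ e2.
  by rewrite !mulr_ge0 // ltW // shell_constant_gt0.
have [_ _ mF _] := measurable_parts (R := R) M.
have B := @bounded_convergence _ _ R lebesgue2 (far_part M) mF
  (fun n p => normc (der (T (w n)) (p.1 +i* p.2)) ^+ 2) (far_constant M * Q) (far_area M)
  (fun n => (measurable_EFinP _ _).1 (measurable_T_far (M := M) (hol n))) (fun n p => sqr_ge0 _).
have [||N hN] := B _ _ _ e2.
- move=> n p hp; rewrite -lee_fin; apply: le_trans (far_pointwise (hol n) hp) _.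
  rewrite EFinM; apply: lee_wpmul2l (wQ n); rewrite lee_fin; exact: far_constant_ge0.
- move=> p [/plane_diskP p1 _]; set z := p.1 +i* p.2 in p1 *.
  have s1 := le_lt_trans (symbol_le p1) p1.
  have c : forall e : R, 0 < e -> exists J, forall j, (J <= j)%N ->
      normc (der (T (w j)) z - 0) <= e.
    move=> r r0; have S0 := normc_ge0 (symbol' z).
    have [|J hJ] := w0 _ s1 (r / (normc (symbol' z) + 1)); first by rewrite divr_gt0 // ltr_pwDr.
    exists J => j /hJ hj; rewrite subr0 T_derivative // normcM.
    rewrite ler_pdivlMr ?ltr_pwDr // in hj; apply: le_trans hj.
    by apply: ler_wpM2l; [exact: normc_ge0|rewrite lerDl].
  move=> r r0; have [J hJ] := converges_normc_sqr c r0.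
  by exists J => j /hJ; rewrite normc0 expr0n.
exists N => n /hN hn; rewrite (near_far_split M (hol n)).
rewrite (_ : e = e / 2 + e / 2); last by field.
rewrite EFinD; apply: leeD; last exact: hn.
apply: le_trans (near_estimate M (hol n)) _.
apply: le_trans (lee_wpmul2l _ (wQ n)) _.
  by rewrite lee_fin !mulr_ge0 // ltW // ?shell_constant_gt0 // theta_gt0.
by rewrite -EFinM lee_fin; apply: le_trans hM; rewrite le_eqVlt; apply/orP; left; apply/eqP; ring.
Qed.

Lemma T_compact : is_compact_operator H dirichlet_ip T.
Proof.
split=> [|u uH [B uB]]; first exact: T_operator.
have ipH := @dirichlet_inner_product R.
pose Q : R := pi * B ^+ 2.
have Q0 : 0 <= Q by rewrite mulr_ge0 ?pi_ge0 ?sqr_ge0.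
have uQ n : (\int[lebesgue2]_(p in D) energy_density (der (u n)) p <= Q%:E)%E.
  rewrite (energy_sqnorm (uH n)) lee_fin ler_wpM2l ?pi_ge0 //.
  rewrite -(hnorm_sqr ipH (uH n)) lerXn2r ?nnegrE ?sqrtr_ge0 //.
  exact: le_trans (sqrtr_ge0 _) (uB n).
have [k [g [k1 gH gQ kg]]] := Montel uH uQ.
exists k; split => //; exists (T g); split; first exact: T_maps.
(* Subtracting the limit reduces the claim to derivatives tending to 0; the energies stay below
   [2 * Q + 2 * Q]. *)
pose w n := -1 *: g + u (k n).
have wH n : H (w n) := dirichlet_linear (-1) gH (uH (k n)).
have [ghol _ _ _] := gH; have uhol n : holomorphic_on_disk (u n) by have [] := uH n.
have wQ n : (\int[lebesgue2]_(p in D) energy_density (der (w n)) p <= (4 * Q)%:E)%E.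
  apply: le_trans (energy_linear (-1) ghol (uhol (k n))) _.
  rewrite normcN normc1 expr1n mulr1.
  apply: le_trans (leeD (lee_wpmul2l _ gQ) (lee_wpmul2l _ (uQ (k n)))) _; rewrite ?lee_fin //.
  by rewrite -mulrDl ler_wpM2r // -natrD.
have w0 z : normc z < 1 -> forall e : R, 0 < e -> exists J, forall j, (J <= j)%N ->
    normc (der (w j) z) <= e.
  move=> z1 e e0; have [J hJ] := kg z z1 e e0; exists J => j /hJ h.
  have -> : der (w j) z = -1 * der g z + der (u (k j)) z.
    exact: derivative_linearE ghol (uhol (k j)) z1.
  by rewrite mulN1r addrC.
apply/cvgr0Pnorm_le => e e0.
have [||N hN] := compact_tail _ wH wQ w0 (e := pi * e ^+ 2).
- by rewrite mulr_ge0.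
- by rewrite mulr_gt0 ?pi_gt0 // exprn_gt0.
exists N => // n /= /hN; have [_ lin] := T_operator.
have E : T (w n) = -1 *: T g + T (u (k n)) := lin (-1) g (u (k n)) gH (uH (k n)).
have -> : T (u (k n)) - T g = T (w n) by rewrite E scaleN1r addrC.
rewrite (energy_sqnorm (T_maps (wH n))) lee_fin ler_pM2l ?pi_gt0 //.
rewrite -(hnorm_sqr ipH (T_maps (wH n))) => h.
by rewrite ger0_norm ?sqrtr_ge0 // -(@ler_pXn2r R 2) // nnegrE ?sqrtr_ge0 // ltW.
Qed.

End compactness.

(** * The singular numbers decay slowly *)

Section lorentz.
Context {R : realType}.
Local Notation mu := (@lebesgue_measure R).
Local Notation mR := (measurableTypeR R).
Local Open Scope ereal_scope.

Lemma integral_oneDsqr : \int[mu]_t ((oneDsqr t)^-1)%:E = (pi : R)%:E.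
Proof.
rewrite (ge0_symfun_integralT (f := fun t => (oneDsqr t)^-1%R)).
- have -> : [set x : R | (0 <= x)%R] = `[0%R, +oo[%classic.
    by apply/seteqP; split => x /=; rewrite in_itv /= andbT.
  by rewrite integral0y_oneDsqr -EFinM; congr EFin; field.
- by move=> x; rewrite invr_ge0 (le_trans _ (oneDsqr_ge1 x)).
- exact: continuous_oneDsqrV.
- by move=> x /=; rewrite /oneDsqr sqrrN.
Qed.

(** [pi] times the Poisson kernel of the half-plane: its integral does not depend on [e]. *)
Definition lorentz (e t : R) : R := e / (e ^+ 2 + t ^+ 2).

Lemma lorentz_ge0 e t : (0 < e)%R -> (0 <= lorentz e t)%R.
Proof. by move=> e0; apply: divr_ge0; [exact: ltW|rewrite addr_ge0 ?sqr_ge0]. Qed.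

Lemma lorentz_continuous e (s c : R) : (0 < e)%R -> continuous (fun t => lorentz e (s * t + c)).
Proof.
move=> e0 t; apply: cvgM; first exact: cvg_cst.
apply: cvgV; first by rewrite gt_eqF // ltr_pwDl ?sqr_ge0 ?exprn_gt0.
apply: cvgD; first exact: cvg_cst.
have h : (s * x + c)%R @[x --> t] --> (s * t + c)%R.
  apply: cvgD; last exact: cvg_cst.
  by apply: cvgM; [exact: cvg_cst|exact: cvg_id].
exact: (cvgM h h).
Qed.

Lemma measurable_lorentz e (s c : R) : (0 < e)%R ->
  measurable_fun (T := mR) setT (fun t => (lorentz e (s * t + c))%:E).
Proof.
move=> e0; apply/measurable_EFinP; apply: continuous_measurable_fun.
exact: lorentz_continuous.
Qed.

Lemma integral_lorentz e (s c : R) : (0 < e)%R -> `|s|%R = 1%R ->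
  \int[mu]_t (lorentz e (s * t + c))%:E = (pi : R)%:E.
Proof.
move=> e0 s1; have s0 : s != 0%R by rewrite -normr_eq0 s1 oner_eq0.
have k0 : (s / e)%R != 0%R by rewrite mulf_neq0 // invr_eq0 gt_eqF.
have mg : measurable_fun (T := mR) setT (fun t : R => ((oneDsqr t)^-1)%:E).
  by apply/measurable_EFinP; apply: continuous_measurable_fun; exact: continuous_oneDsqrV.
have g0 t : 0 <= ((oneDsqr t)^-1 : R)%:E.
  by rewrite lee_fin invr_ge0 (le_trans _ (oneDsqr_ge1 t)).
have := ge0_integral_affine (c / e) k0 mg g0.
rewrite integral_oneDsqr normrM s1 mul1r gtr0_norm ?invr_gt0 // => <-.
rewrite -ge0_integralZl_EFin ?invr_ge0 ?(ltW e0) //.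
- apply: eq_integral => t _; rewrite -EFinM; congr EFin; rewrite /lorentz /oneDsqr.
  have a0 : (0 < e ^+ 2 + (s * t + c) ^+ 2)%R by rewrite ltr_pwDl ?sqr_ge0 ?exprn_gt0.
  have -> : (1 + (s / e * t + c / e) ^+ 2 = (e ^+ 2 + (s * t + c) ^+ 2) / e ^+ 2)%R.
    by field; rewrite gt_eqF.
  by field; rewrite ?gt_eqF.
- have := measurableT_comp mg (measurable_affine (s / e) (c / e)); exact.
Qed.

End lorentz.

Section product_integral.
Context {d1 d2 : measure_display} {T1 : measurableType d1} {T2 : measurableType d2} {R : realType}.
Variables (m1 : {sigma_finite_measure set T1 -> \bar R}) (m2 : {sigma_finite_measure set T2 -> \bar R}).
Local Open Scope ereal_scope.

Lemma integral_product (f : T1 -> R) (g : T2 -> R) (a b : R) :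
  measurable_fun setT f -> measurable_fun setT g -> (forall x, 0 <= f x)%R -> (forall y, 0 <= g y)%R ->
  \int[m1]_x (f x)%:E = a%:E -> \int[m2]_y (g y)%:E = b%:E ->
  \int[m1 \x m2]_p (f p.1 * g p.2)%:E = (a * b)%:E.
Proof.
move=> mf mg f0 g0 fa gb.
have mfg : measurable_fun setT (fun p : T1 * T2 => (f p.1 * g p.2)%:E).
  apply/measurable_EFinP; apply: measurable_funM.
    exact: (measurableT_comp mf).
  exact: (measurableT_comp mg).
rewrite fubini_tonelli1 //; last by move=> p; rewrite lee_fin mulr_ge0.
have b0 : (0 <= b)%R by rewrite -lee_fin -gb; apply: integral_ge0 => y _; rewrite lee_fin.
transitivity (\int[m1]_x (b%:E * (f x)%:E)).
  apply: eq_integral => x _; rewrite /fubini_F /=.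
  under eq_integral do rewrite EFinM.
  by rewrite ge0_integralZl_EFin ?gb 1?muleC //; [move=> y _; rewrite lee_fin|exact/measurable_EFinP].
rewrite ge0_integralZl_EFin ?fa // -?EFinM 1?mulrC //.
  by move=> x _; rewrite lee_fin.
exact/measurable_EFinP.
Qed.

End product_integral.

Lemma normr_Rintegral_le d (T : measurableType d) (R : realType) (mu : {measure set T -> \bar R})
  (A : set T) (u : T -> R) (k : T -> \bar R) (K : R) : measurable A ->
  mu.-integrable A (EFin \o u) -> measurable_fun A k -> (forall x, A x -> `|u x|%:E <= k x)%E ->
  (\int[mu]_(x in A) k x <= K%:E)%E -> `|\int[mu]_(x in A) u x| <= K.
Proof.
move=> mA iu mk uk kK; apply: le_trans (le_normr_Rintegral mA iu) _.
have iu' : mu.-integrable A (EFin \o (fun x => `|u x|)).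
  by have := integrable_abse iu; apply: eq_integrable.
rewrite -lee_fin /Rintegral fineK; last exact: integrable_fin_num.
apply: le_trans kK; by apply: ge0_le_integral => //; case/integrableP: iu'.
Qed.

(** * Test functions concentrated near 1 *)

Section test_functions.
Context {R : realType}.
Local Notation C := R[i].
Local Notation mR := (measurableTypeR R).
Local Notation lebesgue2 := (@lebesgue_measure R \x @lebesgue_measure R)%E.
Local Notation D := (plane_disk : set (mR * mR)).
Local Notation der := complex_derivative.
Local Notation H := (@dirichlet_space R).
#[local] Arguments normc {R} x : simpl never.
Implicit Types (e : R) (z : C).

(** The factor [e ^ 3] gives the derivative a supremum at most [1 / e], an integral of order [e] and
    a bounded energy. Its decay of order 4 is that of a product of two Lorentz kernels, one in each
    coordinate. *)
Definition cubic_kernel e z : C := e%:C ^+ 3 / 3 * (1 + e%:C - z)^-1 ^+ 3.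

Definition test_function e z : C :=
  if normc z < 1 then cubic_kernel e z - cubic_kernel e 0 else 0.

Definition test_derivative e z : C := e%:C ^+ 3 * (1 + e%:C - z)^-1 ^+ 4.

Lemma cubic_kernel_cdiff e z : 1 + e%:C - z != 0 ->
  cdiff (cubic_kernel e) z (test_derivative e z).
Proof.
move=> h; have d1 : cdiff (fun w => 1 + e%:C - w) z (0 - 1).
  by apply: cdiffB; [exact: cdiff_cst|exact: cdiff_id].
have d2 := cdiff_comp d1 (cdiff_inv h).
have d3 := cdiffMl (e%:C ^+ 3 / 3) (cdiffM d2 (cdiffM d2 d2)).
set l := (X in cdiff _ _ X) in d3; have <- : l = test_derivative e z.
  rewrite /l /test_derivative; field; exact: h.
by apply: cdiff_ext d3; exists 1.
Qed.

Lemma test_cdiff e z : 0 < e -> normc z < 1 -> cdiff (test_function e) z (test_derivative e z).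
Proof.
move=> e0 z1; have [A0 _ _] := shift_normP e0 (ltW (Re_lt1 z1)).
rewrite normc_gt0 in A0; have d := cdiffB (cubic_kernel_cdiff A0) (cdiff_cst (cubic_kernel e 0) z).
rewrite subr0 in d; apply: cdiff_ext d; exists (1 - normc z); first by rewrite subr_gt0.
move=> h hh; rewrite /test_function ifT //; apply: le_lt_trans (normcD _ _) _; lra.
Qed.

Lemma test_derivativeE e z : 0 < e -> normc z < 1 -> der (test_function e) z = test_derivative e z.
Proof. by move=> e0 z1; exact/cdiff_derivative/test_cdiff. Qed.

Lemma test_holomorphic e : 0 < e -> holomorphic_on_disk (test_function e).
Proof. by move=> e0 z /diskE z1; exact: cdiff_derivable (test_cdiff e0 z1). Qed.

Lemma normc_test_derivative e z : 0 < e ->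
  normc (test_derivative e z) = e ^+ 3 / normc (1 + e%:C - z) ^+ 4.
Proof.
by move=> e0; rewrite normcM !normcX normcV normc_real gtr0_norm // exprVn.
Qed.

Lemma test_derivative_le e z : 0 < e -> normc z < 1 ->
  normc (test_derivative e z) <= e^-1.
Proof.
move=> e0 z1; have [A0 eA _] := shift_normP e0 (ltW (Re_lt1 z1)).
rewrite normc_test_derivative // ler_pdivrMr ?exprn_gt0 // mulrC ler_pdivlMr //.
by rewrite -exprSr lerXn2r ?nnegrE ?(ltW e0) ?(ltW A0).
Qed.

(* A product, so that Tonelli applies, which dominates [e^2 / |1 + e - z|^4]. *)
Definition lorentz2 e (p : mR * mR) : R := lorentz e (-1 * p.1 + 1) * lorentz e (1 * p.2 + 0).

Lemma lorentz2_ge0 e p : 0 < e -> 0 <= lorentz2 e p.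
Proof. by move=> e0; rewrite mulr_ge0 ?lorentz_ge0. Qed.

Lemma integral_lorentz2 e : 0 < e ->
  (\int[lebesgue2]_p (lorentz2 e p)%:E = (pi ^+ 2)%:E)%E.
Proof.
move=> e0; have i1 := integral_lorentz (e := e) (s := -1) 1 e0 (normrN1 _).
have i2 := integral_lorentz (e := e) (s := 1) 0 e0 (normr1 _).
have m1 := (measurable_EFinP _ _).1 (measurable_lorentz (-1) 1 e0).
have m2 := (measurable_EFinP _ _).1 (measurable_lorentz 1 0 e0).
exact: (integral_product m1 m2 (fun x => lorentz_ge0 _ e0) (fun y => lorentz_ge0 _ e0) i1 i2).
Qed.

Lemma measurable_lorentz2 e : 0 < e -> measurable_fun setT (fun p : mR * mR => (lorentz2 e p)%:E).
Proof.
move=> e0; have m1 := (measurable_EFinP _ _).1 (measurable_lorentz (-1) 1 e0).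
have m2 := (measurable_EFinP _ _).1 (measurable_lorentz 1 0 e0).
apply/measurable_EFinP; apply: measurable_funM.
  exact: (measurableT_comp m1 (@measurable_fst _ _ mR mR)).
exact: (measurableT_comp m2 (@measurable_snd _ _ mR mR)).
Qed.

Lemma integral_lorentz2_disk e : 0 < e ->
  (\int[lebesgue2]_(p in D) (lorentz2 e p)%:E <= (pi ^+ 2)%:E)%E.
Proof.
move=> e0; rewrite -(integral_lorentz2 e0).
apply: (ge0_subset_integral _ measurable_plane_disk measurableT (measurable_lorentz2 e0)) => //.
by move=> p _; rewrite lee_fin lorentz2_ge0.
Qed.

(** With [a = (1 - x) ^ 2] and [b = y ^ 2], it follows from [|1 + e - z| ^ 2 >= e ^ 2 + a + b] and
    [(e ^ 2 + a + b) ^ 2 >= (e ^ 2 + a) * (e ^ 2 + b)]. *)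
Lemma lorentz2_bound e (p : mR * mR) : 0 < e -> normc (p.1 +i* p.2) < 1 ->
  normc (1 + e%:C - (p.1 +i* p.2)) ^- 4 * e ^+ 2 <= lorentz2 e p.
Proof.
move=> e0 z1; have h := shift_norm e0 (ltW (Re_lt1 z1)).
have [A0 _ _] := shift_normP e0 (ltW (Re_lt1 z1)); move: h A0.
rewrite [X in _ + X <= _]normc_sqr; case: p z1 => x y _ /=; simpc => /=.
set N := normc _ => h N0; rewrite /lorentz2 /lorentz /=.
have a0 : 0 < e ^+ 2 + (-1 * x + 1) ^+ 2 by rewrite ltr_pwDl ?sqr_ge0 ?exprn_gt0.
have b0 : 0 < e ^+ 2 + (1 * y + 0) ^+ 2 by rewrite ltr_pwDl ?sqr_ge0 ?exprn_gt0.
rewrite mulrACA -invfM -expr2 mulrC ler_pM2l ?exprn_gt0 //.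
rewrite lef_pV2 ?posrE ?mulr_gt0 ?exprn_gt0 //.
rewrite (_ : N ^+ 4 = (N ^+ 2) ^+ 2); last by rewrite -exprM.
apply: (le_trans (y := (e ^+ 2 + ((1 - x) ^+ 2 + y ^+ 2)) ^+ 2)).
  have := sqr_ge0 e; have := sqr_ge0 (1 - x); have := sqr_ge0 y.
  rewrite (_ : (-1 * x + 1) ^+ 2 = (1 - x) ^+ 2); last by ring.
  rewrite mul1r addr0; move: (e ^+ 2) ((1 - x) ^+ 2) (y ^+ 2) => a b c; nra.
apply: lerXn2r; rewrite ?nnegrE ?sqr_ge0 ?addr_ge0 ?sqr_ge0 //.
by move: h; rewrite sqrrN.
Qed.

Lemma test_energy_le e (p : mR * mR) : 0 < e -> D p ->
  (energy_density (der (test_function e)) p <= (lorentz2 e p)%:E)%E.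
Proof.
move=> e0 /plane_diskP z1; rewrite /energy_density test_derivativeE // lee_fin.
apply: le_trans (lorentz2_bound e0 z1).
have [A0 eA _] := shift_normP e0 (ltW (Re_lt1 z1)).
rewrite normc_test_derivative //; move: A0 eA; move: (normc _) => N N0 eN.
rewrite (_ : (e ^+ 3 / N ^+ 4) ^+ 2 = N ^- 4 * e ^+ 2 * (e ^+ 4 / N ^+ 4)); last first.
  by field; rewrite gt_eqF.
rewrite ler_piMr //; first by rewrite mulr_ge0 ?sqr_ge0 // invr_ge0 exprn_ge0 // ltW.
by rewrite ler_pdivrMr ?exprn_gt0 // mul1r lerXn2r ?nnegrE ?(ltW e0) ?(ltW N0).
Qed.

Lemma test_L1_le e (p : mR * mR) : 0 < e -> D p ->
  normc (der (test_function e) (p.1 +i* p.2)) <= e * lorentz2 e p.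
Proof.
move=> e0 /plane_diskP z1; rewrite test_derivativeE // normc_test_derivative //.
apply: le_trans (ler_wpM2l (ltW e0) (lorentz2_bound e0 z1)).
by rewrite le_eqVlt; apply/orP; left; apply/eqP; ring.
Qed.

Lemma measurable_lorentz2_disk e : 0 < e -> measurable_fun D (fun p => (lorentz2 e p)%:E).
Proof. by move=> e0; exact: (measurable_funS measurableT (@subsetT _ _) (measurable_lorentz2 e0)). Qed.

Lemma test_energy e : 0 < e ->
  (\int[lebesgue2]_(p in D) energy_density (der (test_function e)) p <= (pi ^+ 2)%:E)%E.
Proof.
move=> e0; apply: le_trans (integral_lorentz2_disk e0).
apply: (@ge0_le_integral _ _ R lebesgue2 D measurable_plane_disk _ _
  (fun p _ => energy_density_ge0 (der (test_function e)) p)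
  (measurable_derivative_density (test_holomorphic e0)) (measurable_lorentz2_disk e0)).
by move=> p hp; exact: test_energy_le.
Qed.

Lemma test_dirichlet e : 0 < e -> H (test_function e).
Proof.
move=> e0; apply/dirichletP; split; first exact: test_holomorphic.
- by move=> z /diskE; rewrite /test_function; case: ifP.
- by rewrite /test_function normc0 ltr01 subrr.
exact: le_lt_trans (test_energy e0) (ltry _).
Qed.

Lemma test_sqnorm e : 0 < e -> sqnorm dirichlet_ip (test_function e) <= pi.
Proof.
move=> e0; have := test_energy e0; rewrite (energy_sqnorm (test_dirichlet e0)) lee_fin.
by rewrite expr2 ler_pM2l // pi_gt0.
Qed.

(** The supremum of one derivative, [1 / e], is paired with the integral of the other, of order
    [e']. The factor 2 stems from real and imaginary parts. *)
Lemma test_gram e e' : 0 < e -> 0 < e' ->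
  normc (dirichlet_ip (test_function e) (test_function e')) <= 2 * pi * (e' / e).
Proof.
move=> e0 e'0; have hf := test_dirichlet e0; have hg := test_dirichlet e'0.
have [i1 i2] := product_integrable hf hg.
pose k (p : mR * mR) : \bar R := ((e' / e)%:E * (lorentz2 e' p)%:E)%E.
have q0 : 0 <= e' / e by rewrite divr_ge0 // ltW.
have mk : measurable_fun D k := measurable_funeM _ (measurable_lorentz2_disk e'0).
have ik : (\int[lebesgue2]_(p in D) k p <= (e' / e * pi ^+ 2)%:E)%E.
  rewrite (ge0_integralZl_EFin _ measurable_plane_disk _ (measurable_lorentz2_disk e'0) q0).
    by rewrite (EFinM (e' / e)); apply: lee_wpmul2l; [rewrite lee_fin|exact: integral_lorentz2_disk].
  by move=> p _; rewrite lee_fin lorentz2_ge0.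
have fg p : D p -> normc (der (test_function e) (p.1 +i* p.2) *
    (der (test_function e') (p.1 +i* p.2))^*) <= e' / e * lorentz2 e' p.
  move=> hp; have /plane_diskP z1 := hp.
  rewrite normcM normc_conj [e' / e]mulrC -mulrA; apply: ler_pM; rewrite ?normc_ge0 //.
    by rewrite test_derivativeE //; exact: test_derivative_le.
  exact: test_L1_le.
have b1 := normr_Rintegral_le measurable_plane_disk i1 mk _ ik.
have b2 := normr_Rintegral_le measurable_plane_disk i2 mk _ ik.
have {}b1 := b1 (fun p hp => le_trans (Re_le_normc _) (fg p hp)).
have {}b2 := b2 (fun p hp => le_trans (Im_le_normc _) (fg p hp)).
apply: le_trans (normc_le _) _; rewrite /dirichlet_ip /area_integral.
have p0 : 0 <= pi^-1 :> R by rewrite invr_ge0 pi_ge0.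
rewrite [complex.Re _]/= [complex.Im _]/= !normrM !(ger0_norm p0).
apply: le_trans (lerD (ler_wpM2l p0 b1) (ler_wpM2l p0 b2)) _.
have alg (q r : R) : q != 0 -> q^-1 * (r * q ^+ 2) + q^-1 * (r * q ^+ 2) = 2 * q * r.
  by move=> ?; field.
by rewrite alg // gt_eqF // pi_gt0.
Qed.

End test_functions.

(** * Lower bound for the images and row sums of the Gram matrix *)

Section lower_bound.
Context {R : realType}.
Local Notation C := R[i].
Local Notation mR := (measurableTypeR R).
Local Notation lebesgue2 := (@lebesgue_measure R \x @lebesgue_measure R)%E.
Local Notation D := (plane_disk : set (mR * mR)).
Local Notation der := complex_derivative.
Local Notation T := (composition_operator (@symbol R)).
Local Notation H := (@dirichlet_space R).
#[local] Arguments normc {R} x : simpl never.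
Local Notation g m := (test_function (@remainder R m)).

Definition lower_denominator : R := 512%:R * 1024%:R ^+ 2 * pi.

Lemma lower_denominator_gt0 : 0 < lower_denominator.
Proof.
apply: mulr_gt0 (pi_gt0 R); apply: mulr_gt0; first exact: ltr0Sn.
by apply: exprn_gt0; exact: ltr0Sn.
Qed.

(** One point is enough: at [b = 1 - delta m] the derivative of the image is at least
    [theta m / (1024 * delta m)], and the mean value inequality on a square of half-side
    [delta m / 4] turns this into energy. *)
Lemma lower_estimate m : (0 < m)%N ->
  theta m ^+ 2 / lower_denominator <= sqnorm dirichlet_ip (T (g m)).
Proof.
move=> m0; have d0 := delta_gt0 (R := R) m; have e0 := remainder_gt0 (R := R) m.
have c0 := weight_gt0 (R := R) m.
have d1 : delta m < 1 :> R.
  rewrite -(prednK m0) deltaS; have := delta_le1 (R := R) m.-1; lra.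
set b : C := 1 - (delta m)%:C.
have nb : normc b = 1 - delta m.
  by rewrite /b -[1 : C]/(1%:C) -rmorphB normc_real ger0_norm //; lra.
have b1 : normc b < 1 by rewrite nb; lra.
have nb1 : normc (1 - b) = delta m by rewrite /b subKr normc_real gtr0_norm.
have Tm := test_dirichlet e0; have hol := T_holomorphic (test_holomorphic e0).
have S0 : 0 < delta m / 4 :> R by rewrite divr_gt0.
have K1 := sub_mean_value_disk (F := der (T (g m))) (w := b) (S := delta m / 4)
  (holomorphic_derivative hol) S0 _ measurable_plane_disk (@subset_refl _ _).
have {}K1 : ((normc (der (T (g m)) b) ^+ 2)%:E <=
    (32 / (delta m / 4) ^+ 2)%:E * (pi * sqnorm dirichlet_ip (T (g m)))%:E)%E.
  rewrite -(energy_sqnorm (T_maps Tm)); apply: K1; first by rewrite nb; lra.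
  by move=> q /plane_squareP hq; apply/plane_diskP; apply: disk_square hq; rewrite nb; lra.
rewrite -EFinM lee_fin in K1.
have s1 := le_lt_trans (symbol_le b1) b1.
have near : normc (1 - symbol b) <= 3 * remainder m by apply: symbol_near; rewrite ?nb1.
(* Since [|1 + C m - symbol b| <= 4 * C m], the modulus of the derivative is at least
   [C m ^ 3 / (4 * C m) ^ 4]. *)
have low : (256 * remainder m)^-1 <= normc (der (g m) (symbol b)).
  rewrite test_derivativeE // normc_test_derivative //.
  have [A0 _ _] := shift_normP e0 (ltW (Re_lt1 s1)).
  have A4 : normc (1 + (remainder m)%:C - symbol b) <= 4 * remainder m.
    have := normcD (1 - symbol b) (remainder m)%:C; rewrite normc_real gtr0_norm //.
    by rewrite (_ : 1 - _ + _ = 1 + (remainder m)%:C - symbol b); [lra|ring].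
  rewrite ler_pdivlMr ?exprn_gt0 // mulrC ler_pdivrMr ?mulr_gt0 //.
  apply: (le_trans (y := (4 * remainder m) ^+ 4)).
    by apply: lerXn2r A4; rewrite nnegrE; [exact: ltW|apply: mulr_ge0 => //; exact: ltW].
  by rewrite le_eqVlt; apply/orP; left; apply/eqP; ring.
have q1 : 0 <= (256 * remainder m)^-1 :> R.
  by rewrite invr_ge0; apply: mulr_ge0 => //; exact: ltW.
have q2 : 0 <= weight m / (4 * delta m) :> R.
  by apply: divr_ge0; [exact: ltW|apply: mulr_ge0 => //; exact: ltW].
have big : (256 * remainder m)^-1 * (weight m / (4 * delta m)) <= normc (der (T (g m)) b).
  have -> : der (T (g m)) b = der (g m) (symbol b) * symbol' b.
    exact: T_derivative (test_holomorphic e0) b1.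
  by rewrite normcM; exact: ler_pM q1 q2 low (symbol'_lower m0).
have big2 : ((256 * remainder m)^-1 * (weight m / (4 * delta m))) ^+ 2 <= normc (der (T (g m)) b) ^+ 2.
  by apply: lerXn2r big; rewrite nnegrE; [exact: mulr_ge0|exact: normc_ge0].
have := le_trans big2 K1.
have -> : (256 * remainder m)^-1 * (weight m / (4 * delta m)) = theta m / (1024 * delta m) :> R.
  by rewrite /weight; field; rewrite !gt_eqF.
rewrite ler_pdivrMr ?lower_denominator_gt0 // /lower_denominator; move: (sqnorm _ _) (theta m) (delta m) d0 => Y t d d0 h.
have p0 := pi_gt0 R.
have E1 : t ^+ 2 = (t / (1024 * d)) ^+ 2 * (1024 ^+ 2 * d ^+ 2) by field; rewrite gt_eqF.
have E2 : Y * (512 * 1024 ^+ 2 * pi) = 32 / (d / 4) ^+ 2 * (pi * Y) * (1024 ^+ 2 * d ^+ 2).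
  by field; rewrite gt_eqF.
by rewrite E1 E2; apply: ler_wpM2r h; rewrite mulr_ge0 ?sqr_ge0.
Qed.

(** Entries decay like the ratio of the smaller remainder to the larger. As remainders shrink by at
    least [1 - theta N] per step, each side of the diagonal behaves like a geometric series of sum
    [1 / theta N]. *)
Lemma gram_row N m : (m < N)%N ->
  \sum_(k < N) normc (dirichlet_ip (g m) (g k)) <= 4 * pi / (theta N : R).
Proof.
move=> mN; have tN := theta_gt0 (R := R) N; have Cm := remainder_gt0 (R := R) m.
have p0 := pi_gt0 R.
have sym k : normc (dirichlet_ip (g m) (g k)) = normc (dirichlet_ip (g k) (g m)).
  have [_ _ _ conj _] := @dirichlet_inner_product R.
  by rewrite (conj _ _ (test_dirichlet (remainder_gt0 m)) (test_dirichlet (remainder_gt0 k))) normc_conj.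
(* The induction step is [(1 + theta N) * (1 - theta n) <= 1], true because [theta N <= theta n]. *)
have low n : (n <= m)%N -> \sum_(k < n) (remainder k)^-1 <= (theta N * remainder n)^-1 :> R.
  elim: n => [|n IH] nm; first by rewrite big_ord0 invr_ge0 mulr_ge0 ?ltW ?remainder_gt0.
  rewrite big_ord_recr; apply: le_trans (lerD (IH (ltnW nm)) (lexx _)) _ => /=.
  have tn : theta N <= theta n :> R by apply: theta_decr; lia.
  have t4 := theta_le (R := R) n; have Cn := remainder_gt0 (R := R) n.
  move: (theta N) (theta n) (remainder n) tN tn t4 Cn => a t x a0 at_ t4 x0.
  have tt : 0 < 1 - t by lra.
  rewrite (_ : (a * x)^-1 + x^-1 = (1 + a) / (a * x)); last by field; rewrite !gt_eqF.
  rewrite ler_pdivrMr ?mulr_gt0 // (_ : _ * (a * x) = (1 - t)^-1); last by field; rewrite !gt_eqF.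
  by rewrite -div1r ler_pdivlMr //; nra.
(* Here [C k = c k / theta k <= c k / theta N], and the weights telescope. *)
have high n : (m + n <= N)%N -> \sum_(i < n) remainder (m + i) <=
    (remainder m - remainder (m + n)) / theta N :> R.
  elim: n => [|n IH] nm; first by rewrite big_ord0 addn0 subrr mul0r.
  rewrite big_ord_recr addnS; apply: le_trans (lerD (IH (ltnW _)) (lexx _)) _.
    by rewrite -addnS.
  have tn : theta N <= theta (m + n) :> R by apply: theta_decr; lia.
  rewrite [X in _ + X <= _]/= remainderS -lerBrDl -mulrBl ler_pdivlMr // /weight.
  have Cn := remainder_gt0 (R := R) (m + n)%N; nra.
have mN' := ltnW mN; rewrite -(subnKC mN') big_split_ord /=.
have h1 : \sum_(i < m) normc (dirichlet_ip (g m) (g i)) <= 2 * pi / theta N.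
  apply: (le_trans (y := \sum_(i < m) 2 * pi * remainder m * (remainder i)^-1)).
    apply: ler_sum => i _; rewrite sym -mulrA; apply: test_gram; exact: remainder_gt0.
  rewrite -mulr_sumr; apply: le_trans (ler_wpM2l _ (low m (leqnn m))) _.
    by rewrite !mulr_ge0 // ltW.
  by rewrite le_eqVlt; apply/orP; left; apply/eqP; field; rewrite !gt_eqF.
have h2 : \sum_(i < N - m) normc (dirichlet_ip (g m) (g (m + i))) <= 2 * pi / theta N.
  apply: (le_trans (y := \sum_(i < N - m) 2 * pi / remainder m * remainder (m + i))).
    apply: ler_sum => i _; rewrite -mulrA [_^-1 * _]mulrC; apply: test_gram; exact: remainder_gt0.
  rewrite -mulr_sumr; apply: le_trans (ler_wpM2l _ (high (N - m)%N _)) _.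
  - by rewrite divr_ge0 ?mulr_ge0 // ltW.
  - by rewrite subnKC.
  apply: (le_trans (y := 2 * pi / remainder m * (remainder m / theta N))).
    apply: ler_wpM2l; first by rewrite divr_ge0 ?mulr_ge0 // ltW.
    rewrite ler_wpM2r ?invr_ge0 ?(ltW tN) //.
    have := remainder_gt0 (R := R) (m + (N - m))%N; lra.
  by rewrite le_eqVlt; apply/orP; left; apply/eqP; field; rewrite !gt_eqF.
apply: le_trans (lerD h1 h2) _; rewrite subnKC //.
by rewrite le_eqVlt; apply/orP; left; apply/eqP; ring.
Qed.

End lower_bound.

(** * The Schatten condition against the growth of the test family *)

Lemma Schatten_decay (R : realType) (s : nat -> R) (p : R) : 0 < p ->
  nonincreasing_seq s -> (forall n, 0 <= s n) -> (\sum_(0 <= n <oo) (s n `^ p)%:E < +oo)%E ->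
  forall x : R, 0 < x -> exists q J, forall X, (J < X)%N -> s (X ^ q)%N <= x / X%:R.
Proof.
move=> p0 s_mono s0 fin x x0; set S := (limn _) in fin.
have part L : (\sum_(0 <= k < L) (s k `^ p)%:E <= S)%E.
  by apply: nneseries_lim_ge => k _ _; rewrite lee_fin powR_ge0.
have S0 : (0 <= S)%E by have := part 0%N; rewrite big_geq.
have Sfin : S \is a fin_num by rewrite ge0_fin_numE.
have bound L : L%:R * s L `^ p <= fine S.
  rewrite -lee_fin fineK //; apply: le_trans (part L).
  rewrite big_mkord sumEFin lee_fin mulr_natl -[X in _ *+ X]card_ord -sumr_const.
  by apply: ler_sum => i _; apply: ge0_ler_powR; rewrite ?nnegrE ?s0 ?(ltW p0) //; exact/s_mono/ltnW.
have xp : 0 < x `^ p by rewrite powR_gt0.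
(* Monotonicity gives [L * s L ^ p <= S]. With [L = X ^ q] and [q] one more than an integer above
   [p], a value [s L > x / X] would force [X * x ^ p <= S], which fails beyond the chosen [J]. *)
exists (Num.bound p).+1, (Num.bound (fine S / x `^ p)) => X JX.
have X0 : 0 < X%:R :> R by rewrite ltr0n; apply: leq_ltn_trans JX.
have X1 : 1 <= X%:R :> R by rewrite ler1n -(ltr0n R).
rewrite leNgt; apply/negP => h.
have h1 : (x / X%:R) `^ p <= s (X ^ (Num.bound p).+1)%N `^ p.
  by apply: ge0_ler_powR; rewrite ?nnegrE ?s0 ?(ltW p0) ?(ltW h) // divr_ge0 // ltW.
have h2 : x `^ p = (x / X%:R) `^ p * X%:R `^ p.
  by rewrite -powRM ?(ltW X0) ?divr_ge0 ?(ltW x0) ?(ltW X0) // divfK // gt_eqF.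
have h3 : X%:R `^ p <= X%:R ^+ Num.bound p :> R.
  by rewrite -powR_mulrn ?(ltW X0) //; apply: ler_powR => //; rewrite ltW // archi_boundP // ltW.
have h4 := bound (X ^ (Num.bound p).+1)%N.
have h5 : X%:R * x `^ p <= fine S.
  apply: le_trans h4; rewrite natrX exprS -mulrA; apply: ler_wpM2l; first exact: ltW.
  by rewrite h2 mulrC; apply: ler_pM => //; exact: powR_ge0.
rewrite -ler_pdivlMr // in h5; have := archi_boundP (divr_ge0 (fine_ge0 S0) (ltW xp)).
by move=> /(le_lt_trans h5); rewrite ltr_nat ltnNge (ltnW JX).
Qed.

(** The bound on [t] makes the last term at most half of the left side, using [N' + 1 <= 2 * N'].
    What remains bounds [N'] by a power of [X], while [N'] will be exponential in [X]. *)
Lemma growth_contradiction (R : realType) (N' X K Y Z a t : R) : 0 < X -> 0 < Z -> 0 < N' ->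
  0 <= a -> 1 <= N' -> t <= (4 * K * Z)^-1 -> 0 < K ->
  N' * (X ^- 2 / Z) <= a * (Y * (4 * K * X)) + (N' + 1) * (t / X ^+ 2 * K) ->
  N' <= 8 * K * a * Z * (Y * X ^+ 3).
Proof.
move=> X0 Z0 N0 a0 N1 ht K0 h.
have h1 : (N' + 1) * (t / X ^+ 2 * K) <= N' * (X ^- 2 / Z) / 2.
  apply: (le_trans (y := 2 * N' * ((4 * K * Z)^-1 / X ^+ 2 * K))).
    apply: (le_trans (y := (N' + 1) * ((4 * K * Z)^-1 / X ^+ 2 * K))).
      apply: ler_wpM2l; first lra.
      by apply: ler_wpM2r; [exact: ltW|apply: ler_wpM2r ht; rewrite invr_ge0 sqr_ge0].
    apply: ler_wpM2r; last lra.
    by rewrite mulr_ge0 ?divr_ge0 ?invr_ge0 ?sqr_ge0 ?mulr_ge0 // ltW.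
  by rewrite le_eqVlt; apply/orP; left; apply/eqP; field; rewrite !gt_eqF.
have {}h : N' * (X ^- 2 / Z) / 2 <= a * (Y * (4 * K * X)) by lra.
have E : N' = N' * (X ^- 2 / Z) / 2 * (2 * Z * X ^+ 2) by field; rewrite !gt_eqF.
rewrite E; apply: le_trans (ler_wpM2r _ h) _.
  by rewrite mulr_ge0 ?sqr_ge0 // mulr_ge0 // ltW.
by rewrite le_eqVlt; apply/orP; left; apply/eqP; ring.
Qed.

Section not_Schatten.
Context {R : realType}.
Local Notation T := (composition_operator (@symbol R)).
Local Notation H := (@dirichlet_space R).
Local Notation g m := (test_function (@remainder R m)).

Lemma not_Schatten (p : R) : 0 < p -> ~ schatten_class H dirichlet_ip p T.
Proof.
move=> p0 [compT [s [[s_mono s0 [S [e [adj orth eigen kernel]]]] fin]]].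
have ipH := @dirichlet_inner_product R.
have hg m : H (g m) by exact/test_dirichlet/remainder_gt0.
have pi0 := pi_gt0 R.
have := @lower_estimate R; move: (@lower_denominator_gt0 R); move: lower_denominator => Z Z0 lower.
(* Chosen so that [x ^ 2 <= (4 * pi * Z)^-1], the threshold at which the tail of the singular
   numbers is absorbed. *)
pose x : R := (1 + 4 * pi * Z)^-1.
have Y0 : 0 < 4 * pi * Z by apply: mulr_gt0 => //; exact: mulr_gt0.
have x0 : 0 < x by rewrite invr_gt0 ltr_pwDl // ltW.
have x2 : x ^+ 2 <= (4 * pi * Z)^-1.
  rewrite /x exprVn lef_pV2 ?posrE ?exprn_gt0 //; nra.
have [q [J decay]] := Schatten_decay p0 s_mono s0 fin x0.
pose K : R := 16 * pi * s 0%N ^+ 2 * Z.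
have K0 : 0 <= K by rewrite !mulr_ge0 ?sqr_ge0 // ltW.
(* The summand [2 ^ J] forces [j >= J], so that the decay estimate applies at [X = j + 4]; the
   summand 4 leaves room for the subtraction of 2 in [N']. *)
have [j hj] := exponential_beats_power (q + 3) (K + 2 ^+ J + 4).
pose X := (j + 4)%N; have X0 : 0 < X%:R :> R by rewrite ltr0n /X addn4.
have X1 : 1 <= X%:R :> R by rewrite ler1n /X addn4.
have Xq n : 1 <= X%:R ^+ n :> R by rewrite exprn_ege1.
rewrite -/X in hj.
have P0 : 0 <= 2 ^+ J :> R by rewrite exprn_ge0.
have big4 : K * X%:R ^+ (q + 3) + 4 <= 2 ^+ j.
  apply: le_trans hj; have := Xq (q + 3)%N; nra.
have jJ : (J <= j)%N.
  rewrite leqNgt; apply/negP => lj; have : 2 ^+ J <= 2 ^+ j :> R.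
    apply: le_trans hj; have := Xq (q + 3)%N; nra.
  by rewrite leNgt ltr_eXn2l ?lj // ltr1n.
have j2 : (2 ^ j)%N = ((2 ^ j).-2).+2.
  have : 4 <= (2 ^ j)%:R :> R.
    rewrite natrX; apply: le_trans big4; rewrite lerDr mulr_ge0 // exprn_ge0 // ltW.
  by rewrite ler_nat; case: (2 ^ j)%N => [|[|]].
(* The family has [N'.+1 = 2 ^ j - 1] members, an index at which [theta] equals [1 / X] exactly. *)
set N' := (2 ^ j).-2 in j2.
have tN : theta N'.+1 = X%:R^-1 :> R by have := theta_pow (R := R) j; rewrite j2.
have count := singular_numbers_count ipH compT adj s_mono s0 orth eigen kernel
  (N := N'.+1) (f := fun m => g m) (A := pi) (B := 4 * pi / theta N'.+1) (X ^ q)%N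
  (ltW pi0) _ hg (fun m => test_sqnorm (remainder_gt0 m)) (fun m hm => gram_row hm).
have {}count : N'%:R * (X%:R ^- 2 / Z) <=
    s 0%N ^+ 2 * (X%:R ^+ q * (4 * pi * X%:R)) + (N'%:R + 1) * (x ^+ 2 / X%:R ^+ 2 * pi).
  apply: (le_trans (y := \sum_(m < N'.+1) sqnorm dirichlet_ip (T (g m)))).
    (* The member of index 0, to which the lower estimate does not apply, is discarded; [N'] members
       remain. *)
    rewrite big_ord_recl; apply: ler_wpDl; first exact/(sqnorm_ge0 ipH)/T_maps.
    rewrite -[X in X%:R * _]card_ord mulr_natl -sumr_const; apply: ler_sum => i _.
    apply: le_trans (lower (lift ord0 i) _); last by [].
    rewrite ler_wpM2r ?invr_ge0 ?(ltW Z0) // -exprVn -tN.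
    apply: lerXn2r; rewrite ?nnegrE ?(ltW (theta_gt0 _)) //.
    by apply: theta_decr; rewrite lift0 ltnS ltnW.
  apply: le_trans (count _) _.
    by rewrite divr_ge0 ?mulr_ge0 ?(ltW pi0) ?(ltW (theta_gt0 _)).
  rewrite tN invrK natrX (_ : N'.+1%:R = N'%:R + 1); last by rewrite natr1.
  apply: lerD => //.
  apply: ler_wpM2l; first by rewrite addr_ge0.
  rewrite ler_wpM2r ?(ltW pi0) // -expr_div_n.
  have JX : (J < X)%N by apply: leq_ltn_trans jJ _; rewrite /X -addn1 leq_add2l.
  apply: lerXn2r (decay X JX); rewrite nnegrE; first exact: s0.
  by apply: divr_ge0; exact: ltW.
have N'E : N'%:R = 2 ^+ j - 2 :> R.
  by rewrite -natrX j2 -addn2 natrD addrK.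
have KX : 0 <= K * X%:R ^+ (q + 3) by rewrite mulr_ge0 // exprn_ge0 // ltW.
have N'1 : 1 <= N'%:R :> R by rewrite N'E; lra.
have := growth_contradiction X0 Z0 (lt_le_trans ltr01 N'1) (sqr_ge0 _) N'1 x2 pi0 count.
have -> : 8 * pi * s 0%N ^+ 2 * Z * (X%:R ^+ q * X%:R ^+ 3) = K * X%:R ^+ (q + 3) / 2.
  by rewrite exprD /K; field.
by rewrite N'E; lra.
Qed.

End not_Schatten.

Theorem theorem3p4 (R : realType) :
  exists phi : R[i] -> R[i],
    [/\ schur_function phi,
        is_compact_operator dirichlet_space dirichlet_ip
          (composition_operator phi) &
        forall p : R, 0 < p ->
          ~ schatten_class dirichlet_space dirichlet_ip p
              (composition_operator phi)].
Proof.
exists symbol; split; [exact: symbol_schur|exact: T_compact|exact: not_Schatten].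
Qed.
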